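(* Let $A,B$ be $C^*$-algebras represented (non-degenerately) on Hilbert spaces $H,K$ respectively, such that the induced maps $\mathcal B(H)_*\to A^*$ and $\mathcal B(K)_*\to B^*$ (restriction of normal functionals) are both onto (for example, the universal representations). Regard $A^{**}\overline\otimes B^{**}$ as a subalgebra of $\mathcal B(H\otimes K)$. For $x\in A^{**}\overline\otimes B^{**}$ the following are equivalent: 1. $x,\ x^*x,\ xx^*\in SC(A\times B)$; 2. $x \in M(A^1\otimes \mathcal B_0(K);A\otimes \mathcal B_0(K))\cap M(\mathcal B_0(H) \otimes B^1;\mathcal B_0(H) \otimes B)$; 3. Let $(e_j)_{j\in J}$ be a fixed orthonormal basis of $K$, embed $A^{**}\overline\otimes B^{**}$ into $A^{**}\overline\otimes\mathcal B(K)$ and view $x=(x_{ij})_{i,j\in J}$ as a matrix with entries in $A^{**}$, $x_{ij}=(\mathrm{id}\otimes\omega_{e_j,e_i})(x)$. Then each $x_{ij}\in A$, and for each $i\in J$ both sums $\sum_{j} x_{ij}x_{ij}^*$ and $\sum_j x_{ji}^*x_{ji}$ are norm convergent. Moreover the same holds with the roles of $A$ and $B$ swapped (that is, using a fixed orthonormal basis $(f_i)_{i\in I}$ of $H$, viewing $x\in\mathcal B(H)\overline\otimes B^{**}$ as a matrix with entries $(\omega_{f_j,f_i}\otimes\mathrm{id})(x)\in B^{**}$, these entries lie in $B$ and the corresponding row and column sums are norm convergent).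
   Context: $\otimes$ between $C^*$-algebras is the minimal (spatial) tensor product, $\overline\otimes$ the von Neumann algebra tensor product. For a $C^*$-algebra $A$, $A^{**}$ is its enveloping von Neumann algebra (predual $A^*$); the predual of $A^{**}\overline\otimes B^{**}$ is the operator space projective tensor product $A^*\widehat\otimes B^*$, and slice maps are $\langle(\mu\otimes\mathrm{id})x,\lambda\rangle=\langle x,\mu\otimes\lambda\rangle=\langle(\mathrm{id}\otimes\lambda)x,\mu\rangle$ for $\mu\in A^*,\lambda\in B^*$, $x\in A^{**}\overline\otimes B^{**}$. View $A\subseteq A^{**}$, $B\subseteq B^{**}$. Define $$SC(A\times B)=\{x\in A^{**}\overline\otimes B^{**}: (\mu\otimes\mathrm{id})x\in B,\ (\mathrm{id}\otimes\lambda)x\in A\ (\mu\in A^*,\lambda\in B^* )\}.$$ $\mathcal B_0(H)$ denotes the compact operators; $\omega_{\xi,\eta}(x)=(x\xi|\eta)$. $M(C)$ is the multiplier algebra of a $C^*$-algebra $C$; for a closed two-sided ideal $I$ of $C$, $M(C;I)=\{x\in M(C): xC+Cx\subseteq I\}$. $A^1$ is the conditional unitisation ($A^1=A$ if $A$ is unital, otherwise $A$ with a unit adjoined). The algebras $A^1\otimes\mathcal B_0(K)$ and $\mathcal B_0(H)\otimes B^1$, and their multiplier algebras, are regarded as acting on $H\otimes K$ (so the multiplier algebras are idealisers in $\mathcal B(H\otimes K)$). Sums over an index set converge as nets over finite subsets. *)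

(* Defs.v *)
From HB Require Import structures.
From mathcomp Require Import all_boot all_order all_algebra finmap.
From mathcomp Require Import complex.
From mathcomp Require Import boolp classical_sets functions reals topology.
From mathcomp Require Import normedtype sequences.
From mathcomp.analysis.showcase Require Import summability.

Set Implicit Arguments.
Unset Strict Implicit.
Unset Printing Implicit Defensive.

Import Order.TTheory GRing.Theory Num.Theory.
Import numFieldNormedType.Exports.

Local Open Scope classical_set_scope.
Local Open Scope complex_scope.
Local Open Scope ring_scope.

(* Inner products are linear in the first variable. *)
HB.mixin Record CompleteNormedModule_isHilbert (R : realType) H
    & CompleteNormedModule R[i] H := {
  inner : H -> H -> R[i];
  inner_linearl : forall (c : R[i]) (x y z : H),
    inner (c *: x + y) z = c * inner x z + inner y z;
  inner_conj : forall x y : H, inner y x = (inner x y)^*%R;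
  inner_norm : forall x : H, inner x x = `|x| ^+ 2
}.

#[short(type="hilbertType")]
HB.structure Definition Hilbert (R : realType) :=
  {H of CompleteNormedModule R[i] H & CompleteNormedModule_isHilbert R H}.

(* C*-algebras are complex and not assumed unital. *)
HB.mixin Record CompleteNormedModule_isCStarAlgebra (R : realType) A
    & CompleteNormedModule R[i] A := {
  cmul : A -> A -> A;
  cstar : A -> A;
  cmulA : associative cmul;
  cmulDl : left_distributive cmul +%R;
  cmulDr : right_distributive cmul +%R;
  cmulZl : forall (c : R[i]) (a b : A), cmul (c *: a) b = c *: cmul a b;
  cmulZr : forall (c : R[i]) (a b : A), cmul a (c *: b) = c *: cmul a b;
  cstarD : {morph cstar : a b / a + b};
  cstarZ : forall (c : R[i]) (a : A), cstar (c *: a) = c^*%R *: cstar a;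
  cstarM : forall a b : A, cstar (cmul a b) = cmul (cstar b) (cstar a);
  cstarK : involutive cstar;
  cnormM : forall a b : A, `|cmul a b| <= `|a| * `|b|;
  cnorm_star : forall a : A, `|cmul (cstar a) a| = `|a| ^+ 2
}.

#[short(type="cstarAlgType")]
HB.structure Definition CStarAlgebra (R : realType) :=
  {A of CompleteNormedModule R[i] A & CompleteNormedModule_isCStarAlgebra R A}.

Definition unital (R : realType) (A : cstarAlgType R) : Prop :=
  exists u : A, forall a : A, cmul u a = a /\ cmul a u = a.

Definition lin_span (R : realType) (V : lmodType R[i]) (S : set V) : set V :=
  [set v | exists (n : nat) (c : 'I_n -> R[i]) (s : 'I_n -> V),
    (forall i, S (s i)) /\ v = \sum_(i < n) c i *: s i].

Section Operators.
Variables (R : realType) (H : hilbertType R).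
Implicit Types (T S : H -> H) (X : set (H -> H)).

(* B(H), as a set of functions *)
Definition bounded_op : set (H -> H) :=
  [set T | linear T /\ exists c : R[i], forall v, `|T v| <= c * `|v|].

(* By Riesz, the defining set is a singleton when T is bounded. *)
Definition adjoint T : H -> H :=
  xget (fun=> 0)
    [set S | bounded_op S /\ forall u v, inner (T u) v = inner u (S v)].

Definition compact_op : set (H -> H) :=
  [set T | bounded_op T /\ compact (closure (T @` [set v : H | `|v| <= 1]))].

Definition norm_closure X : set (H -> H) :=
  [set T | bounded_op T /\ forall e : R[i], 0 < e ->
    exists2 S, X S & forall v, `|T v - S v| <= e * `|v|].

(* B(H)_*: the functionals sum_n omega_{xi_n, eta_n} with sum_n |xi_n|^2 and
   sum_n |eta_n|^2 finite; only the values on B(H) are relevant. *)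
Definition normal_functional : set ((H -> H) -> R[i]) :=
  [set w : (H -> H) -> R[i] | exists xi eta : nat -> H,
    [/\ cvgn (series (fun n => `|xi n| ^+ 2)),
        cvgn (series (fun n => `|eta n| ^+ 2)) &
        forall T, bounded_op T ->
          series (fun n => inner (T (xi n)) (eta n)) @ \oo --> (w T : R[i]^o)]].

(* closure in B(H) for the weak-* topology sigma(B(H), B(H)_* ) *)
Definition weakstar_closure X : set (H -> H) :=
  [set T | bounded_op T /\
    forall (n : nat) (w : 'I_n -> (H -> H) -> R[i]) (e : R[i]),
      (forall i, normal_functional (w i)) -> 0 < e ->
      exists2 S, X S & forall i, `|w i T - w i S| < e].

Definition idealiser X : set (H -> H) :=
  [set x | bounded_op x /\ forall c, X c -> X (x \o c) /\ X (c \o x)].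

(* M(C; I), for C acting non-degenerately on H *)
Definition multiplier_into (C I : set (H -> H)) : set (H -> H) :=
  [set x | idealiser C x /\
    forall c d, C c -> C d -> I ((x \o c) \+ (d \o x))].

Definition orthonormal_basis (J : Type) (e : J -> H) : Prop :=
  [/\ forall j, inner (e j) (e j) = 1,
      forall j k, j <> k -> inner (e j) (e k) = 0 &
      closure (lin_span (range e)) = setT].

End Operators.

Arguments bounded_op {R} H.
Arguments compact_op {R} H.
Arguments normal_functional {R} H.

Section Representations.
Variables (R : realType) (A : cstarAlgType R).

Definition dual_space : set (A -> R[i]) :=
  [set mu | scalar mu /\ exists c : R[i], forall a, `|mu a| <= c * `|a|].

(* A^{**}; only the values on A^* are relevant. *)
Definition bidual : set ((A -> R[i]) -> R[i]) :=
  [set Phi |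
    (forall (k : R[i]) mu nu, dual_space mu -> dual_space nu ->
      Phi (fun a => k * mu a + nu a) = k * Phi mu + Phi nu) /\
    exists c : R[i], forall mu (m : R[i]), dual_space mu -> 0 <= m ->
      (forall a, `|mu a| <= m * `|a|) -> `|Phi mu| <= c * m].

Variable H : hilbertType R.

Definition representation (pi : A -> H -> H) : Prop :=
  [/\ forall a, bounded_op H (pi a),
      forall (c : R[i]) a b v, pi (c *: a + b) v = c *: pi a v + pi b v,
      forall a b, pi (cmul a b) = pi a \o pi b &
      forall a, pi (cstar a) = adjoint (pi a)].

Variable pi : A -> H -> H.

Definition nondegenerate_rep : Prop :=
  closure (lin_span [set w | exists a v, w = pi a v]) = setT.

Definition predual_onto : Prop :=
  forall mu, dual_space mu ->
    exists2 w, normal_functional H w & forall a, w (pi a) = mu a.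

(* T in B(H) is the image of Phi in A^{**} under the normal (weak-* continuous)
   extension A^{**} -> B(H) of pi, i.e. under the adjoint of the restriction map
   B(H)_* -> A^*. *)
Definition represents (Phi : (A -> R[i]) -> R[i]) (T : H -> H) : Prop :=
  bounded_op H T /\
  forall w, normal_functional H w -> w T = Phi (fun a => w (pi a)).

(* A^{**}, regarded inside B(H) *)
Definition enveloping : set (H -> H) :=
  [set T | exists2 Phi, bidual Phi & represents Phi T].

(* A^1, acting on H *)
Definition unitisation : set (H -> H) :=
  [set T | exists (a : A) (c : R[i]),
    (unital A -> c = 0) /\ T = (fun v => pi a v + c *: v)].

End Representations.

Section TensorProducts.
Variables (R : realType) (H K L : hilbertType R) (t : H -> K -> L).

(* (L, t) is a Hilbert space tensor product of H and K; this determines it up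
   to a unique unitary. *)
Definition hilbert_tensor : Prop :=
  [/\ forall (c : R[i]) h h' k, t (c *: h + h') k = c *: t h k + t h' k,
      forall (c : R[i]) h k k', t h (c *: k + k') = c *: t h k + t h k',
      forall h h' k k', inner (t h k) (t h' k') = inner h h' * inner k k' &
      closure (lin_span [set v | exists h k, v = t h k]) = setT].

(* For S, T bounded and hilbert_tensor, the defining set is a singleton. *)
Definition op_tensor (S : H -> H) (T : K -> K) : L -> L :=
  xget (fun=> 0)
    [set X | bounded_op L X /\ forall h k, X (t h k) = t (S h) (T k)].

Definition alg_tensor (X : set (H -> H)) (Y : set (K -> K)) : set (L -> L) :=
  lin_span [set Z | exists S T, [/\ X S, Y T & Z = op_tensor S T]].

Definition min_tensor (X : set (H -> H)) (Y : set (K -> K)) : set (L -> L) :=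
  norm_closure (alg_tensor X Y).

Definition vn_tensor (X : set (H -> H)) (Y : set (K -> K)) : set (L -> L) :=
  weakstar_closure (alg_tensor X Y).

(* T = (id (x) omega_{z, z'})(x) and T = (omega_{z, z'} (x) id)(x), where
   omega_{z, z'}(S) = (S z | z') *)
Definition vslicer (x : L -> L) (z z' : K) (T : H -> H) : Prop :=
  bounded_op H T /\
  forall u v, inner (T u) v = inner (x (t u z)) (t v z').

Definition vslicel (x : L -> L) (z z' : H) (T : K -> K) : Prop :=
  bounded_op K T /\
  forall u v, inner (T u) v = inner (x (t z u)) (t z' v).

Variables (A B : cstarAlgType R) (pi : A -> H -> H) (rho : B -> K -> K).

(* A^{**} (x) B^{**}, von Neumann algebra tensor product, inside B(L) *)
Definition env_tensor : set (L -> L) :=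
  vn_tensor (enveloping pi) (enveloping rho).

(* phi is the functional mu (x) lam of the predual of A^{**} (x) B^{**},
   extended to a normal functional on B(L); its restriction to
   A^{**} (x) B^{**} is determined by mu and lam. *)
Definition predual_tensor (mu : A -> R[i]) (lam : B -> R[i])
    (phi : (L -> L) -> R[i]) : Prop :=
  normal_functional L phi /\
  forall Phi Psi S T, bidual Phi -> bidual Psi ->
    represents pi Phi S -> represents rho Psi T ->
    phi (op_tensor S T) = Phi mu * Psi lam.

(* <x, mu (x) lam> = z *)
Definition pairing (x : L -> L) (mu : A -> R[i]) (lam : B -> R[i])
    (z : R[i]) : Prop :=
  exists2 phi, predual_tensor mu lam phi & phi x = z.

(* (mu (x) id) x = Psi in B^{**} and (id (x) lam) x = Phi in A^{**} *)
Definition slicel (mu : A -> R[i]) (x : L -> L)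
    (Psi : (B -> R[i]) -> R[i]) : Prop :=
  forall lam, dual_space lam -> pairing x mu lam (Psi lam).

Definition slicer (lam : B -> R[i]) (x : L -> L)
    (Phi : (A -> R[i]) -> R[i]) : Prop :=
  forall mu, dual_space mu -> pairing x mu lam (Phi mu).

(* a in A is viewed in A^{**} as evaluation at a. *)
Definition SC : set (L -> L) :=
  [set x | [/\ env_tensor x,
    forall mu, dual_space mu -> exists b : B, slicel mu x (fun lam => lam b) &
    forall lam, dual_space lam -> exists a : A, slicer lam x (fun mu => mu a)]].

End TensorProducts.

(* The matrix a has norm convergent row sums sum_j a_ij a_ij^* and column sums
   sum_j a_ji^* a_ji, as nets over finite subsets of the index set. *)
Definition row_col_summable (R : realType) (A : cstarAlgType R)
    (J : choiceType) (a : J -> J -> A) : Prop :=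
  forall i : J,
    cvg (partial_sum (fun j => cmul (a i j) (cstar (a i j))) @ totally) /\
    cvg (partial_sum (fun j => cmul (cstar (a j i)) (a j i)) @ totally).

(* Main.v *)
(** Write [V_z h = t h z], [x_ij = V_{e_i}^* x V_{e_j}] and let [P_F] be the projection of [H (x) K]
    onto [H (x) span {e_j : j in F}], [F] a finite set of indices. On the side of [A], each of the
    three conditions is equivalent to: every [x_ij] lies in [A], and
    [||(1 - P_F) x V_{e_j}|| -> 0] and [||(1 - P_F) x^* V_{e_j}|| -> 0] along the finite sets [F]
    ([tight_matrix]). The side of [B] follows by exchanging the two factors.

    - (3): [V_{e_j}^* x^* (1 - P_F) x V_{e_j}] is the tail of the series [sum_i x_ij^* x_ij].
    - (2): [A (x) B_0(K)] consists of the [y] with matrix entries in [A] such that [(1 - P_F) y -> 0]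
      and [(1 - P_F) y^* -> 0] in norm, because compact operators are norm limits of their
      compressions to finite sets of basis vectors.
    - (1) implies tightness: the sums [sum_{i in F} x_ij^* x_ij] increase weakly to the element
      [(x^* x)_jj] of [A]; by a Dini argument (Hahn-Banach on the convex set of upper bounds of the
      tails) the convergence is in norm. Conversely tightness makes [(x^* x)_ij] a norm limit of
      finite sums [sum_k x_ki^* x_kj], and slices by general normal functionals are norm limits of
      linear combinations of matrix entries.

    As every functional on [A] extends to a normal functional on B(H), the uniform boundedness
    principle shows that the representation is bounded below, so that [A] is closed in B(H). *)

Require Import Defs.
From HB Require Import structures.
From mathcomp Require Import all_boot all_order all_algebra finmap.
From mathcomp Require Import complex boolp classical_sets functions reals topology.
From mathcomp Require Import normedtype sequences interval_inference ring lra zify.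
From mathcomp.analysis.showcase Require Import summability.

Set Implicit Arguments.
Unset Strict Implicit.
Unset Printing Implicit Defensive.

Import Order.TTheory GRing.Theory Num.Theory.
Import numFieldNormedType.Exports.

Local Open Scope classical_set_scope.
Local Open Scope complex_scope.
Local Open Scope ring_scope.

(** The obstacle is that slices carry only weak information, while the other two conditions speak of
    norms. Surjectivity of the restriction map onto the dual of A bridges the gap: every functional
    on A is normal, so a bounded net converging weakly as operators converges weakly in A, where the
    Dini argument applies. Contractivity and the lower bound of the representation then carry norm
    estimates between A and B(H); no spectral theory is involved.

    Slices of x alone give only its entries; x^* x controls the columns and x x^* the rows.
    Tightness is asked of each column and row, not of x: for unital algebras and infinite
    dimensional K the identity has tight columns without being tight. Hence multipliers appear,
    rather than elements of A (x) B_0(K). The unitisation makes multiplication by 1 (x) e_jj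
    available, which cuts out a single column or row.

    A pairing with mu (x) lam is given by some normal extension to B(L); weak-* density of the
    algebraic tensor product makes its value unambiguous, so that vector functionals compute the
    matrix entries. *)

Section RealNorm.
Variable R : realType.
Implicit Type V : normedZmodType R[i].

(* Norms take values in [R[i]]; [nrm] is the same norm with values in [R]. *)
Definition nrm V (v : V) : R := complex.Re `|v|.

Lemma nrmE V (v : V) : `|v| = (nrm v)%:C.
Proof. by rewrite /nrm RRe_real ?normr_real. Qed.

Lemma nrm_ge0 V (v : V) : 0 <= nrm v.
Proof. by rewrite -lecR -nrmE normr_ge0. Qed.

Lemma nrm0 V : nrm (0 : V) = 0.
Proof. by rewrite /nrm normr0. Qed.

Lemma nrm_eq0 V (v : V) : nrm v = 0 -> v = 0.
Proof. by move=> h; apply/eqP; rewrite -normr_eq0 nrmE h. Qed.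

Lemma nrmN V (v : V) : nrm (- v) = nrm v.
Proof. by rewrite /nrm normrN. Qed.

Lemma nrmBC V (v w : V) : nrm (v - w) = nrm (w - v).
Proof. by rewrite /nrm distrC. Qed.

Lemma nrmD V (v w : V) : nrm (v + w) <= nrm v + nrm w.
Proof. by rewrite -lecR rmorphD /= -!nrmE ler_normD. Qed.

Lemma nrm_tri V (u v w : V) : nrm (u - w) <= nrm (u - v) + nrm (v - w).
Proof. by apply: le_trans (nrmD _ _); rewrite addrA subrK. Qed.

Lemma nrm_sub V (v w : V) : nrm v - nrm w <= nrm (v - w).
Proof. by rewrite lerBlDr; apply: le_trans (nrmD _ _); rewrite subrK. Qed.

Lemma nrm_sum V (I : Type) (r : seq I) (P : pred I) (F : I -> V) :
  nrm (\sum_(i <- r | P i) F i) <= \sum_(i <- r | P i) nrm (F i).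
Proof.
elim/big_rec2: _ => [|i y x _ h]; first by rewrite nrm0.
by apply: le_trans (nrmD _ _) _; rewrite lerD2l.
Qed.

Lemma nrmM (a b : R[i]) : nrm (a * b) = nrm a * nrm b.
Proof. by apply: complexI; rewrite rmorphM /= -!nrmE normrM. Qed.

Lemma nrm_conj (a : R[i]) : nrm (a^*%R) = nrm a.
Proof. by rewrite /nrm norm_conjC. Qed.

Lemma nrmR (r : R) : nrm (r%:C) = `|r|.
Proof. by apply: complexI; rewrite -nrmE normc_def /= expr0n /= addr0 sqrtr_sqr. Qed.

Lemma nrmZ (V : normedModType R[i]) (a : R[i]) (v : V) : nrm (a *: v) = nrm a * nrm v.
Proof. by apply: complexI; rewrite rmorphM /= -!nrmE normrZ. Qed.

Lemma Re_le_nrm (a : R[i]) : complex.Re a <= nrm a.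
Proof. by rewrite -lecR -nrmE; apply: le_trans (normc_ge_Re a); rewrite lecR ler_norm. Qed.

Lemma nrm_Re (a : R[i]) : `|complex.Re a| <= nrm a.
Proof. by rewrite -lecR -nrmE normc_ge_Re. Qed.

Lemma nrm_sqrt (a : R[i]) : nrm a = Num.sqrt (complex.Re a ^+ 2 + complex.Im a ^+ 2).
Proof. by rewrite /nrm normc_def. Qed.

Lemma nrm_Im (a : R[i]) : `|complex.Im a| <= nrm a.
Proof. by rewrite nrm_sqrt -sqrtr_sqr ler_wsqrtr // lerDr sqr_ge0. Qed.

Lemma nrm_ReIm (a : R[i]) : nrm a <= `|complex.Re a| + `|complex.Im a|.
Proof.
rewrite {1}[a]complexE; apply: le_trans (nrmD _ _) _.
by rewrite nrmM !nrmR nrm_sqrt /= expr0n expr1n /= add0r sqrtr1 mul1r.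
Qed.

(** The constants in the definitions range over [R[i]]. The order there forces the product on the
    right to be real and nonnegative, but leaves [c] arbitrary when [w] is zero; so [c] is replaced
    by its modulus. *)
Lemma nrm_leP V (W : normedZmodType R[i]) (c : R[i]) (v : V) (w : W) :
  `|v| <= c * `|w| -> nrm v <= nrm c * nrm w.
Proof.
move=> h; rewrite -lecR rmorphM /= -!nrmE.
have h0 : 0 <= c * `|w| by apply: le_trans h.
by rewrite (le_trans h) // -{1}(ger0_norm h0) normrM normr_id.
Qed.

Lemma nrm_leC V (v : V) (c : R) : (`|v| <= c%:C) = (nrm v <= c).
Proof. by rewrite nrmE lecR. Qed.

Lemma nrm_leCM V (W : normedZmodType R[i]) (v : V) (w : W) (c : R) :
  (`|v| <= c%:C * `|w|) = (nrm v <= c * nrm w).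
Proof. by rewrite !nrmE -rmorphM lecR. Qed.

Lemma posC (e : R[i]) : 0 < e -> exists2 r : R, 0 < r & e = r%:C.
Proof.
move=> e0; exists (complex.Re e); last by rewrite RRe_real // gtr0_real.
by rewrite -ltcR RRe_real // gtr0_real.
Qed.

Lemma invS_small (e : R) : 0 < e -> exists N, forall n, (N <= n)%N -> n.+1%:R^-1 <= e.
Proof.
move=> e0; have [N _ hN] := near_infty_natSinv_lt (PosNum e0).
by exists N => n /hN/ltW.
Qed.

Lemma nrm_small V (v : V) : (forall e : R, 0 < e -> nrm v <= e) -> v = 0.
Proof.
move=> h; apply: nrm_eq0; apply: le_anti; rewrite nrm_ge0 andbT.
by apply/ler_addgt0Pr => e e0; rewrite add0r h.
Qed.

Lemma nrm_close V (v w : V) : (forall e : R, 0 < e -> nrm (v - w) <= e) -> v = w.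
Proof. by move=> h; apply/eqP; rewrite -subr_eq0; apply/eqP/nrm_small. Qed.

End RealNorm.

(** * Limits of sequences and nets through real-valued norms *)

Section Convergence.
Variable R : realType.

Lemma cvg_nrmP (V : pseudoMetricNormedZmodType R[i]) (T : Type) (F : set_system T)
    (FF : Filter F) (f : T -> V) (l : V) :
  (f x @[x --> F] --> l) <->
  (forall e : R, 0 < e -> \forall x \near F, nrm (l - f x) <= e).
Proof.
split=> [/cvgrPdist_le h e e0|h].
  have := h e%:C; rewrite ltcR => /(_ e0); apply: filterS => x.
  by rewrite nrm_leC.
apply/cvgrPdist_le => e /posC[r r0 ->]; have := h r r0; apply: filterS => x.
by rewrite nrm_leC.
Qed.

Lemma cvg_seqP (V : pseudoMetricNormedZmodType R[i]) (f : nat -> V) (l : V) :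
  (f x @[x --> \oo] --> l) <->
  (forall e : R, 0 < e -> exists N, forall n, (N <= n)%N -> nrm (l - f n) <= e).
Proof.
split=> [/cvg_nrmP h e e0|h]; first by have [N _ hN] := h e e0; exists N.
by apply/cvg_nrmP => e /h[N hN]; exists N.
Qed.

Lemma cvg_netP (V : pseudoMetricNormedZmodType R[i]) (J : choiceType)
    (f : {fset J} -> V) (l : V) :
  (f x @[x --> totally] --> l) <->
  (forall e : R, 0 < e ->
     exists F0, forall F, (F0 `<=` F)%fset -> nrm (l - f F) <= e).
Proof.
have TF := @totally_filter J.
split=> [/cvg_nrmP h e e0|h]; first by have [N _ hN] := h e e0; exists N.
by apply/cvg_nrmP => e /h[N hN]; exists N.
Qed.

Lemma cauchy_cvg (V : completeNormedModType R[i]) (T : Type) (F : set_system T)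
    (FF : ProperFilter F) (f : T -> V) :
  (forall e : R, 0 < e -> exists x, \forall y \near F, nrm (f x - f y) <= e) ->
  cvg (f x @[x --> F]).
Proof.
move=> h; apply/cauchy_cvgP; apply: cauchy_exP => e /posC[r r0 ->].
have [|x hx] := h (r / 2); first by rewrite divr_gt0.
exists (f x); apply: filterS hx => y /= hy; rewrite -ball_normE /=.
by rewrite nrmE ltcR (le_lt_trans hy) // ltr_pdivrMr // ltr_pMr // ltr1n.
Qed.

Lemma cauchy_net (V : completeNormedModType R[i]) (J : choiceType)
    (f : {fset J} -> V) :
  (forall e : R, 0 < e -> exists F0, forall F, (F0 `<=` F)%fset ->
    nrm (f F0 - f F) <= e) -> cvg (f x @[x --> totally]).
Proof.
move=> h; apply: cauchy_cvg; first exact: totally_filter.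
by move=> e /h[F0 hF0]; exists F0; exists F0.
Qed.

Lemma cauchy_seq (V : completeNormedModType R[i]) (f : nat -> V) :
  (forall e : R, 0 < e -> exists N, forall n, (N <= n)%N ->
    nrm (f N - f n) <= e) -> exists l : V, f x @[x --> \oo] --> l.
Proof.
move=> h; have : cvg (f x @[x --> \oo]); last by move=> ?; exists (lim (f x @[x --> \oo])).
by apply: cauchy_cvg => e /h[N hN]; exists N; exists N.
Qed.

Lemma densityP (V : normedModType R[i]) (S : set V) : closure S = setT ->
  forall v (e : R), 0 < e -> exists2 s, S s & nrm (v - s) <= e.
Proof.
move=> h v e e0; have : closure S v by rewrite h.
move=> /(_ (ball v e%:C)) []; first by apply: nbhsx_ballx; rewrite ltcR.
move=> s [Ss]; rewrite -ball_normE /= nrmE ltcR => /ltW hs.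
by exists s.
Qed.

End Convergence.

Section Eventually.
Variable J : choiceType.
Implicit Types F G : {fset J}.

(** Membership in the filter [totally], unfolded, so that finitely many approximations can be
    combined at one finite set without reference to a topology. *)
Definition evt (P : {fset J} -> Prop) := exists F0, forall F, (F0 `<=` F)%fset -> P F.

Lemma evtI P Q : evt P -> evt Q -> evt (fun F => P F /\ Q F).
Proof.
move=> [F hF] [G hG]; exists (F `|` G)%fset => E; rewrite fsubUset => /andP[? ?].
by split; [apply: hF|apply: hG].
Qed.

Lemma evtW (P Q : {fset J} -> Prop) : (forall F, P F -> Q F) -> evt P -> evt Q.
Proof. by move=> h [F hF]; exists F => G /hF/h. Qed.

Lemma evtE (P : {fset J} -> Prop) : evt P -> exists F, P F.
Proof. by move=> [F hF]; exists F; exact: hF. Qed.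

Lemma evt_seq (T : eqType) (r : seq T) (P : T -> {fset J} -> Prop) :
  (forall x, x \in r -> evt (P x)) -> evt (fun F => forall x, x \in r -> P x F).
Proof.
elim: r => [|y r IH] h; first by exists fset0.
have h1 : evt (P y) by apply: h; rewrite inE eqxx.
have h2 : evt (fun F => forall x, x \in r -> P x F).
  by apply: IH => x hx; apply: h; rewrite inE hx orbT.
apply: evtW (evtI h1 h2) => F [h3 h4] x; rewrite inE => /orP[/eqP->//|].
exact: h4.
Qed.

Lemma evt_ord n (P : 'I_n -> {fset J} -> Prop) :
  (forall x, evt (P x)) -> evt (fun F => forall x, P x F).
Proof.
move=> h; have := @evt_seq _ (enum 'I_n) P (fun x _ => h x).
by apply: evtW => F hF x; apply: hF; rewrite mem_enum.
Qed.

End Eventually.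

(** * Hilbert spaces and bounded operators *)

Section InnerProduct.
Variables (R : realType) (H : hilbertType R).
Implicit Types (u v w : H) (c : R[i]).

Lemma innerDl u v w : inner (u + v) w = inner u w + inner v w.
Proof. by have := inner_linearl 1 u v w; rewrite scale1r mul1r. Qed.

Lemma inner0l w : inner 0 w = 0.
Proof. by apply: (addIr (inner 0 w)); rewrite -innerDl addr0 add0r. Qed.

Lemma innerZl c u w : inner (c *: u) w = c * inner u w.
Proof. by have := inner_linearl c u 0 w; rewrite inner0l !addr0. Qed.

Lemma innerNl u w : inner (- u) w = - inner u w.
Proof. by rewrite -scaleN1r innerZl mulN1r. Qed.

Lemma innerBl u v w : inner (u - v) w = inner u w - inner v w.
Proof. by rewrite innerDl innerNl. Qed.

Lemma innerDr u v w : inner w (u + v) = inner w u + inner w v.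
Proof. by rewrite inner_conj innerDl rmorphD /= -!inner_conj. Qed.

Lemma inner0r w : inner w 0 = 0.
Proof. by rewrite inner_conj inner0l rmorph0. Qed.

Lemma innerZr c u w : inner w (c *: u) = c^*%R * inner w u.
Proof. by rewrite inner_conj innerZl rmorphM /= -inner_conj. Qed.

Lemma innerNr u w : inner w (- u) = - inner w u.
Proof. by rewrite inner_conj innerNl rmorphN /= -inner_conj. Qed.

Lemma innerBr u v w : inner w (u - v) = inner w u - inner w v.
Proof. by rewrite innerDr innerNr. Qed.

Lemma inner_suml (I : Type) (r : seq I) (P : pred I) (F : I -> H) w :
  inner (\sum_(i <- r | P i) F i) w = \sum_(i <- r | P i) inner (F i) w.
Proof.
by elim/big_rec2: _ => [|i y x _ <-]; rewrite ?inner0l // innerDl.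
Qed.

Lemma inner_sumr (I : Type) (r : seq I) (P : pred I) (F : I -> H) w :
  inner w (\sum_(i <- r | P i) F i) = \sum_(i <- r | P i) inner w (F i).
Proof.
by elim/big_rec2: _ => [|i y x _ <-]; rewrite ?inner0r // innerDr.
Qed.

Lemma inner_nrm u : inner u u = (nrm u ^+ 2)%:C.
Proof. by rewrite inner_norm nrmE rmorphXn. Qed.

Lemma Re_inner_nrm u : complex.Re (inner u u) = nrm u ^+ 2.
Proof. by rewrite inner_nrm. Qed.

Lemma Re_innerC u v : complex.Re (inner u v) = complex.Re (inner v u).
Proof. by rewrite inner_conj; case: (inner v u). Qed.

Lemma nrm_sqD u v :
  nrm (u + v) ^+ 2 = nrm u ^+ 2 + 2 * complex.Re (inner u v) + nrm v ^+ 2.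
Proof.
rewrite -!Re_inner_nrm innerDl !innerDr !raddfD /= [X in _ + (X + _)]Re_innerC; ring.
Qed.

Lemma nrm_sqB u v :
  nrm (u - v) ^+ 2 = nrm u ^+ 2 - 2 * complex.Re (inner u v) + nrm v ^+ 2.
Proof. by rewrite nrm_sqD nrmN innerNr raddfN mulrN. Qed.

Lemma inner_eq0 u : inner u u = 0 -> u = 0.
Proof.
by rewrite inner_nrm => -[] /eqP; rewrite sqrf_eq0 => /eqP/nrm_eq0.
Qed.

Lemma nrm_innerC u v : nrm (inner u v) = nrm (inner v u).
Proof. by rewrite inner_conj /nrm norm_conjC. Qed.

Lemma CauchySchwarz u v : nrm (inner u v) <= nrm u * nrm v.
Proof.
have [->|v0] := eqVneq v 0; first by rewrite inner0r !nrm0 mulr0.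
have nv : 0 < nrm v.
  by rewrite lt_def nrm_ge0 andbT; apply: contra v0 => /eqP/nrm_eq0 ->.
pose a := inner u v; pose n := nrm v ^+ 2.
have n0 : 0 < n by rewrite exprn_gt0.
have := sqr_ge0 (nrm (n%:C *: u - a *: v)).
rewrite nrm_sqB !nrmZ innerZl innerZr -/a [a^*%R * a]mulrC -normCK nrmE -rmorphXn.
rewrite nrmR (gtr0_norm n0) -!rmorphM /= !exprMn -/n => h.
have {}h : n * nrm a ^+ 2 <= n * (nrm u ^+ 2 * n).
  by move: h; set p := nrm a ^+ 2; set r := nrm u ^+ 2 => h; nra.
rewrite ler_pM2l // in h; rewrite -ler_sqr ?nnegrE ?nrm_ge0 ?mulr_ge0 ?nrm_ge0 //.
by rewrite exprMn.
Qed.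

Lemma inner_ext u v : (forall w, inner w u = inner w v) -> u = v.
Proof.
move=> h; apply/eqP; rewrite -subr_eq0; apply/eqP/inner_eq0.
by rewrite innerBr !h subrr.
Qed.

Lemma nrm_le_inner u (M : R) : 0 <= M ->
  (forall v, nrm (inner u v) <= M * nrm v) -> nrm u <= M.
Proof.
move=> M0 h; have := h u; rewrite inner_nrm nrmR ger0_norm ?sqr_ge0 // expr2.
have [->//|u0] := eqVneq (nrm u) 0.
by rewrite ler_pM2r // lt_def u0 nrm_ge0.
Qed.

End InnerProduct.

(** * The Riesz representation theorem *)

Section Riesz.
Variables (R : realType) (H : hilbertType R) (phi : H -> R[i]) (M : R).
Hypothesis phi_linear : forall (c : R[i]) u v, phi (c *: u + v) = c * phi u + phi v.
Hypothesis phi_bound : forall v, nrm (phi v) <= M * nrm v.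

Let q (v : H) := complex.Re (phi v).
(** If [phi] is [inner _ w], this is |v - w|^2 - |w|^2; the representing vector is therefore sought
    as a minimiser. *)
Let J (v : H) := nrm v ^+ 2 - 2 * q v.

Let phiD u v : phi (u + v) = phi u + phi v.
Proof. by have := phi_linear 1 u v; rewrite scale1r mul1r. Qed.

Let phi0 : phi 0 = 0.
Proof. by apply: (addIr (phi 0)); rewrite -phiD addr0 add0r. Qed.

Let phiZ c u : phi (c *: u) = c * phi u.
Proof. by have := phi_linear c u 0; rewrite phi0 !addr0. Qed.

Let qZ (t : R) u : q (t%:C *: u) = t * q u.
Proof. by rewrite /q phiZ; case: (phi u) => a b /=; rewrite mul0r subr0. Qed.

Let qD u v : q (u + v) = q u + q v.
Proof. by rewrite /q phiD raddfD. Qed.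

Let q_le v : q v <= M * nrm v.
Proof. exact: le_trans (Re_le_nrm _) (phi_bound v). Qed.

Let J_ge v : - M ^+ 2 <= J v.
Proof. by have := q_le v; have := sqr_ge0 (nrm v - M); rewrite /J; nra. Qed.

Let d := inf (range J).

Let J_has_inf : has_inf (range J).
Proof. by split; [exists (J 0); exists 0|exists (- M ^+ 2) => _ [v _ <-]; exact: J_ge]. Qed.

Let d_le v : d <= J v.
Proof. by apply: ge_inf; [exact: (proj2 J_has_inf)|exists v]. Qed.

(* parallelogram identity for the quadratic functional [J] *)
Let J_close u v (e : R) : J u <= d + e -> J v <= d + e -> nrm (u - v) ^+ 2 <= 4 * e.
Proof.
move=> hu hv; have := d_le ((2^-1)%:C *: (u + v)).
have i2 : nrm (2^-1 : R)%:C = 2^-1 by rewrite nrmR ger0_norm // invr_ge0 ler0n.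
rewrite /J nrmZ qZ qD exprMn i2 nrm_sqB nrm_sqD.
move: hu hv; rewrite /J.
set a := nrm u ^+ 2; set b := nrm v ^+ 2; set c := complex.Re _; set k := q u; set l := q v.
by move=> *; lra.
Qed.

Let J_inf : exists w, J w <= d.
Proof.
have hex n : exists v, J v <= d + n.+1%:R^-1.
  have [|_ [v _ <-] /ltW hv] := @inf_adherent _ (range J) n.+1%:R^-1 _ J_has_inf.
    by rewrite invr_gt0 ltr0n.
  by exists v.
have [f hf] := choice hex.
have [w hw] : exists l : H, f x @[x --> \oo] --> l.
  apply: cauchy_seq => e e0.
  have [|N hN] := @invS_small R (e ^+ 2 / 4); first by rewrite divr_gt0 // exprn_gt0.
  exists N => n Nn; rewrite -ler_sqr ?nnegrE ?nrm_ge0 ?(ltW e0) //.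
  rewrite (_ : e ^+ 2 = 4 * (e ^+ 2 / 4)); last by field.
  by apply: J_close; apply: le_trans (hf _) _; rewrite lerD2l hN.
exists w; apply/ler_addgt0Pr => e e0.
(* Expanding |w - (w - f n)|^2 shows that [J w] exceeds [J (f n)] by at most 2 (|w| + |M|) |w - f
   n|. *)
have k0 : 0 < 2 * (nrm w + `|M| + 1).
  by rewrite mulr_gt0 // ltr_wpDl // addr_ge0 ?nrm_ge0.
have [N1 h1] := proj1 (cvg_seqP _ _) hw (e / 2 / (2 * (nrm w + `|M| + 1))) ltac:(by rewrite !divr_gt0).
have [N2 h2] := @invS_small R (e / 2) ltac:(by rewrite divr_gt0).
pose n := maxn N1 N2; have {}h1 := h1 n (leq_maxl _ _); have {}h2 := h2 n (leq_maxr _ _).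
have {}hf := hf n; rewrite ler_pdivlMr // in h1.
set v := f n in hf h1.
have := nrm_sqB w (w - v); rewrite subKr => hs.
have qv : q v = q w - q (w - v).
  have e1 : q w = q (w - v) + q v by rewrite -qD subrK.
  by rewrite e1 addrAC subrr add0r.
have c1 : complex.Re (inner w (w - v)) <= nrm w * nrm (w - v).
  exact: le_trans (Re_le_nrm _) (CauchySchwarz _ _).
have c2 : - q (w - v) <= `|M| * nrm (w - v).
  rewrite -raddfN -nrmN /= /q; apply: le_trans (Re_le_nrm _) _.
  rewrite nrmN; apply: le_trans (_ : M * nrm (w - v) <= _).
    by rewrite /nrm normrN -/(nrm _) phi_bound.
  by rewrite ler_wpM2r ?nrm_ge0 ?ler_norm.
move: hf; rewrite /J hs qv.
have := sqr_ge0 (nrm (w - v)); have := nrm_ge0 (w - v).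
set a := nrm (w - v) in h1 c1 c2 *; set b := nrm w in h1 c1 c2 *; set c := `|M| in h1 c2 *.
set x := complex.Re _ in c1 *; set y := q (w - v) in c2 *; set z := n.+1%:R^-1 in h2 *.
by rewrite -/b => *; nra.
Qed.

(** First variation: along the line w + t v, minimality makes a quadratic polynomial in [t] without
    constant term nonnegative, so its linear coefficient vanishes. *)
Let J_var w v : J w <= d -> complex.Re (inner v w) = q v.
Proof.
move=> hw; apply/eqP; rewrite -subr_eq0; apply/eqP.
set x := _ - _.
have h (t : R) : 0 <= 2 * t * x + t ^+ 2 * nrm v ^+ 2.
  have := le_trans hw (d_le (w + t%:C *: v)).
  rewrite /J nrm_sqD qD qZ nrmZ exprMn nrmR real_normK ?num_real // Re_innerC innerZl.
  by rewrite /x; case: (inner v w) => a b /=; rewrite mul0r subr0; lra.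
set b := nrm v ^+ 2 in h; have b0 : 0 <= b by rewrite sqr_ge0.
(* The vertex of the parabola is at [- x / b]; with [b + 1] there is no division by zero, and the
   value is still negative unless [x = 0]. *)
have := h (- x / (b + 1)); rewrite exprMn sqrrN => {}h.
have b1 : 0 < b + 1 by rewrite ltr_wpDl.
have : 0 <= - (x ^+ 2 * (b + 2)).
  have -> : - (x ^+ 2 * (b + 2)) =
    (2 * (- x / (b + 1)) * x + x ^+ 2 * (b + 1)^-1 ^+ 2 * b) * (b + 1) ^+ 2.
    by field; rewrite lt0r_neq0.
  by rewrite mulr_ge0 // sqr_ge0.
rewrite oppr_ge0 pmulr_lle0 ?ltr_wpDl // => h2; apply/eqP; rewrite -sqrf_eq0.
by rewrite eq_le h2 sqr_ge0.
Qed.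

Lemma Riesz : exists w, forall v, phi v = inner v w.
Proof.
have [w hw] := J_inf; exists w => v.
(* Since the real part of i z is minus the imaginary part of z, the instance at ['i *: v] settles
   the imaginary parts. *)
have hre := J_var v hw; have := J_var ('i%C *: v) hw.
rewrite /q phiZ innerZl => him; apply/eqP; rewrite eq_complex -/(q v) -hre eqxx /=.
move: him; case: (inner v w) => a b; case: (phi v) => c e /=.
by rewrite !mul0r !mul1r !sub0r => /oppr_inj ->.
Qed.

End Riesz.

Reserved Notation "S \oB T" (at level 40, left associativity).

(** * Bounded operators and their norm *)

Section BoundedOperators.
Variable R : realType.
Implicit Types U V W : normedModType R[i].

(** Unlike [bounded_op], this allows distinct source and target, as the maps from H to the tensor
    product require. Proof irrelevance reduces equality to equality of values. *)
Record bop U V := Bop {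
  bfun :> U -> V;
  bfun_linear : linear bfun;
  bfun_bounded : exists2 M : R, 0 <= M & forall v, nrm (bfun v) <= M * nrm v }.

HB.instance Definition _ U V (T : bop U V) :=
  GRing.isLinear.Build R[i] U V _ (bfun T) (@bfun_linear _ _ T).

Lemma bop_ext U V (S T : bop U V) : (forall v, S v = T v) -> S = T.
Proof.
case: S T => [f lf bf] [g lg bg] /= /funext h; move: lf bf; rewrite h => lf bf.
by congr Bop; exact: Prop_irrelevance.
Qed.

HB.instance Definition _ U V := gen_eqMixin (bop U V).
HB.instance Definition _ U V := gen_choiceMixin (bop U V).

Section Operations.
Variables U V : normedModType R[i].
Implicit Types S T : bop U V.

Lemma bop0_linear : linear ((fun=> 0) : U -> V).
Proof. by move=> c u v; rewrite scaler0 addr0. Qed.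

Lemma bop0_bounded : exists2 M : R, 0 <= M & forall v : U, nrm (0 : V) <= M * nrm v.
Proof. by exists 0 => // v; rewrite nrm0 mul0r. Qed.

Definition bop0 := Bop bop0_linear bop0_bounded.

Lemma bopD_linear S T : linear (fun v => S v + T v).
Proof. by move=> c u v; rewrite !linearP scalerDr addrACA. Qed.

Lemma bopD_bounded S T :
  exists2 M : R, 0 <= M & forall v, nrm (S v + T v) <= M * nrm v.
Proof.
have [M M0 hM] := bfun_bounded S; have [N N0 hN] := bfun_bounded T.
exists (M + N); first exact: addr_ge0.
by move=> v; rewrite mulrDl; apply: le_trans (nrmD _ _) _; rewrite lerD.
Qed.

Definition bopD S T := Bop (bopD_linear S T) (bopD_bounded S T).

Lemma bopZ_linear c T : linear (fun v => c *: T v).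
Proof. by move=> d u v; rewrite linearP scalerDr !scalerA mulrC. Qed.

Lemma bopZ_bounded (c : R[i]) T :
  exists2 M : R, 0 <= M & forall v, nrm (c *: T v) <= M * nrm v.
Proof.
have [M M0 hM] := bfun_bounded T.
exists (nrm c * M); first by rewrite mulr_ge0 ?nrm_ge0.
by move=> v; rewrite nrmZ -mulrA ler_wpM2l ?nrm_ge0.
Qed.

Definition bopZ c T := Bop (bopZ_linear c T) (bopZ_bounded c T).

Let addA : associative bopD.
Proof. by move=> S T Z; apply: bop_ext => v /=; rewrite addrA. Qed.
Let addC : commutative bopD.
Proof. by move=> S T; apply: bop_ext => v /=; rewrite addrC. Qed.
Let add0 : left_id bop0 bopD.
Proof. by move=> T; apply: bop_ext => v /=; rewrite add0r. Qed.
Let addN : left_inverse bop0 (bopZ (-1)) bopD.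
Proof. by move=> T; apply: bop_ext => v /=; rewrite scaleN1r addNr. Qed.

HB.instance Definition _ := GRing.isZmodule.Build (bop U V) addA addC add0 addN.

Let scaleA a b T : bopZ a (bopZ b T) = bopZ (a * b) T.
Proof. by apply: bop_ext => v /=; rewrite scalerA. Qed.
Let scale1 : left_id 1 bopZ.
Proof. by move=> T; apply: bop_ext => v /=; rewrite scale1r. Qed.
Let scaleDr : right_distributive bopZ +%R.
Proof. by move=> a S T; apply: bop_ext => v /=; rewrite scalerDr. Qed.
Let scaleDl T : {morph bopZ^~ T : a b / a + b}.
Proof. by move=> a b; apply: bop_ext => v /=; rewrite scalerDl. Qed.

HB.instance Definition _ :=
  GRing.Zmodule_isLmodule.Build R[i] (bop U V) scaleA scale1 scaleDr scaleDl.

Lemma bopLD T u v : T (u + v) = T u + T v. Proof. exact: linearD. Qed.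
Lemma bopLB T u v : T (u - v) = T u - T v. Proof. exact: linearB. Qed.
Lemma bopLZ T c v : T (c *: v) = c *: T v. Proof. exact: linearZ. Qed.
Lemma bopL_sum T (I : Type) (r : seq I) (P : pred I) (F : I -> U) :
  T (\sum_(i <- r | P i) F i) = \sum_(i <- r | P i) T (F i).
Proof. exact: linear_sum. Qed.
Lemma bopDE S T v : (S + T) v = S v + T v. Proof. by []. Qed.
Lemma bopZE c T v : (c *: T) v = c *: T v. Proof. by []. Qed.
Lemma bop0E v : (0 : bop U V) v = 0. Proof. by []. Qed.
Lemma bopNE T v : (- T) v = - T v. Proof. exact: scaleN1r. Qed.
Lemma bopBE S T v : (S - T) v = S v - T v. Proof. by rewrite bopDE bopNE. Qed.
Lemma bop_sumE (I : Type) (r : seq I) (P : pred I) (F : I -> bop U V) v :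
  (\sum_(i <- r | P i) F i) v = \sum_(i <- r | P i) F i v.
Proof. by elim/big_rec2: _ => [|i y x _ <-]. Qed.

(** The operator norm as the least Lipschitz constant; compared with a supremum over unit vectors,
    the zero space is no exception. *)
Definition opn T : R := inf [set M : R | 0 <= M /\ forall v, nrm (T v) <= M * nrm v].

Let opn_inf T : has_inf [set M : R | 0 <= M /\ forall v, nrm (T v) <= M * nrm v].
Proof.
split; last by exists 0 => M [].
by have [M M0 hM] := bfun_bounded T; exists M.
Qed.

Lemma opn_ge0 T : 0 <= opn T.
Proof. by apply: lb_le_inf; [exact: (opn_inf T).1|move=> M []]. Qed.

Lemma opn_le T (M : R) : 0 <= M -> (forall v, nrm (T v) <= M * nrm v) -> opn T <= M.
Proof. by move=> M0 hM; apply: ge_inf => //; exact: (opn_inf T).2. Qed.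

Lemma opnP T v : nrm (T v) <= opn T * nrm v.
Proof.
have [v0|v0] := eqVneq (nrm v) 0.
  by have -> : v = 0 by [apply: nrm_eq0]; rewrite linear0 !nrm0 mulr0.
have vp : 0 < nrm v by rewrite lt_def v0 nrm_ge0.
rewrite -ler_pdivrMr //; apply: lb_le_inf; first exact: (opn_inf T).1.
by move=> M [M0 hM]; rewrite ler_pdivrMr.
Qed.

Lemma opnD S T : opn (S + T) <= opn S + opn T.
Proof.
apply: opn_le => [|v]; first by rewrite addr_ge0 ?opn_ge0.
by rewrite mulrDl; apply: le_trans (nrmD _ _) _; rewrite lerD ?opnP.
Qed.

Lemma opn0 : opn (0 : bop U V) = 0.
Proof.
by apply: le_anti; rewrite opn_ge0 andbT opn_le // => v; rewrite nrm0 mul0r.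
Qed.

Lemma opnZ_le c T : opn (c *: T) <= nrm c * opn T.
Proof.
apply: opn_le => [|v]; first by rewrite mulr_ge0 ?nrm_ge0 ?opn_ge0.
by rewrite nrmZ -mulrA ler_wpM2l ?nrm_ge0 ?opnP.
Qed.

Lemma opnN T : opn (- T) = opn T.
Proof.
suff h S : opn (- S) <= opn S by apply: le_anti; rewrite h -{1}[T]opprK h.
by apply: opn_le => [|v]; rewrite ?opn_ge0 // bopNE nrmN opnP.
Qed.

Lemma opnBC S T : opn (S - T) = opn (T - S).
Proof. by rewrite -opnN opprB. Qed.

Lemma opnB S T : opn (S - T) <= opn S + opn T.
Proof. by rewrite -[opn T]opnN opnD. Qed.

Lemma opn_tri S T Z : opn (S - Z) <= opn (S - T) + opn (T - Z).
Proof. by apply: le_trans (opnD _ _); rewrite addrA subrK. Qed.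

Lemma opn_sum (I : Type) (r : seq I) (P : pred I) (F : I -> bop U V) :
  opn (\sum_(i <- r | P i) F i) <= \sum_(i <- r | P i) opn (F i).
Proof.
elim/big_rec2: _ => [|i y x _ h]; first by rewrite opn0.
by apply: le_trans (opnD _ _) _; rewrite lerD2l.
Qed.

End Operations.

Lemma bopI_bounded V : exists2 M : R, 0 <= M & forall v : V, nrm v <= M * nrm v.
Proof. by exists 1 => // v; rewrite mul1r. Qed.

Lemma bopI_linear V : linear (@id V).
Proof. by []. Qed.

Definition bopI V := Bop (@bopI_linear V) (bopI_bounded V).

Section Composition.
Variables U V W : normedModType R[i].
Implicit Types (S : bop V W) (T : bop U V).

Lemma bopM_linear S T : linear (S \o T).
Proof. by move=> c u v /=; rewrite !linearP. Qed.

Lemma bopM_bounded S T :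
  exists2 M : R, 0 <= M & forall v, nrm ((S \o T) v) <= M * nrm v.
Proof.
exists (opn S * opn T) => [|v /=]; first by rewrite mulr_ge0 ?opn_ge0.
by apply: le_trans (opnP _ _) _; rewrite -mulrA ler_wpM2l ?opn_ge0 ?opnP.
Qed.

Definition bopM S T := Bop (bopM_linear S T) (bopM_bounded S T).

End Composition.
Notation "S \oB T" := (bopM S T).

Arguments bop0 : simpl never.
Arguments bopD : simpl never.
Arguments bopZ : simpl never.
Arguments bopM : simpl never.

Section CompositionTheory.
Variables U V W : normedModType R[i].
Implicit Types (S : bop V W) (T : bop U V).

Lemma bopME S T v : (S \oB T) v = S (T v). Proof. by []. Qed.

Lemma opnM S T : opn (S \oB T) <= opn S * opn T.
Proof.
apply: opn_le => [|v /=]; first by rewrite mulr_ge0 ?opn_ge0.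
by apply: le_trans (opnP _ _) _; rewrite -mulrA ler_wpM2l ?opn_ge0 ?opnP.
Qed.

Lemma opnM_le S T (a b : R) : opn S <= a -> opn T <= b -> opn (S \oB T) <= a * b.
Proof. by move=> ha hb; apply: le_trans (opnM _ _) _; rewrite ler_pM ?opn_ge0. Qed.

Lemma bopMDl S S' T : (S + S') \oB T = S \oB T + S' \oB T.
Proof. exact: bop_ext. Qed.
Lemma bopMDr S T T' : S \oB (T + T') = S \oB T + S \oB T'.
Proof. by apply: bop_ext => v; rewrite bopME !bopDE linearD. Qed.
Lemma bopMNl S T : (- S) \oB T = - (S \oB T).
Proof. exact: bop_ext. Qed.
Lemma bopMNr S T : S \oB (- T) = - (S \oB T).
Proof. by apply: bop_ext => v; rewrite bopME !bopNE linearN. Qed.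
Lemma bopMBl S S' T : (S - S') \oB T = S \oB T - S' \oB T.
Proof. by rewrite bopMDl bopMNl. Qed.
Lemma bopMBr S T T' : S \oB (T - T') = S \oB T - S \oB T'.
Proof. by rewrite bopMDr bopMNr. Qed.
Lemma bopMZl c S T : (c *: S) \oB T = c *: (S \oB T).
Proof. exact: bop_ext. Qed.
Lemma bopMZr c S T : S \oB (c *: T) = c *: (S \oB T).
Proof. by apply: bop_ext => v; rewrite bopME !bopZE linearZ. Qed.
Lemma bopM0l T : (0 : bop V W) \oB T = 0.
Proof. exact: bop_ext. Qed.
Lemma bopM0r S : S \oB (0 : bop U V) = 0.
Proof. by apply: bop_ext => v; rewrite bopME !bop0E linear0. Qed.
Lemma bopMsuml (I : Type) (r : seq I) (P : pred I) (F : I -> bop V W) T :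
  (\sum_(i <- r | P i) F i) \oB T = \sum_(i <- r | P i) (F i \oB T).
Proof.
by elim/big_rec2: _ => [|i y x _ <-]; rewrite ?bopM0l // bopMDl.
Qed.
Lemma bopMsumr (I : Type) (r : seq I) (P : pred I) (F : I -> bop U V) S :
  S \oB (\sum_(i <- r | P i) F i) = \sum_(i <- r | P i) (S \oB F i).
Proof.
by elim/big_rec2: _ => [|i y x _ <-]; rewrite ?bopM0r // bopMDr.
Qed.
Lemma bopMIl T : bopI V \oB T = T.
Proof. exact: bop_ext. Qed.
Lemma bopMIr T : T \oB bopI U = T.
Proof. exact: bop_ext. Qed.

End CompositionTheory.

Lemma bopMA U V W X (S : bop W X) (T : bop V W) (Z : bop U V) :
  S \oB (T \oB Z) = S \oB T \oB Z.
Proof. exact: bop_ext. Qed.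

End BoundedOperators.
Arguments bopI {R} V.
Notation "S \oB T" := (bopM S T).

(** * Adjoints and rank-one operators *)

Section Adjoint.
Variable R : realType.
Implicit Types U V W : hilbertType R.

Lemma adj_exists U V (T : bop U V) :
  exists S : bop V U, forall u v, inner (T u) v = inner u (S v).
Proof.
have ex v : exists w, forall u, inner (T u) v = inner u w.
  apply: (@Riesz _ _ _ (opn T * nrm v)) => [c u w|u].
    by rewrite linearP innerDl innerZl.
  by rewrite mulrAC; apply: le_trans (CauchySchwarz _ _) _; rewrite ler_wpM2r ?nrm_ge0 ?opnP.
have [f hf] := choice ex.
have lf : linear f.
  move=> c u v; apply: inner_ext => w.
  by rewrite innerDr innerZr -!hf innerDr innerZr.
have bf v : nrm (f v) <= opn T * nrm v.
  apply: nrm_le_inner => [|w]; first by rewrite mulr_ge0 ?opn_ge0 ?nrm_ge0.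
  rewrite nrm_innerC -hf; apply: le_trans (CauchySchwarz _ _) _.
  by rewrite mulrAC ler_wpM2r ?nrm_ge0 ?opnP.
have bf' : exists2 M : R, 0 <= M & forall v, nrm (f v) <= M * nrm v.
  by exists (opn T) => //; exact: opn_ge0.
by exists (Bop lf bf').
Qed.

Definition adj U V (T : bop U V) : bop V U := projT1 (cid (adj_exists T)).

Lemma adjP U V (T : bop U V) u v : inner (T u) v = inner u (adj T v).
Proof. by rewrite /adj; case: cid => S /=. Qed.

Lemma adjP' U V (T : bop U V) u v : inner (adj T v) u = inner v (T u).
Proof. by rewrite inner_conj -adjP -inner_conj. Qed.

Lemma adj_uniq U V (T : bop U V) (S : bop V U) :
  (forall u v, inner (T u) v = inner u (S v)) -> S = adj T.
Proof. by move=> h; apply: bop_ext => v; apply: inner_ext => u; rewrite -h adjP. Qed.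

Lemma adjK U V (T : bop U V) : adj (adj T) = T.
Proof. by symmetry; apply: adj_uniq => u v; rewrite adjP'. Qed.

Lemma adjD U V (S T : bop U V) : adj (S + T) = adj S + adj T.
Proof. by symmetry; apply: adj_uniq => u v; rewrite !bopDE innerDl innerDr !adjP. Qed.

Lemma adjZ U V c (T : bop U V) : adj (c *: T) = c^*%R *: adj T.
Proof.
by symmetry; apply: adj_uniq => u v; rewrite !bopZE innerZl innerZr conjCK adjP.
Qed.

Lemma adjN U V (T : bop U V) : adj (- T) = - adj T.
Proof. by symmetry; apply: adj_uniq => u v; rewrite !bopNE innerNl innerNr adjP. Qed.

Lemma adjB U V (S T : bop U V) : adj (S - T) = adj S - adj T.
Proof. by rewrite adjD adjN. Qed.

Lemma adj0 U V : adj (0 : bop U V) = 0.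
Proof. by symmetry; apply: adj_uniq => u v; rewrite !bop0E inner0l inner0r. Qed.

Lemma adjI U : adj (bopI U) = bopI U.
Proof. by symmetry; apply: adj_uniq. Qed.

Lemma adjM U V W (S : bop V W) (T : bop U V) : adj (S \oB T) = adj T \oB adj S.
Proof. by symmetry; apply: adj_uniq => u v; rewrite !bopME !adjP. Qed.

Lemma adj_sum U V (I : Type) (r : seq I) (P : pred I) (F : I -> bop U V) :
  adj (\sum_(i <- r | P i) F i) = \sum_(i <- r | P i) adj (F i).
Proof. by elim/big_rec2: _ => [|i y x _ <-]; rewrite ?adj0 // adjD. Qed.

Lemma opn_adj U V (T : bop U V) : opn (adj T) = opn T.
Proof.
suff h (X Y : hilbertType R) (S : bop X Y) : opn (adj S) <= opn S.
  by apply: le_anti; rewrite h -{1}[T]adjK h.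
apply: opn_le => [|v]; first exact: opn_ge0.
apply: nrm_le_inner => [|w]; first by rewrite mulr_ge0 ?opn_ge0 ?nrm_ge0.
rewrite adjP'; apply: le_trans (CauchySchwarz _ _) _.
by rewrite [leRHS]mulrAC mulrC ler_wpM2r ?nrm_ge0 ?opnP.
Qed.

Lemma nrm_sq_adj U V (T : bop U V) v :
  nrm (T v) ^+ 2 = complex.Re (inner ((adj T \oB T) v) v).
Proof. by rewrite bopME adjP' Re_inner_nrm. Qed.

Lemma rank1_linear U V (u : V) (w : U) : linear (fun v => inner v w *: u).
Proof. by move=> c x y; rewrite innerDl innerZl scalerDl scalerA. Qed.

Lemma rank1_bounded U V (u : V) (w : U) :
  exists2 M : R, 0 <= M & forall v, nrm (inner v w *: u) <= M * nrm v.
Proof.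
exists (nrm u * nrm w) => [|v]; first by rewrite mulr_ge0 ?nrm_ge0.
rewrite nrmZ mulrC -mulrA ler_wpM2l ?nrm_ge0 // mulrC; exact: CauchySchwarz.
Qed.

Definition rank1 U V (u : V) (w : U) : bop U V := Bop (rank1_linear u w) (rank1_bounded u w).

Arguments rank1 : simpl never.

Lemma rank1E U V (u : V) (w v : U) : rank1 u w v = inner v w *: u.
Proof. by []. Qed.

Lemma adj_rank1 U V (u : V) (w : U) : adj (rank1 u w) = rank1 w u.
Proof.
symmetry; apply: adj_uniq => x y; rewrite !rank1E innerZl innerZr -inner_conj.
by rewrite mulrC.
Qed.

Lemma bounded_opP U (f : U -> U) : bounded_op U f <-> exists T : bop U U, f = T.
Proof.
split=> [[lf [c hc]]|[T ->]].
  have bf : exists2 M : R, 0 <= M & forall v, nrm (f v) <= M * nrm v.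
    by exists (nrm c) => [|v]; [exact: nrm_ge0|exact: nrm_leP].
  by exists (Bop lf bf).
split; first exact: bfun_linear.
exists (opn T)%:C => v; rewrite !nrmE -rmorphM /= lecR; exact: opnP.
Qed.

Lemma bop_bounded_op U (T : bop U U) : bounded_op U T.
Proof. by apply/bounded_opP; exists T. Qed.

Lemma adjointE U (T : bop U U) : adjoint T = adj T :> (U -> U).
Proof.
rewrite /adjoint; case: xgetP => [S _ [/bounded_opP[S' ->] hS]|/(_ (adj T))].
  by rewrite (@adj_uniq _ _ T S').
by case; split; [exact: bop_bounded_op|exact: adjP].
Qed.

End Adjoint.

(** * Sequential limits, Hahn-Banach and uniform boundedness *)

Section SequentialLimits.
Variable R : realType.
Implicit Type V : normedZmodType R[i].

(** Stated with [nrm] only, so that scalars and vectors are treated alike and no topology on [V] has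
    to be chosen. *)
Definition tends V (f : nat -> V) (l : V) :=
  forall e : R, 0 < e -> exists N, forall n, (N <= n)%N -> nrm (l - f n) <= e.

Lemma tends_le V (f : nat -> V) l a (b : R) N :
  tends f l -> (forall n, (N <= n)%N -> nrm (f n - a) <= b) -> nrm (l - a) <= b.
Proof.
move=> fl h; apply/ler_addgt0Pr => e /fl[N1 hN1].
have h1 := hN1 _ (leq_maxr N N1); have h2 := h _ (leq_maxl N N1).
by apply: le_trans (nrm_tri _ (f (maxn N N1)) _) _; rewrite addrC lerD.
Qed.

Lemma tends_bound V (f : nat -> V) l (b : R) :
  tends f l -> (forall n, nrm (f n) <= b) -> nrm l <= b.
Proof.
by move=> fl h; rewrite -[l]subr0; apply: (tends_le (N := 0) fl) => n _; rewrite subr0.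
Qed.

Lemma tends_uniq V (f : nat -> V) l l' : tends f l -> tends f l' -> l = l'.
Proof.
move=> h h'; apply: nrm_close => e e0; have [N hN] := h' e e0.
by apply: (tends_le (N := N) h) => n Nn; rewrite nrmBC hN.
Qed.

Lemma tendsD V (f g : nat -> V) l m :
  tends f l -> tends g m -> tends (fun n => f n + g n) (l + m).
Proof.
move=> hf hg e e0; have e1 : 0 < e / 2 by rewrite divr_gt0.
have [N1 h1] := hf _ e1; have [N2 h2] := hg _ e1; exists (maxn N1 N2) => n.
rewrite geq_max => /andP[/h1 n1 /h2 n2]; rewrite opprD addrACA.
by apply: le_trans (nrmD _ _) _; rewrite [leRHS]splitr lerD.
Qed.

Lemma tends_comp V (W : normedZmodType R[i]) (f : nat -> V) (phi : V -> W) l (M : R) : 0 <= M ->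
  (forall x y, nrm (phi x - phi y) <= M * nrm (x - y)) ->
  tends f l -> tends (phi \o f) (phi l).
Proof.
(* Here and in many estimates below, 1 is added to a constant before dividing by it, because the
   constant may be zero. *)
move=> M0 h hf e e0; have [|N hN] := hf (e / (M + 1)).
  by rewrite divr_gt0 // ltr_wpDl.
exists N => n /hN hn /=; apply: le_trans (h _ _) _.
rewrite ler_pdivlMr ?ltr_wpDl // in hn; apply: le_trans hn.
by rewrite mulrC ler_wpM2l ?nrm_ge0 // lerDl.
Qed.

Lemma tendsM (f : nat -> R[i]) l (c : R[i]) : tends f l -> tends (fun n => c * f n) (c * l).
Proof.
by apply: (tends_comp (M := nrm c)) => [|x y]; rewrite ?nrm_ge0 // -mulrBr nrmM.
Qed.

Lemma tends_conj (f : nat -> R[i]) l : tends f l -> tends (fun n => (f n)^*%R) l^*%R.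
Proof.
apply: (tends_comp (M := 1)) => // x y.
by rewrite -rmorphB /= /nrm norm_conjC mul1r.
Qed.

Lemma tends_ext V (f g : nat -> V) l : f =1 g -> tends f l -> tends g l.
Proof. by move=> /funext ->. Qed.

Lemma tends_cst V (f : nat -> V) l N : (forall n, (N <= n)%N -> f n = l) -> tends f l.
Proof.
by move=> h e e0; exists N => n /h ->; rewrite subrr nrm0 ltW.
Qed.

Lemma tends_sub V (f : nat -> V) l (k : nat -> nat) : (forall n, (n <= k n)%N) ->
  tends f l -> tends (f \o k) l.
Proof.
by move=> hk hf e /hf[N hN]; exists N => n Nn; apply: hN; apply: leq_trans (hk n).
Qed.

(** Completeness of [R[i]] is inherited from [R], as real and imaginary parts are 1-Lipschitz. *)
Lemma cauchy_complex (f : nat -> R[i]) :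
  (forall e : R, 0 < e -> exists N, forall n, (N <= n)%N -> nrm (f N - f n) <= e) ->
  exists l, tends f l.
Proof.
move=> h.
have real (g : R[i] -> R) : (forall a b, `|g a - g b| <= nrm (a - b)) ->
    exists l : R, g (f n) @[n --> \oo] --> l.
  move=> hg; have : cvg (g (f n) @[n --> \oo]); last by move=> ?; exists (lim (g (f n) @[n --> \oo])).
  apply/cauchy_cvgP; apply: cauchy_exP => e e0.
  have [|N hN] := h (e / 2); first by rewrite divr_gt0.
  exists (g (f N)); exists N => // n /hN hn; rewrite /= -ball_normE /=.
  apply: le_lt_trans (hg _ _) _; apply: le_lt_trans hn _.
  by rewrite ltr_pdivrMr // ltr_pMr // ltr1n.
have [a ha] : exists l : R, complex.Re (f n) @[n --> \oo] --> l.
  by apply: real => x y; rewrite -raddfB nrm_Re.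
have [b hb] : exists l : R, complex.Im (f n) @[n --> \oo] --> l.
  by apply: real => x y; rewrite -raddfB nrm_Im.
exists (a +i* b) => e e0; have e1 : 0 < e / 2 by rewrite divr_gt0.
have [N1 _ h1] := proj1 (cvgrPdist_le _ _) ha _ e1.
have [N2 _ h2] := proj1 (cvgrPdist_le _ _) hb _ e1.
exists (maxn N1 N2) => n; rewrite geq_max => /andP[/h1 n1 /h2 n2].
apply: le_trans (nrm_ReIm _) _; move: n1 n2; case: (f n) => x y /= n1 n2.
by rewrite [leRHS]splitr lerD.
Qed.

End SequentialLimits.

Section HahnBanach.
Variables (R : realType) (V : lmodType R[i]).

(** One inequality of positive homogeneity implies the other: apply it with the factor [r^-1]. *)
Definition sublinear (p : V -> R) :=
  (forall u v, p (u + v) <= p u + p v) /\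
  (forall (r : R) v, 0 < r -> p (r%:C *: v) <= r * p v).

(** This infimum serves three times: as lower bound of a chain for Zorn's lemma, to decrease a
    sublinear functional along a direction, and to build the functional that separates a convex set
    from a ball. *)
Lemma inf_sublinear (I : Type) (i0 : I) (F : I -> V -> R) :
  (forall v, exists m, forall i, m <= F i v) ->
  (forall i j u v, exists k, F k (u + v) <= F i u + F j v) ->
  (forall (r : R) i v, 0 < r -> exists k, F k (r%:C *: v) <= r * F i v) ->
  exists q, [/\ sublinear q, forall i v, q v <= F i v &
    forall v m, (forall i, m <= F i v) -> m <= q v].
Proof.
move=> hb hD hZ; pose q v := inf (range (F^~ v)).
have hi v : has_inf (range (F^~ v)).
  by split; [exists (F i0 v); exists i0|have [m hm] := hb v; exists m => _ [i _ <-]].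
have q_le i v : q v <= F i v by apply: ge_inf; [exact: (hi v).2|exists i].
have q_near v e : 0 < e -> exists i, F i v <= q v + e.
  move=> e0; have [_ [i _ <-] /ltW h] := inf_adherent e0 (hi v).
  by exists i.
exists q; split=> //; last first.
  by move=> v m hm; apply: lb_le_inf; [exact: (hi v).1|move=> _ [i _ <-]].
split=> [u v|r v r0].
  apply/ler_addgt0Pr => e e0; have e1 : 0 < e / 2 by rewrite divr_gt0.
  have [i hu] := q_near u _ e1; have [j hv] := q_near v _ e1.
  have [k hk] := hD i j u v; apply: le_trans (q_le k _) _; apply: le_trans hk _.
  by apply: le_trans (lerD hu hv) _; rewrite addrACA -splitr.
apply/ler_addgt0Pr => e e0; have [|i hv] := q_near v (e / r); first by rewrite divr_gt0.
have [k hk] := hZ r i v r0; apply: le_trans (q_le k _) _; apply: le_trans hk _.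
by rewrite -(ler_pM2l r0) mulrDr mulrCA divff ?mulr1 // lt0r_neq0 in hv.
Qed.

Lemma sublinear0 p : sublinear p -> 0 <= p 0.
Proof. by move=> [h _]; have := h 0 0; rewrite addr0 -subr_ge0 addrK. Qed.

Lemma sublinear_ge p v : sublinear p -> - p (- v) <= p v.
Proof.
move=> hp; have := le_trans (sublinear0 hp) (_ : p 0 <= p v + p (- v)).
by rewrite -{1}(subrr v) hp.1 => /(_ isT); lra.
Qed.

Let below p0 := {p : V -> R | sublinear p /\ forall v, p v <= p0 v}.

Lemma minimal_sublinear p0 : sublinear p0 ->
  exists p, [/\ sublinear p, forall v, p v <= p0 v &
    forall q, sublinear q -> (forall v, q v <= p v) -> q = p].
Proof.
move=> hp0.
pose r (p q : below p0) := `[< forall v, sval q v <= sval p v >].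
have [||||[p [hp pp0]] pmin] := @Zorn _ r.
- by move=> p; apply/asboolP.
- by move=> p q s /asboolP h1 /asboolP h2; apply/asboolP => v; apply: le_trans (h2 v) (h1 v).
- move=> [p hp] [q hq] /asboolP /= h1 /asboolP /= h2; apply: eq_exist; apply/funext => v.
  by apply: le_anti; rewrite h1 h2.
- move=> A tot; have [[a Aa]|A0] := pselect (exists a, A a); last first.
    exists (exist _ p0 (conj hp0 (fun v => lexx _))) => s As.
    by exfalso; apply: A0; exists s.
  pose I := {s | A s}; pose F (i : I) := sval (sval i).
  have [|||q [sq qF _]] := @inf_sublinear I (exist _ a Aa) F.
  (* Every sublinear [s] below [p0] satisfies s(v) >= - s(- v) >= - p0(- v), so a chain cannot
     descend to minus infinity. *)
  + move=> v; exists (- p0 (- v)) => i; rewrite /F.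
    case: (sval i) => s [/= hs sp0]; apply: le_trans (sublinear_ge _ hs).
    by rewrite lerN2.
  + move=> i j u v.
    have [h|h] := tot _ _ (svalP i) (svalP j); have {}h := asboolW h.
      by exists j; apply: le_trans ((svalP (sval j)).1.1 u v) _; rewrite lerD2r; exact: h.
    by exists i; apply: le_trans ((svalP (sval i)).1.1 u v) _; rewrite lerD2l; exact: h.
  + by move=> t i v t0; exists i; exact: (svalP (sval i)).1.2.
  have qp0 v : q v <= p0 v.
    by apply: le_trans (qF (exist _ a Aa) v) _; rewrite /F /=; case: (a) => ? [].
  exists (exist _ q (conj sq qp0)) => s As; apply/asboolP => v /=.
  exact: (qF (exist _ s As)).
exists p; split=> // q sq qp.
have qp0 v : q v <= p0 v by apply: le_trans (pp0 v).
have := pmin (exist _ q (conj sq qp0)) ltac:(by apply/asboolP).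
by move=> /(congr1 sval).
Qed.

(* A pointwise minimal sublinear functional is linear. *)
Lemma HahnBanach p0 : sublinear p0 -> exists l : V -> R,
  [/\ forall u v, l (u + v) = l u + l v, forall (r : R) v, l (r%:C *: v) = r * l v &
    forall v, l v <= p0 v].
Proof.
move=> /minimal_sublinear[p [hp pp0 pmin]]; exists p.
have pZ (r : R) v : 0 < r -> p (r%:C *: v) = r * p v.
  move=> r0; apply: le_anti; rewrite hp.2 //=.
  have ri : 0 < r^-1 by rewrite invr_gt0.
  have := hp.2 r^-1 (r%:C *: v) ri; rewrite scalerA -rmorphM mulVf ?lt0r_neq0 // scale1r.
  by rewrite -(ler_pM2l r0) mulrA divff ?mul1r // lt0r_neq0.
have super x y : p x + p y <= p (x + y).
  (* The infimum over t >= 0 of p(v + t y) - t p(y) is sublinear and at most [p] (take t = 0), hence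
     equal to [p] by minimality; t = 1 then gives superadditivity. *)
  pose I := {t : R | 0 <= t}; pose F (i : I) v := p (v + (sval i)%:C *: y) - sval i * p y.
  have [|||q [sq qF _]] := @inf_sublinear I (exist _ 0 (lexx 0)) F.
  - move=> v; exists (- p (- v)) => -[t t0]; rewrite /F /=.
    have := hp.1 (- v) (v + t%:C *: y); rewrite addKr.
    move: t0; rewrite le_eqVlt => /predU1P[<-|t0].
      by rewrite scale0r addr0 mul0r subr0 => _; exact: sublinear_ge.
    by rewrite pZ //; lra.
  - move=> [s s0] [t t0] u v; exists (exist _ (s + t) (addr_ge0 s0 t0)); rewrite /F /=.
    rewrite rmorphD scalerDl addrACA mulrDl.
    by have := hp.1 (u + s%:C *: y) (v + t%:C *: y); lra.
  - move=> r [t t0] v r0; exists (exist _ (r * t) (mulr_ge0 (ltW r0) t0)); rewrite /F /=.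
    rewrite rmorphM -scalerA -scalerDr mulrBr -mulrA.
    by rewrite lerD2r hp.2.
  have := pmin q sq; have h0 v : q v <= p v.
    by apply: le_trans (qF (exist _ 0 (lexx 0)) v) _; rewrite /F /= scale0r addr0 mul0r subr0.
  move=> /(_ h0) qp; have := qF (exist _ 1 ler01) x.
  by rewrite /F /= scale1r mul1r qp; lra.
have pD u v : p (u + v) = p u + p v by apply: le_anti; rewrite hp.1 super.
have p00 : p 0 = 0 by apply: (addIr (p 0)); rewrite -pD addr0 add0r.
have pN v : p (- v) = - p v by apply: (addIr (p v)); rewrite -pD !addNr.
split=> // r v; have [r0|r0|->] := ltrgtP r 0; last by rewrite scale0r mul0r.
  have := pZ (- r) v; rewrite oppr_gt0 => /(_ r0).
  by rewrite rmorphN scaleNr pN mulNr => /oppr_inj.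
exact: pZ.
Qed.

End HahnBanach.

Section Functionals.
Variables (R : realType) (V : normedModType R[i]).

Definition functional (mu : V -> R[i]) :=
  (forall (c : R[i]) u v, mu (c *: u + v) = c * mu u + mu v) /\
  exists2 M : R, 0 <= M & forall v, nrm (mu v) <= M * nrm v.

(* Every real functional [l] is the real part of [v |-> l v - i l (i v)]. *)
Lemma separation (C : set V) (c0 : V) (d : R) : C c0 ->
  (forall a b (s : R), C a -> C b -> 0 <= s <= 1 ->
    C (s%:C *: a + (1 - s)%:C *: b)) ->
  (forall a, C a -> d <= nrm a) ->
  exists mu : V -> R[i], [/\ functional mu, forall v, nrm (mu v) <= 2 * nrm v &
    forall a, C a -> d <= complex.Re (mu a)].
Proof.
move=> Cc0 Cconv Cd.
pose I := {x : V * R | C x.1 /\ 0 <= x.2}.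
(* The sublinear functional is the infimum of |v + t a| - t d over [a] in [C] and t >= 0. It is at
   most the norm (t = 0) and at most - d at the point - a (t = 1), so a linear functional below it
   is at least [d] on [C]. *)
pose F (i : I) v := nrm (v + (sval i).2%:C *: (sval i).1) - (sval i).2 * d.
have i0P : C (c0, 0 : R).1 /\ 0 <= (c0, 0 : R).2 by [].
have [|||p [sp pF _]] := @inf_sublinear _ V I (exist _ _ i0P) F.
- move=> v; exists (- nrm v) => -[[c t] /= [Cc t0]]; rewrite /F /=.
  have := nrm_sub (t%:C *: c) (- v); rewrite nrmN opprK addrC nrmZ nrmR ger0_norm //.
  by have := ler_wpM2l t0 (Cd c Cc); rewrite [_ *: _ + v]addrC; lra.
- move=> [[a s] [/= Ca s0]] [[b t] [/= Cb t0]] u v; rewrite /F /=.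
  have [st|st] := ltP 0 (s + t); last first.
    have -> : s = 0 by lra. have -> : t = 0 by lra.
    exists (exist (fun x : V * R => C x.1 /\ 0 <= x.2) _ i0P) => /=.
    by rewrite !scale0r !addr0 !mul0r !subr0 nrmD.
  pose k := ((s / (s + t))%:C *: a + (1 - s / (s + t))%:C *: b, s + t).
  have kP : C k.1 /\ 0 <= k.2.
    split; last exact: ltW.
    by apply: Cconv => //; rewrite divr_ge0 ?(ltW st) //= ler_pdivrMr // mul1r lerDl.
  exists (exist (fun x : V * R => C x.1 /\ 0 <= x.2) k kP) => /=.
  rewrite scalerDr !scalerA -!rmorphM /= mulrCA divff ?lt0r_neq0 // mulr1.
  have -> : (s + t) * (1 - s / (s + t)) = t by field; rewrite lt0r_neq0.
  by rewrite addrACA; have := nrmD (u + s%:C *: a) (v + t%:C *: b); lra.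
- move=> r [[c t] /= [Cc t0]] v r0; rewrite /F /=.
  have kP : C (c, r * t).1 /\ 0 <= (c, r * t).2 by split=> //; rewrite mulr_ge0 // ltW.
  exists (exist (fun x : V * R => C x.1 /\ 0 <= x.2) _ kP) => /=.
  rewrite rmorphM -scalerA -scalerDr nrmZ nrmR gtr0_norm // mulrBr -mulrA.
  by rewrite lerD2r.
have [l [lD lZ lp]] := HahnBanach sp.
have l_nrm v : l v <= nrm v.
  apply: le_trans (lp v) _; apply: le_trans (pF (exist _ _ i0P) v) _.
  by rewrite /F /= scale0r addr0 mul0r subr0.
have lN v : l (- v) = - l v by have := lZ (-1) v; rewrite rmorphN scaleN1r mulN1r.
have l_abs v : `|l v| <= nrm v.
  by rewrite ler_norml l_nrm andbT lerNl -lN -(nrmN v) l_nrm.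
pose mu v := (l v +i* - l ('i%C *: v)).
(* The 2 comes from estimating real and imaginary parts separately; a rotation would give 1, but any
   fixed constant would do. *)
have bmu v : nrm (mu v) <= 2 * nrm v.
  apply: le_trans (nrm_ReIm _) _ => /=; rewrite mulr_natl mulr2n lerD ?l_abs //.
  rewrite normrN; apply: le_trans (l_abs _) _.
  by rewrite nrmZ nrm_sqrt /= expr0n expr1n /= add0r sqrtr1 mul1r.
exists mu; split=> //; last first.
  move=> c Cc /=; have := le_trans (lp (- c)) (pF (exist _ (c, 1) (conj Cc ler01)) (- c)).
  by rewrite /F /= scale1r addNr nrm0 mul1r lN; lra.
split; last by exists 2.
move=> [x y] u v; rewrite /mu scalerDr scalerA !lD.
have lC (a b : R) w : l ((a +i* b) *: w) = a * l w + b * l ('i%C *: w).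
  have -> : a +i* b = a%:C + b%:C * 'i%C by simpc.
  by rewrite scalerDl lD lZ -scalerA lZ.
have -> : 'i%C * (x +i* y) = (- y +i* x) :> R[i] by simpc.
rewrite (lC x y) (lC (- y) x); move: (l u) (l ('i%C *: u)) (l v) (l ('i%C *: v)) => a b c e.
by simpc; congr (_ +i* _); ring.
Qed.

Lemma norming v : exists mu : V -> R[i],
  [/\ functional mu, forall u, nrm (mu u) <= 2 * nrm u & nrm v <= nrm (mu v)].
Proof.
have [||mu [fmu bmu hmu]] := @separation [set v] v (nrm v) erefl.
- by move=> a b s -> -> _; rewrite /= -scalerDl -rmorphD addrCA subrr addr0 scale1r.
- by move=> a ->.
by exists mu; split=> //; apply: le_trans (hmu v erefl) (Re_le_nrm _).
Qed.

(* Sokal's gliding hump: bounded functionals [mu n] norming [c n] are added, or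
   not, with weights [8^-n] so that the sum stays large at each [c n]. *)
Lemma uniform_boundedness (b : nat -> V) :
  (forall mu, functional mu -> exists M : R, forall n, nrm (mu (b n)) <= M) ->
  exists M : R, forall n, nrm (b n) <= M.
Proof.
move=> hb; apply: contrapT => nb.
(* At the end |L(c k)| is at least (1/2 - 2/7) 8^-k |c k|: half the weight survives in [S k.+1], and
   the later terms cost (16/7) 8^-(k+1) |c k|. The factor 5 makes this at least 15 k / 14, which
   eventually exceeds any bound. *)
have hk k : exists v, (exists n, v = b n) /\ 5 * k%:R * 8 ^+ k <= nrm v.
  apply: contrapT => h; apply: nb; exists (5 * k%:R * 8 ^+ k) => n.
  rewrite leNgt; apply/negP => /ltW h'; apply: h; exists (b n); split=> //.
  by exists n.
have [c hc] := choice hk; have [mu hmu] := choice (fun n => norming (c n)).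
pose w n : R := (8 ^+ n)^-1.
have w0 n : 0 < w n by rewrite invr_gt0 exprn_gt0.
have wS n : w n.+1 = w n / 8 by rewrite /w exprS invfM mulrC.
pose S := fix S n := if n is m.+1 then
    if w m / 2 * nrm (c m) <= nrm (S m (c m)) then S m
    else (fun v => (w m)%:C * mu m v + S m v)
  else (fun=> 0 : R[i]).
have S_lin n (a : R[i]) u v : S n (a *: u + v) = a * S n u + S n v.
  elim: n => [|n IH] /=; first by rewrite mulr0 addr0.
  have [[hn _] _ _] := hmu n.
  by case: ifP => _ //; rewrite IH hn; ring.
have S_big n : w n / 2 * nrm (c n) <= nrm (S n.+1 (c n)).
  rewrite /=; case: ifP => // /negbT; rewrite -ltNge => h.
  have [_ _ h3] := hmu n.
  have := nrm_sub ((w n)%:C * mu n (c n)) (- S n (c n)); rewrite nrmN opprK nrmM nrmR gtr0_norm //.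
  by have := w0 n; nra.
have S_step n v : nrm (S n.+1 v - S n v) <= 2 * w n * nrm v.
  have h0 : 0 <= 2 * w n * nrm v by rewrite !mulr_ge0 ?nrm_ge0 // ltW.
  rewrite /=; case: ifP => _; first by rewrite subrr nrm0.
  rewrite addrK nrmM nrmR gtr0_norm // [2 * _]mulrC -mulrA ler_wpM2l ?(ltW (w0 n)) //.
  by case: (hmu n).
(* A geometric sum with ratio 1/8: the steps 2 w n, ..., 2 w (n + k - 1) add up to 16/7 times w n -
   w (n + k). *)
have S_tail n k v : nrm (S (n + k)%N v - S n v) <= (w n - w (n + k)%N) * 16 / 7 * nrm v.
  elim: k => [|k IH]; first by rewrite addn0 !subrr nrm0 !mul0r.
  rewrite addnS; apply: le_trans (nrm_tri _ (S (n + k)%N v) _) _.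
  have := lerD (S_step (n + k)%N v) IH; rewrite wS => /le_trans; apply.
  by rewrite -mulrDl ler_wpM2r ?nrm_ge0 //; lra.
have S_tail' n m v : (n <= m)%N -> nrm (S m v - S n v) <= 16 / 7 * w n * nrm v.
  move=> /subnKC <-; apply: le_trans (S_tail _ _ _) _; rewrite ler_wpM2r ?nrm_ge0 //.
  by have := w0 (n + (m - n))%N; lra.
have w_small e : 0 < e -> exists N, w N <= e.
  move=> e0; have [N hN] := invS_small e0; exists N; apply: le_trans (hN N (leqnn _)).
  rewrite lef_pV2 ?posrE ?exprn_gt0 //; have : (N.+1 <= 8 ^ N)%N by exact: ltn_expl.
  by rewrite -(ler_nat R) natrX.
have L_ex v : exists l, tends (S^~ v) l.
  apply: cauchy_complex => e e0.
  have k0 : 0 < 16 / 7 * (nrm v + 1) :> R by rewrite !mulr_gt0 // ltr_wpDl ?nrm_ge0.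
  have [N hN] := w_small (e / (16 / 7 * (nrm v + 1))) ltac:(by rewrite divr_gt0).
  exists N => n Nn; rewrite nrmBC; apply: le_trans (S_tail' _ _ _ Nn) _.
  rewrite ler_pdivlMr // in hN; apply: le_trans hN.
  by have := w0 N; have := nrm_ge0 v; nra.
have [L hL] := choice L_ex.
have L_tail n v : nrm (L v - S n v) <= 16 / 7 * w n * nrm v.
  by apply: (tends_le (N := n) (hL v)) => m nm; exact: S_tail'.
have fL : functional L.
  split=> [a u v|].
    apply: tends_uniq (hL _) _; apply: tends_ext (tendsD (tendsM a (hL u)) (hL v)).
    by move=> n /=; rewrite S_lin.
  exists (16 / 7) => // v; have := L_tail 0 v; rewrite /= subr0 /w expr0 invr1 mulr1.
  exact.
have [M hM] := hb L fL.
have [k Mk] : exists k : nat, M < k%:R.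
  by exists (Num.bound `|M|); apply: le_lt_trans (ler_norm _) (archi_boundP _).
have [[n ck] hck] := hc k; have := hM n; rewrite -ck.
have h1 := S_big k; have h2 := L_tail k.+1 (c k).
have h3 := nrm_sub (S k.+1 (c k)) (S k.+1 (c k) - L (c k)); rewrite subKr nrmBC in h3.
have h4 : 5 * k%:R <= w k * nrm (c k).
  by rewrite /w [_ * nrm _]mulrC ler_pdivlMr ?exprn_gt0.
have k0 : 0 <= k%:R :> R by [].
by rewrite wS in h2; lra.
Qed.

End Functionals.

(** * Normal functionals *)

Section SquareEnumeration.

(* Runs along [(n, 0), .., (n, n), .., (0, n)] for [n = 0, 1, ..]. *)
Definition shell_step (p : nat * nat) : nat * nat :=
  if (p.2 < p.1)%N then (p.1, p.2.+1) else
  if p.1 is m.+1 then (m, p.2) else (p.2.+1, 0%N).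

Definition shell (k : nat) : nat * nat := iter k shell_step (0%N, 0%N).

Lemma shell_row n r : (r <= n)%N -> iter r shell_step (n, 0%N) = (n, r).
Proof.
elim: r => // r IH rn; rewrite iterS IH ?(ltnW rn) // /shell_step /=.
by rewrite rn.
Qed.

Lemma shell_col n r : (r <= n)%N -> iter r shell_step (n, n) = ((n - r)%N, n).
Proof.
elim: r => [|r IH] rn; first by rewrite subn0.
rewrite iterS IH ?(ltnW rn) // /shell_step /= ltnNge leq_subr /=.
by rewrite -(subnSK rn).
Qed.

Lemma shell_sq n : shell (n * n) = (n, 0%N).
Proof.
elim: n => // n IH; rewrite /shell (_ : n.+1 * n.+1 = (n.+1 + n) + n * n)%N; last by lia.
rewrite iterD -/(shell (n * n)) IH addSn iterS iterD shell_row // shell_col //.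
by rewrite subnn.
Qed.

Lemma shell_sq_row n r : (r <= n)%N -> shell (n * n + r) = (n, r).
Proof. by move=> rn; rewrite addnC /shell iterD -/(shell _) shell_sq shell_row. Qed.

Lemma shell_sq_col n r : (r <= n)%N -> shell (n * n + n + r) = ((n - r)%N, n).
Proof.
by move=> rn; rewrite addnC /shell iterD -/(shell _) shell_sq_row // shell_col.
Qed.

(** The reason for enumerating by shells: the first n^2 pairs fill a square, so square partial sums
    of a double series form a subsequence of the partial sums of the enumerated series. *)
Lemma sum_shell (V : nmodType) (G : nat -> nat -> V) n :
  \sum_(0 <= k < n * n) G (shell k).1 (shell k).2 =
  \sum_(0 <= i < n) \sum_(0 <= j < n) G i j.
Proof.
elim: n => [|n IH]; first by rewrite !big_geq.
rewrite (big_cat_nat _ (n := (n * n)%N)) //=; last by lia.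
rewrite (big_cat_nat _ (n := (n * n + n.+1)%N) (m := (n * n)%N)) //=; [|by lia..].
have rowE : \sum_(0 <= i < n) \sum_(0 <= j < n.+1) G i j =
    \sum_(0 <= i < n) (\sum_(0 <= j < n) G i j + G i n).
  by apply: eq_bigr => i _; rewrite big_nat_recr.
rewrite IH [RHS]big_nat_recr //= rowE big_split /= -!addrA; congr (_ + _); rewrite addrC; congr (_ + _).
  rewrite -{1}[(n * n + n.+1)%N]add0n big_addn (_ : _ - _ = n)%N; last by lia.
  rewrite [RHS]big_nat_rev /= !big_mkord; apply: eq_bigr => i _.
  rewrite (_ : i + (n * n + n.+1) = n * n + n + i.+1)%N; last by lia.
  by rewrite shell_sq_col //= add0n.
rewrite -{1}[(n * n)%N]add0n big_addn (_ : _ - _ = n.+1)%N; last by lia.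
rewrite !big_mkord; apply: eq_bigr => i _.
by rewrite addnC shell_sq_row //= -ltnS.
Qed.

End SquareEnumeration.

Section Series.
Variable R : realType.

Lemma sum_natB (V : zmodType) (g : nat -> V) n m : (n <= m)%N ->
  \sum_(0 <= k < m) g k - \sum_(0 <= k < n) g k = \sum_(n <= k < m) g k.
Proof. by move=> nm; rewrite (big_cat_nat _ (n := n)) //= addrAC subrr add0r. Qed.

Lemma bounded_tail (a : nat -> R) (M : R) : (forall k, 0 <= a k) ->
  (forall n, \sum_(0 <= k < n) a k <= M) ->
  forall e, 0 < e -> exists N, forall n, \sum_(N <= k < n) a k <= e.
Proof.
move=> a0 aM e e0; pose S := range (fun n => \sum_(0 <= k < n) a k).
have hS : has_sup S.
  by split; [exists (\sum_(0 <= k < 0) a k); exists 0%N|exists M => _ [n _ <-]].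
have [_ [N _ <-] hN] := sup_adherent e0 hS; exists N => n.
have [Nn|/ltnW nN] := leqP N n; last by rewrite big_geq // ltW.
have : \sum_(0 <= k < n) a k <= sup S by apply: ub_le_sup; [exact: hS.2|exists n].
by rewrite (big_cat_nat _ (n := N)) //=; lra.
Qed.

Lemma series_dominated (g : nat -> R[i]) (a : nat -> R) (M : R) :
  (forall k, nrm (g k) <= a k) -> (forall n, \sum_(0 <= k < n) a k <= M) ->
  exists l, tends (fun n => \sum_(0 <= k < n) g k) l.
Proof.
move=> ga aM; apply: cauchy_complex => e e0.
have a0 k : 0 <= a k by apply: le_trans (ga k); exact: nrm_ge0.
have [N hN] := bounded_tail a0 aM e0; exists N => n Nn.
rewrite nrmBC sum_natB //; apply: le_trans (nrm_sum _ _ _) _.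
by apply: le_trans (hN n); apply: ler_sum.
Qed.

(** The square sums tend to [s]. Domination by products makes the row tails small uniformly: beyond
    column n they contribute at most [A] times a tail of [b], so square sums and iterated sums have
    the same limit. *)
Lemma Fubini_shell (g : nat -> nat -> R[i]) (a b : nat -> R) (A B : R)
    (h : nat -> R[i]) (s t : R[i]) :
  (forall i j, nrm (g i j) <= a i * b j) -> (forall i, 0 <= a i) -> (forall j, 0 <= b j) ->
  (forall n, \sum_(0 <= k < n) a k <= A) -> (forall n, \sum_(0 <= k < n) b k <= B) ->
  tends (fun n => \sum_(0 <= k < n) g (shell k).1 (shell k).2) s ->
  (forall i, tends (fun n => \sum_(0 <= j < n) g i j) (h i)) ->
  tends (fun n => \sum_(0 <= i < n) h i) t -> s = t.
Proof.
move=> gab a0 b0 aA bB hs hh ht.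
have {}hs : tends (fun n => \sum_(0 <= i < n) \sum_(0 <= j < n) g i j) s.
  apply: tends_ext (tends_sub (k := fun n => (n * n)%N) _ hs); last by move=> n; nia.
  by move=> n /=; rewrite -sum_shell.
apply: tends_uniq hs _ => e e0; have e1 : 0 < e / 2 by rewrite divr_gt0.
have A0 : 0 <= A by have := aA 0%N; rewrite big_geq.
have [N hN] := bounded_tail b0 bB (e := e / 2 / (A + 1)) ltac:(by rewrite divr_gt0 // ltr_wpDl).
have [N1 hN1] := ht _ e1; exists (maxn N N1) => n; rewrite geq_max => /andP[Nn /hN1 {}hN1].
apply: le_trans (nrm_tri _ (\sum_(0 <= i < n) h i) _) _; rewrite [leRHS]splitr lerD //.
rewrite -sumrB; apply: le_trans (nrm_sum _ _ _) _.
apply: le_trans (_ : \sum_(0 <= i < n) a i * (e / 2 / (A + 1)) <= _); last first.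
  rewrite -mulr_suml mulrA ler_pdivrMr ?ltr_wpDl // mulrC ler_wpM2l ?(ltW e1) //.
  by apply: le_trans (aA n) _; rewrite lerDl.
apply: ler_sum => i _; apply: (tends_le (N := n) (hh i)) => m nm.
rewrite sum_natB //; apply: le_trans (nrm_sum _ _ _) _.
apply: le_trans (_ : \sum_(n <= j < m) a i * b j <= _); first exact: ler_sum.
rewrite -mulr_sumr ler_wpM2l //; apply: le_trans (hN m).
by rewrite [leRHS](big_cat_nat _ (n := n)) //= lerDr sumr_ge0.
Qed.

End Series.

Section NormalFunctionals.
Variables (R : realType) (H : hilbertType R).
Implicit Types (T S P Q : bop H H) (xi eta : nat -> H) (w : (H -> H) -> R[i]).

Definition ell2 xi := exists M : R, forall n, \sum_(0 <= k < n) nrm (xi k) ^+ 2 <= M.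

Lemma ell2P xi : cvgn (series (fun n => `|xi n| ^+ 2)) <-> ell2 xi.
Proof.
have seriesE n : \sum_(0 <= k < n) `|xi k| ^+ 2 = (\sum_(0 <= k < n) nrm (xi k) ^+ 2)%:C.
  by rewrite rmorph_sum /=; apply: eq_bigr => i _; rewrite nrmE rmorphXn.
have nd n m : (n <= m)%N -> \sum_(0 <= k < n) nrm (xi k) ^+ 2 <= \sum_(0 <= k < m) nrm (xi k) ^+ 2.
  by move=> nm; rewrite [leRHS](big_cat_nat _ (n := n)) //= lerDl sumr_ge0 // => *; rewrite sqr_ge0.
split=> [h|[M hM]].
  have /(_ 1 ltr01)[N hN] := proj1 (@cvg_seqP R (R[i] : numFieldType) _ _) h.
  exists (nrm (limn (series (fun n => `|xi n| ^+ 2))) + 1) => n.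
  apply: le_trans (nd _ _ (leq_maxr N n)) _.
  have := hN _ (leq_maxl N n); rewrite seriesE nrmBC.
  set x := \sum_(0 <= k < _) _; set l := limn _ => h1.
  by have := nrm_sub x%:C l; have := ler_norm x; rewrite nrmR; lra.
have [|l hl] := @series_dominated R (fun n => `|xi n| ^+ 2) (fun n => nrm (xi n) ^+ 2) M _ hM.
  by move=> k; rewrite nrmE -rmorphXn nrmR ger0_norm ?sqr_ge0.
have : series (fun n => `|xi n| ^+ 2) @ \oo --> (l : (R[i] : numFieldType)).
  by apply/(@cvg_seqP R (R[i] : numFieldType)).
by move=> hl'; apply/cvg_ex; exists l.
Qed.

Lemma normalP w : normal_functional H w <-> exists xi eta,
  [/\ ell2 xi, ell2 eta & forall T : bop H H,
    tends (fun n => \sum_(0 <= k < n) inner (T (xi k)) (eta k)) (w T)].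
Proof.
split=> [[xi [eta [/ell2P hx /ell2P he hw]]]|[xi [eta [/ell2P hx /ell2P he hw]]]].
  exists xi, eta; split=> // T.
  by have /(@cvg_seqP R (R[i] : numFieldType)) := hw T (bop_bounded_op T).
exists xi, eta; split; [exact: hx|exact: he|].
move=> _ /bounded_opP[T ->].
by apply/(@cvg_seqP R (R[i] : numFieldType)); exact: hw.
Qed.

(** The arithmetic-geometric mean bound, without its factor 1/2, gives a dominating series directly
    and replaces the Cauchy-Schwarz inequality for sequences. *)
Lemma nrm_inner_sq T (u v : H) :
  nrm (inner (T u) v) <= opn T * (nrm u ^+ 2 + nrm v ^+ 2).
Proof.
apply: le_trans (CauchySchwarz _ _) _.
apply: le_trans (_ : opn T * nrm u * nrm v <= _); first by rewrite ler_wpM2r ?nrm_ge0 ?opnP.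
rewrite -mulrA ler_wpM2l ?opn_ge0 //.
by have := sqr_ge0 (nrm u - nrm v); have := sqr_ge0 (nrm u + nrm v); lra.
Qed.

Lemma ell2D xi eta : ell2 xi -> ell2 eta -> exists M : R,
  forall n, \sum_(0 <= k < n) (nrm (xi k) ^+ 2 + nrm (eta k) ^+ 2) <= M.
Proof.
move=> [M hM] [N hN]; exists (M + N) => n.
by rewrite big_split /= lerD.
Qed.

Lemma normal_exists xi eta : ell2 xi -> ell2 eta ->
  exists2 w, normal_functional H w & forall T : bop H H,
    tends (fun n => \sum_(0 <= k < n) inner (T (xi k)) (eta k)) (w T).
Proof.
move=> hx he.
pose w (f : H -> H) : R[i] :=
  xget 0 [set l | tends (fun n => \sum_(0 <= k < n) inner (f (xi k)) (eta k)) l].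
have hw T : tends (fun n => \sum_(0 <= k < n) inner (T (xi k)) (eta k)) (w T).
  rewrite /w; case: xgetP => [l _ //|nl]; exfalso.
  have [M hM] := ell2D hx he.
  have [||l hl] := @series_dominated R (fun k => inner (T (xi k)) (eta k))
    (fun k => opn T * (nrm (xi k) ^+ 2 + nrm (eta k) ^+ 2)) (opn T * M).
  - by move=> k; exact: nrm_inner_sq.
  - by move=> n; rewrite -mulr_sumr ler_wpM2l ?opn_ge0.
  - exact: (nl l).
by exists w => //; apply/normalP; exists xi, eta.
Qed.

(** Normal functionals are norm limits of finite sums of vector functionals: [N] does not depend on
    [T]. *)
Lemma normal_head w : normal_functional H w ->
  exists xi eta, forall e : R, 0 < e -> exists N, forall T : bop H H,
    nrm (w T - \sum_(0 <= k < N) inner (T (xi k)) (eta k)) <= opn T * e.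
Proof.
move=> /normalP[xi [eta [hx he hw]]]; exists xi, eta => e e0.
have [M hM] := ell2D hx he.
have [|N hN] := bounded_tail _ hM e0; first by move=> k; rewrite addr_ge0 ?sqr_ge0.
exists N => T; apply: (tends_le (N := N) (hw T)) => n Nn.
rewrite sum_natB //; apply: le_trans (nrm_sum _ _ _) _.
apply: le_trans (_ : \sum_(N <= k < n) opn T * (nrm (xi k) ^+ 2 + nrm (eta k) ^+ 2) <= _).
  by apply: ler_sum => k _; exact: nrm_inner_sq.
by rewrite -mulr_sumr ler_wpM2l ?opn_ge0.
Qed.

Lemma normal_lin w c S T : normal_functional H w -> w (c *: S + T) = c * w S + w T.
Proof.
move=> /normalP[xi [eta [hx he hw]]]; apply: tends_uniq (hw _) _.
apply: tends_ext (tendsD (tendsM c (hw S)) (hw T)) => n.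
by rewrite mulr_sumr -big_split /=; apply: eq_bigr => k _; rewrite ?bopDE ?bopZE innerDl innerZl.
Qed.

Lemma normal0 w : normal_functional H w -> w (0 : bop H H) = 0.
Proof.
move=> hw; have := normal_lin 1 0 0 hw.
by rewrite scale1r addr0 mul1r => /eqP; rewrite addrC -subr_eq subrr => /eqP.
Qed.

Lemma normalB w S T : normal_functional H w -> w (S - T) = w S - w T.
Proof.
move=> hw; have := normal_lin (-1) T S hw.
by rewrite scaleN1r mulN1r addrC [- _ + _]addrC.
Qed.

Lemma normal_sum w (I : Type) (r : seq I) (P : pred I) (c : I -> R[i]) (F : I -> bop H H) :
  normal_functional H w ->
  w (\sum_(i <- r | P i) c i *: F i) = \sum_(i <- r | P i) c i * w (F i).
Proof.
move=> hw; elim/big_rec2: _ => [|i y x _ <-]; first exact: normal0.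
by rewrite normal_lin.
Qed.

Lemma normal_bound w : normal_functional H w ->
  exists2 M : R, 0 <= M & forall T : bop H H, nrm (w T) <= M * opn T.
Proof.
move=> hw; have /normalP[xi [eta [hx he h]]] := hw; have [M hM] := ell2D hx he.
have M0 : 0 <= M by have := hM 0%N; rewrite big_geq.
exists M => // T; apply: tends_bound (h T) _ => n; apply: le_trans (nrm_sum _ _ _) _.
apply: le_trans (_ : \sum_(0 <= k < n) opn T * (nrm (xi k) ^+ 2 + nrm (eta k) ^+ 2) <= _).
  by apply: ler_sum => k _; exact: nrm_inner_sq.
by rewrite -mulr_sumr mulrC ler_wpM2r ?opn_ge0.
Qed.

Lemma ell2_bop xi T : ell2 xi -> ell2 (T \o xi).
Proof.
move=> [M hM]; exists (opn T ^+ 2 * M) => n.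
apply: le_trans (_ : \sum_(0 <= k < n) opn T ^+ 2 * nrm (xi k) ^+ 2 <= _).
  apply: ler_sum => k _; rewrite -exprMn ler_sqr ?nnegrE ?nrm_ge0 ?opnP //.
  by rewrite mulr_ge0 ?opn_ge0 ?nrm_ge0.
by rewrite -mulr_sumr ler_wpM2l ?sqr_ge0.
Qed.

Lemma normal_comp w P Q : normal_functional H w ->
  exists2 w', normal_functional H w' & forall T : bop H H, w' T = w (P \oB T \oB Q).
Proof.
move=> /normalP[xi [eta [hx he hw]]].
have [w' hw' w'E] := normal_exists (ell2_bop Q hx) (ell2_bop (adj P) he).
exists w' => // T; apply: tends_uniq (w'E T) _; apply: tends_ext (hw _) => n.
by apply: eq_bigr => k _; rewrite /= -adjP.
Qed.

Lemma normal_adj w : normal_functional H w ->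
  exists2 w', normal_functional H w' & forall T : bop H H, w' T = (w (adj T))^*%R.
Proof.
move=> /normalP[xi [eta [hx he hw]]]; have [w' hw' w'E] := normal_exists he hx.
exists w' => // T; apply: tends_uniq (w'E T) _.
apply: tends_ext (tends_conj (hw _)) => n; rewrite rmorph_sum /=.
by apply: eq_bigr => k _; rewrite -inner_conj adjP.
Qed.

Lemma normal_vector (u v : H) : normal_functional H (fun f => inner (f u) v).
Proof.
pose d (z : H) k := if k is 0%N then z else 0.
have hd z : ell2 (d z).
  exists (nrm z ^+ 2) => -[|n]; first by rewrite big_geq // sqr_ge0.
  rewrite big_nat_recl //= big1_seq ?addr0 // => k _.
  by rewrite nrm0 expr0n.
apply/normalP; exists (d u), (d v); split=> // T.
apply: (tends_cst (N := 1%N)) => -[//|n] _; rewrite big_nat_recl //= big1_seq ?addr0 // => k _.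
by rewrite inner0r.
Qed.

(** On bounded nets, weak operator convergence implies convergence under normal functionals: a
    finite head is handled vector by vector, and the tail is uniformly small by boundedness. *)
Lemma normal_weak (J : choiceType) w (T : {fset J} -> bop H H) S (M : R) :
  normal_functional H w -> 0 <= M -> (forall F, opn (T F) <= M) ->
  (forall u v (e : R), 0 < e -> evt (fun F => nrm (inner (S u) v - inner (T F u) v) <= e)) ->
  forall e : R, 0 < e -> evt (fun F => nrm (w S - w (T F)) <= e).
Proof.
move=> hw M0 hM h e e0; have [xi [eta hN]] := normal_head hw.
have K0 : 0 < opn S + M + 1 by rewrite ltr_wpDl // addr_ge0 ?opn_ge0.
have e1 : 0 < e / 2 by rewrite divr_gt0.
have [N {}hN] := hN (e / 2 / (opn S + M + 1)) ltac:(by rewrite divr_gt0).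
have e2 : 0 < e / 2 / N.+1%:R by rewrite divr_gt0.
have := evt_ord (fun k : 'I_N => h (xi k) (eta k) _ e2).
apply: evtW => F hF; rewrite -normalB //.
apply: le_trans (_ : nrm (w (S - T F) - \sum_(0 <= k < N) inner ((S - T F) (xi k)) (eta k)) +
  nrm (\sum_(0 <= k < N) inner ((S - T F) (xi k)) (eta k)) <= _).
  by apply: le_trans (nrmD _ _); rewrite subrK.
rewrite [leRHS]splitr lerD //.
  apply: le_trans (hN _) _; rewrite mulrC mulrAC ler_pdivrMr // ler_wpM2l ?(ltW e1) //.
  by apply: le_trans (opnB _ _) _; have := hM F; lra.
rewrite big_mkord; apply: le_trans (nrm_sum _ _ _) _.
apply: le_trans (_ : \sum_(k < N) (e / 2 / N.+1%:R) <= _).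
  by apply: ler_sum => k _; rewrite bopBE innerBl.
rewrite sumr_const card_ord -[_ *+ N]mulr_natr mulrAC ler_pdivrMr // ler_wpM2l ?(ltW e1) //.
by rewrite ler_nat.
Qed.

End NormalFunctionals.

(** * Representations of C*-algebras *)

Section StarRepresentations.
Variables (R : realType) (A : cstarAlgType R) (H : hilbertType R).

Record star_rep (P : A -> bop H H) : Prop := StarRep {
  rep_lin : forall (c : R[i]) a b, P (c *: a + b) = c *: P a + P b;
  rep_mul : forall a b, P (cmul a b) = P a \oB P b;
  rep_star : forall a, P (cstar a) = adj (P a) }.

Lemma representation_bop (pi : A -> H -> H) : representation pi ->
  exists2 P : A -> bop H H, star_rep P & pi = fun a => P a.
Proof.
move=> [hb hl hm hs].
have [P hP] := choice (fun a => proj1 (bounded_opP _) (hb a)).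
exists P; last by apply/funext => a; rewrite hP.
split=> [c a b|a b|a]; apply: bop_ext => v.
- by rewrite -hP hl bopDE bopZE -!hP.
- by rewrite -hP hm bopME -!hP.
- by rewrite -hP hs hP adjointE.
Qed.

Lemma nrm_cmul (a b : A) : nrm (cmul a b) <= nrm a * nrm b.
Proof. by rewrite -lecR rmorphM /= -!nrmE cnormM. Qed.

Lemma nrm_cstar_mul (a : A) : nrm (cmul (cstar a) a) = nrm a ^+ 2.
Proof. by apply: complexI; rewrite rmorphXn /= -!nrmE cnorm_star. Qed.

Lemma nrm_cstar (a : A) : nrm (cstar a) = nrm a.
Proof.
suff h (b : A) : nrm b <= nrm (cstar b) by apply: le_anti; rewrite h -{2}[a]cstarK h.
have [b0|b0] := eqVneq (nrm b) 0; first by rewrite b0 nrm_ge0.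
have bp : 0 < nrm b by rewrite lt_def b0 nrm_ge0.
by rewrite -(ler_pM2r bp) -expr2 -nrm_cstar_mul nrm_cmul.
Qed.

Lemma dual_spaceP (mu : A -> R[i]) : dual_space mu <-> functional mu.
Proof.
split=> [[lm [c hc]]|[lm [M M0 hM]]].
  split; first exact: lm.
  by exists (nrm c) => [|a]; [exact: nrm_ge0|exact: nrm_leP].
by split=> //; exists M%:C => a; rewrite !nrmE -rmorphM /= lecR.
Qed.

Variables (P : A -> bop H H).
Hypothesis hP : star_rep P.

Lemma repD a b : P (a + b) = P a + P b.
Proof. by have := rep_lin hP 1 a b; rewrite !scale1r. Qed.

Lemma rep0 : P 0 = 0.
Proof. by apply: (addIr (P 0)); rewrite -repD addr0 add0r. Qed.

Lemma repZ c a : P (c *: a) = c *: P a.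
Proof. by have := rep_lin hP c a 0; rewrite rep0 !addr0. Qed.

Lemma repN a : P (- a) = - P a.
Proof. by rewrite -scaleN1r repZ scaleN1r. Qed.

Lemma repB a b : P (a - b) = P a - P b.
Proof. by rewrite repD repN. Qed.

Lemma rep_sum (I : Type) (r : seq I) (Q : pred I) (F : I -> A) :
  P (\sum_(i <- r | Q i) F i) = \sum_(i <- r | Q i) P (F i).
Proof. by elim/big_rec2: _ => [|i y x _ <-]; rewrite ?rep0 // repD. Qed.

(** [g] is the Neumann series x + x^2 + ..., that is (1 - x)^-1 - 1, which makes sense without a
    unit. *)
Lemma quasi_inverse (x : A) : nrm x < 1 -> exists g, g = x + cmul g x.
Proof.
move=> x1; set q := nrm x in x1; have q0 : 0 <= q by exact: nrm_ge0.
pose s := fix s n := if n is m.+1 then x + cmul (s m) x else 0 : A.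
pose B := q / (1 - q); have B0 : 0 <= B by rewrite divr_ge0 // subr_ge0 ltW.
have cmul0l (a : A) : cmul 0 a = 0 by have := cmulZl 0 0 a; rewrite !scale0r.
have cmulNl (a b : A) : cmul (- a) b = - cmul a b.
  by rewrite -scaleN1r cmulZl scaleN1r.
have sB n : nrm (s n) <= B.
  elim: n => [|n IH] /=; first by rewrite nrm0.
  apply: le_trans (nrmD _ _) _; apply: le_trans (lerD (lexx _) (nrm_cmul _ _)) _.
  apply: le_trans (_ : q + B * q <= _); first by rewrite lerD2l ler_wpM2r.
  by rewrite le_eqVlt; apply/orP; left; apply/eqP; rewrite /B; field; rewrite subr_eq0 gt_eqF.
have sC n k : nrm (s (n + k)%N - s n) <= B * q ^+ n.
  elim: n => [|n IH]; first by rewrite subr0 expr0 mulr1 sB.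
  rewrite addSn /= opprD addrACA subrr add0r -cmulNl -cmulDl.
  by apply: le_trans (nrm_cmul _ _) _; rewrite exprSr mulrA ler_wpM2r.
have qn e : 0 < e -> exists N, forall n, (N <= n)%N -> q ^+ n <= e.
  move=> e0; have qc : `|q| < 1 by rewrite ger0_norm.
  have /cvgrPdist_le/(_ e e0)[N _ hN] := cvg_expr qc.
  exists N => n /hN; rewrite sub0r normrN; apply: le_trans; exact: ler_norm.
have [g hg] : exists l : A, s x @[x --> \oo] --> l.
  apply: cauchy_seq => e e0.
  have [|N hN] := qn (e / (B + 1)); first by rewrite divr_gt0 // ltr_wpDl.
  exists N => n Nn; rewrite nrmBC -(subnKC Nn); apply: le_trans (sC _ _) _.
  have := hN N (leqnn _); rewrite ler_pdivlMr ?ltr_wpDl // => h; apply: le_trans h.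
  by rewrite mulrDr mulr1 mulrC lerDl exprn_ge0.
have {}hg : tends s g by apply/cvg_seqP.
exists g; apply: (tends_uniq hg).
have h1 : tends (fun n => x + cmul (s n) x) (x + cmul g x).
  apply: (@tends_comp _ _ _ s (fun y => x + cmul y x) g q q0 _ hg) => y z.
  by rewrite opprD addrACA subrr add0r -cmulNl -cmulDl mulrC nrm_cmul.
move=> e /h1[N hN]; exists N.+1 => -[//|n] /hN hn.
exact: hn.
Qed.

(** If p = |P a| exceeded |a|, then x = a^* a / p^2 would have norm below 1, and 1 - P x would have
    the bounded left inverse 1 + P g. But where |P a v| is nearly p |v|, the vector P x v is nearly
    v, so 1 - P x is not bounded below. *)
Lemma rep_contractive a : opn (P a) <= nrm a.
Proof.
rewrite leNgt; apply/negP => lt; set p := opn (P a) in lt.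
have p0 : 0 < p by apply: le_lt_trans lt; exact: nrm_ge0.
pose x : A := ((p ^+ 2)^-1)%:C *: cmul (cstar a) a.
have x1 : nrm x < 1.
  rewrite nrmZ nrmR ger0_norm ?invr_ge0 ?sqr_ge0 // nrm_cstar_mul mulrC.
  by rewrite ltr_pdivrMr ?exprn_gt0 // mul1r ltr_sqr ?nnegrE ?nrm_ge0 // ltW.
have [g hg] := quasi_inverse x1; pose k := 1 + opn (P g).
have k1 : 1 <= k by rewrite lerDl opn_ge0.
have kv v : nrm v <= k * nrm (v - P x v).
  have gv : P g v = P x v + P g (P x v) by rewrite {1}hg repD (rep_mul hP).
  have -> : nrm v = nrm ((v - P x v) + P g (v - P x v)).
    by rewrite linearB /= {1}gv addrK subrK.
  by apply: le_trans (nrmD _ _) _; rewrite mulrDl mul1r lerD2l opnP.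
have xv v : nrm (v - P x v) ^+ 2 <= 2 * (nrm v ^+ 2 - nrm (P a v) ^+ 2 / p ^+ 2).
  have xa w : P x w = ((p ^+ 2)^-1)%:C *: adj (P a) (P a w).
    by rewrite repZ (rep_mul hP) (rep_star hP).
  have : nrm (P x v) ^+ 2 <= nrm v ^+ 2.
    rewrite ler_sqr ?nnegrE ?nrm_ge0 // xa nrmZ nrmR ger0_norm ?invr_ge0 ?sqr_ge0 //.
    rewrite mulrC ler_pdivrMr ?exprn_gt0 // mulrC expr2 -mulrA.
    apply: le_trans (opnP _ _) _; rewrite opn_adj ler_wpM2l ?(ltW p0) //; exact: opnP.
  have : complex.Re (inner v (P x v)) = nrm (P a v) ^+ 2 / p ^+ 2.
    rewrite xa Re_innerC innerZl adjP' inner_nrm -rmorphM /= mulrC //.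
  by rewrite nrm_sqB => -> ?; lra.
(* [c] is below [p], yet so close that |P a v| > c |v| would give |v|^2 <= |v|^2 / 2 through [kv]
   and [xv]. Hence [c] bounds [P a], contrary to the minimality of [p]. *)
pose c := Num.sqrt (p ^+ 2 * (1 - (4 * k ^+ 2)^-1)).
have k0 : 0 < 4 * k ^+ 2 by rewrite mulr_gt0 // exprn_gt0 // (lt_le_trans ltr01).
have i1 : (4 * k ^+ 2)^-1 <= 1.
  by rewrite invf_le1 //; have : 1 <= k ^+ 2 by [rewrite exprn_ege1]; lra.
have c2 : c ^+ 2 = p ^+ 2 * (1 - (4 * k ^+ 2)^-1).
  by rewrite sqr_sqrtr // mulr_ge0 ?sqr_ge0 // subr_ge0.
have cp : c < p.
  rewrite -ltr_sqr ?nnegrE ?sqrtr_ge0 ?(ltW p0) // c2 gtr_pMr ?exprn_gt0 //.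
  by rewrite gtrBl invr_gt0.
suff : p <= c by rewrite leNgt cp.
apply: opn_le => [|v]; first exact: sqrtr_ge0.
rewrite leNgt; apply/negP => cv.
have hv : (c * nrm v) ^+ 2 < nrm (P a v) ^+ 2.
  by rewrite ltr_sqr ?nnegrE ?mulr_ge0 ?nrm_ge0 ?sqrtr_ge0.
have v0 : 0 < nrm v.
  rewrite lt_def nrm_ge0 andbT; apply/eqP => v0; move: cv.
  by rewrite (nrm_eq0 v0) linear0 !nrm0 mulr0 ltxx.
have h1 : nrm v ^+ 2 <= k ^+ 2 * nrm (v - P x v) ^+ 2.
  rewrite -exprMn ler_sqr ?nnegrE ?nrm_ge0 //; apply: mulr_ge0 (nrm_ge0 _).
  exact: le_trans k1.
have h2 : nrm v ^+ 2 <= k ^+ 2 * (2 * (nrm v ^+ 2 - nrm (P a v) ^+ 2 / p ^+ 2)).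
  by apply: le_trans h1 _; rewrite ler_wpM2l ?sqr_ge0.
have h3 : nrm v ^+ 2 * (1 - (4 * k ^+ 2)^-1) <= nrm (P a v) ^+ 2 / p ^+ 2.
  rewrite ler_pdivlMr ?exprn_gt0 //; apply: ltW; apply: le_lt_trans hv.
  by rewrite exprMn c2; lra.
have h4 : k ^+ 2 * (2 * (nrm v ^+ 2 - nrm (P a v) ^+ 2 / p ^+ 2)) <= nrm v ^+ 2 / 2.
  have -> : nrm v ^+ 2 / 2 = k ^+ 2 * (2 * (nrm v ^+ 2 * (4 * k ^+ 2)^-1)).
    by field; rewrite gt_eqF // (lt_le_trans ltr01).
  rewrite ler_wpM2l ?sqr_ge0 //; lra.
have : 0 < nrm v ^+ 2 by rewrite exprn_gt0.
by lra.
Qed.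

Hypothesis onto : predual_onto (fun a => P a : H -> H).

Lemma rep_bounded_below : exists2 C : R, 0 <= C & forall a, nrm a <= C * opn (P a).
Proof.
apply: contrapT => nC.
(* Unbounded elements whose images stay in the unit ball: normal functionals are bounded on them,
   and every functional on A is normal. *)
have hn (n : nat) : exists b : A, nrm b = n%:R /\ opn (P b) <= 1.
  have [a ha] : exists a, n%:R * opn (P a) < nrm a.
    apply: contrapT => na; apply: nC; exists n%:R => // a.
    by rewrite leNgt; apply/negP => h; apply: na; exists a.
  have a0 : 0 < nrm a by apply: le_lt_trans ha; rewrite mulr_ge0 ?opn_ge0.
  exists ((n%:R / nrm a)%:C *: a); rewrite repZ; split.
    by rewrite nrmZ nrmR ger0_norm ?divr_ge0 ?(ltW a0) // divfK ?gt_eqF.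
  apply: le_trans (opnZ_le _ _) _; rewrite nrmR ger0_norm ?divr_ge0 ?(ltW a0) //.
  by rewrite mulrAC ler_pdivrMr // mul1r ltW.
have [b hb] := choice hn.
have [|M hM] := @uniform_boundedness _ _ b.
  move=> mu /dual_spaceP/onto[w hw wE].
  have [M M0 hM] := normal_bound hw; exists M => n.
  by rewrite -wE; apply: le_trans (hM _) _; rewrite ler_piMr //; case: (hb n).
have := hM (Num.bound `|M|); rewrite (hb _).1 leNgt => /negP; apply.
by apply: le_lt_trans (ler_norm _) (archi_boundP _).
Qed.

(** The lower bound makes the approximants a Cauchy sequence in A; contractivity shows that [P] maps
    their limit to [T]. *)
Lemma rep_range_closed (T : bop H H) :
  (forall e : R, 0 < e -> exists a, opn (T - P a) <= e) -> exists a, T = P a.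
Proof.
move=> hT; have [C C0 hC] := rep_bounded_below.
have [f hf] := choice (fun n : nat => hT (n.+1%:R^-1) ltac:(by rewrite invr_gt0)).
have [a ha] : exists l : A, f x @[x --> \oo] --> l.
  apply: cauchy_seq => e e0.
  have C1 : 0 < 2 * C + 1 by rewrite ltr_wpDl // mulr_ge0.
  have [N hN] := @invS_small R (e / (2 * C + 1)) ltac:(by rewrite divr_gt0).
  exists N => n Nn; apply: le_trans (hC _) _; rewrite repB.
  have h : opn (P (f N) - P (f n)) <= 2 * (e / (2 * C + 1)).
    apply: le_trans (opn_tri _ T _) _; rewrite opnBC mulr_natl mulr2n.
    by rewrite lerD //; [apply: le_trans (hf N) _; exact: hN|apply: le_trans (hf n) _; exact: hN].
  apply: le_trans (ler_wpM2l C0 h) _; rewrite mulrCA mulrA mulrCA ler_piMr ?(ltW e0) //.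
  by rewrite ler_pdivrMr // mul1r lerDl.
exists a; apply/eqP; rewrite -subr_eq0; apply/eqP/bop_ext => v.
apply: nrm_small => e e0.
suff : opn (T - P a) <= e / (nrm v + 1).
  move=> h; apply: le_trans (opnP _ _) _; apply: le_trans (ler_wpM2r (nrm_ge0 v) h) _.
  by rewrite mulrAC ler_pdivrMr ?ltr_wpDl ?nrm_ge0 // ler_wpM2l ?(ltW e0) // lerDl.
have : 0 < e / (nrm v + 1) by rewrite divr_gt0 // ltr_wpDl ?nrm_ge0.
move: (_ / _) => d d0; have d1 : 0 < d / 2 by rewrite divr_gt0.
have [N1 h1] := proj1 (cvg_seqP _ _) ha _ d1; have [N2 h2] := invS_small d1.
apply: le_trans (opn_tri _ (P (f (maxn N1 N2))) _) _; rewrite [leRHS]splitr lerD //.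
  by apply: le_trans (hf _) _; exact: h2 (leq_maxr _ _).
rewrite -repB; apply: le_trans (rep_contractive _) _.
by rewrite nrmBC; exact: h1 (leq_maxl _ _).
Qed.

(* Dini: otherwise the convex set of all [a] dominating some [s - t F] would be
   separated from [0] by a functional, although [s - t F] tends weakly to [0]. *)
Lemma Dini (J : choiceType) (s : A) (t : {fset J} -> A) :
  (forall F G v, (F `<=` G)%fset ->
    complex.Re (inner (P (s - t G) v) v) <= complex.Re (inner (P (s - t F) v) v)) ->
  (forall mu (e : R), functional mu -> 0 < e -> evt (fun F => nrm (mu (s - t F)) <= e)) ->
  forall e : R, 0 < e ->
    evt (fun F => forall v, complex.Re (inner (P (s - t F) v) v) <= e * nrm v ^+ 2).
Proof.
move=> mono weak e e0.
(* Monotonicity makes [C] convex: two tails are both dominated at the union of their index sets. An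
   element of [C] of norm at most [e] bounds the tails as required; otherwise [C] avoids the open
   ball of radius [e] and can be separated. *)
pose C : set A := [set a | exists F, forall v,
  complex.Re (inner (P (s - t F) v) v) <= complex.Re (inner (P a v) v)].
have [[a [[F hF] ae]]|nC] := pselect (exists a, C a /\ nrm a <= e).
  exists F => G FG v; apply: le_trans (mono F G v FG) _; apply: le_trans (hF v) _.
  apply: le_trans (Re_le_nrm _) _; apply: le_trans (CauchySchwarz _ _) _.
  rewrite expr2 mulrA ler_wpM2r ?nrm_ge0 //; apply: le_trans (opnP _ _) _.
  by rewrite ler_wpM2r ?nrm_ge0 //; apply: le_trans (rep_contractive _) ae.
have Cin F : C (s - t F) by exists F.
have [||mu [fmu _ hmu]] := @separation _ _ C (s - t fset0) e (Cin _).
- move=> a b r [F hF] [G hG] /andP[r0 r1]; exists (F `|` G)%fset => v.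
  rewrite [P (r%:C *: a + _)]repD !repZ bopDE !bopZE innerDl !innerZl.
  have hr (x : R) (z : R[i]) : complex.Re (x%:C * z) = x * complex.Re z.
    by case: z => y z /=; rewrite mul0r subr0.
  rewrite raddfD /= !hr.
  have := le_trans (mono _ _ v (fsubsetUl F G)) (hF v).
  have := le_trans (mono _ _ v (fsubsetUr F G)) (hG v).
  set x := complex.Re _; set y := complex.Re _; set z := complex.Re _.
  by move=> *; nra.
- by move=> a Ca; rewrite leNgt; apply/negP => /ltW h; apply: nC; exists a.
have [F hF] := evtE (weak mu (e / 2) fmu ltac:(by rewrite divr_gt0)).
have := le_trans (hmu _ (Cin F)) (le_trans (Re_le_nrm _) hF).
by rewrite leNgt ltr_pdivrMr // ltr_pMr // ltr1n.
Qed.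

End StarRepresentations.

(** * Projections and operators on tensor products *)

Section StrongLimits.
Variables (R : realType) (J : choiceType).

Lemma evt_dense (U W : hilbertType R) (T : {fset J} -> bop U W) (M : R) (S : set U) :
  0 <= M -> (forall F, opn (T F) <= M) -> closure (lin_span S) = setT ->
  (forall s (e : R), S s -> 0 < e -> evt (fun F => nrm (T F s) <= e)) ->
  forall v (e : R), 0 < e -> evt (fun F => nrm (T F v) <= e).
Proof.
move=> M0 hM hS hT v e e0; have e1 : 0 < e / 2 by rewrite divr_gt0.
have M1 : 0 < M + 1 by rewrite ltr_wpDl.
have [_ [n [c [s [Ss ->]]]] hs] := densityP hS v (divr_gt0 e1 M1).
have c1 : 0 < \sum_(i < n) nrm (c i) + 1 by rewrite ltr_wpDl // sumr_ge0 // => *; exact: nrm_ge0.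
have e2 := divr_gt0 e1 c1.
have := evt_ord (fun i => hT (s i) _ (Ss i) e2).
apply: evtW => F hF.
rewrite -(subrK (\sum_(i < n) c i *: s i) v) bopLD.
apply: le_trans (nrmD _ _) _; rewrite [leRHS]splitr lerD //.
  apply: le_trans (opnP _ _) _; apply: le_trans (ler_pM (opn_ge0 _) (nrm_ge0 _) (hM F) hs) _.
  by rewrite mulrA ler_pdivrMr // mulrC ler_wpM2l ?(ltW e1) // lerDl.
rewrite bopL_sum; apply: le_trans (nrm_sum _ _ _) _.
apply: le_trans (_ : \sum_(i < n) nrm (c i) * (e / 2 / (\sum_(i < n) nrm (c i) + 1)) <= _).
  by apply: ler_sum => i _; rewrite bopLZ nrmZ ler_wpM2l ?nrm_ge0.
by rewrite -mulr_suml mulrA ler_pdivrMr // mulrC ler_wpM2l ?(ltW e1) // lerDl.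
Qed.

Lemma bop_dense_ext (U W : hilbertType R) (S : set U) (X Y : bop U W) :
  closure (lin_span S) = setT -> (forall s, S s -> X s = Y s) -> X = Y.
Proof.
move=> hS h; apply: bop_ext => v; apply/eqP; rewrite -subr_eq0 -bopBE; apply/eqP.
apply: nrm_small => e e0.
have C1 : 0 < opn (X - Y) + 1 by rewrite ltr_wpDl ?opn_ge0.
have [_ [n [c [s [Ss ->]]]] hs] := densityP hS v (divr_gt0 e0 C1).
have -> : (X - Y) v = (X - Y) (v - \sum_(i < n) c i *: s i).
  rewrite [RHS]bopLB -[LHS]subr0; congr (_ - _); rewrite bopL_sum big1 // => i _.
  by rewrite bopLZ bopBE h // subrr scaler0.
apply: le_trans (opnP _ _) _; apply: le_trans (ler_wpM2l (opn_ge0 _) hs) _.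
by rewrite mulrA ler_pdivrMr // mulrC ler_wpM2l ?(ltW e0) // lerDl.
Qed.

End StrongLimits.

Section OrthogonalProjections.
Variables (R : realType) (J : choiceType) (L : hilbertType R) (p : J -> bop L L).
Hypothesis p_adj : forall j, adj (p j) = p j.
Hypothesis p_mul : forall i j, p i \oB p j = if i == j then p j else 0.

Definition psum (F : {fset J}) : bop L L := \sum_(j <- F) p j.
Definition ptail (F : {fset J}) : bop L L := bopI L - psum F.

Lemma psum_p F j : j \in F -> psum F \oB p j = p j.
Proof.
move=> jF; rewrite /psum bopMsuml (bigD1_seq j) ?fset_uniq //= p_mul eqxx.
by rewrite big1 ?addr0 // => i /negbTE ij; rewrite p_mul ij.
Qed.

Lemma psum_sub F G : (F `<=` G)%fset -> psum G \oB psum F = psum F.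
Proof.
move=> /fsubsetP FG; rewrite [X in _ \oB X]/psum bopMsumr; apply: eq_big_seq => j jF.
by rewrite psum_p // FG.
Qed.

Lemma psum_adj F : adj (psum F) = psum F.
Proof. by rewrite /psum adj_sum; apply: eq_bigr => j _; rewrite p_adj. Qed.

Lemma ptail_adj F : adj (ptail F) = ptail F.
Proof. by rewrite /ptail adjB adjI psum_adj. Qed.

Lemma ptail_sub F G : (F `<=` G)%fset -> ptail G \oB ptail F = ptail G.
Proof.
move=> FG; rewrite [X in _ \oB X]/ptail bopMBr bopMIr [X in _ - X](_ : _ = 0) ?subr0 //.
by rewrite /ptail bopMBl bopMIl psum_sub // subrr.
Qed.

Lemma proj_le1 (Q : bop L L) : adj Q = Q -> Q \oB Q = Q -> opn Q <= 1.
Proof.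
move=> Qa QQ; apply: opn_le => // v; rewrite mul1r.
have [->|q0] := eqVneq (nrm (Q v)) 0; first exact: nrm_ge0.
have qp : 0 < nrm (Q v) by rewrite lt_def q0 nrm_ge0.
rewrite -(ler_pM2l qp) -expr2 nrm_sq_adj Qa QQ.
by apply: le_trans (Re_le_nrm _) _; exact: CauchySchwarz.
Qed.

Lemma psum_le1 F : opn (psum F) <= 1.
Proof. by apply: proj_le1; rewrite ?psum_adj ?psum_sub. Qed.

Lemma ptail_le1 F : opn (ptail F) <= 1.
Proof. by apply: proj_le1; rewrite ?ptail_adj ?ptail_sub. Qed.

Lemma ptail_mono F G v : (F `<=` G)%fset -> nrm (ptail G v) <= nrm (ptail F v).
Proof.
move=> /ptail_sub <-; rewrite bopME; apply: le_trans (opnP _ _) _.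
by rewrite ler_piMl ?nrm_ge0 ?ptail_le1.
Qed.

(** For the rank-one projections of a basis this is compactness of [T]; for their amplifications to
    the tensor product it is the decay condition on columns. *)
Definition tight (U : hilbertType R) (T : bop U L) :=
  forall e : R, 0 < e -> evt (fun F => opn (ptail F \oB T) <= e).

Lemma tightD (U : hilbertType R) (S T : bop U L) : tight S -> tight T -> tight (S + T).
Proof.
move=> hS hT e e0; have e1 : 0 < e / 2 by rewrite divr_gt0.
apply: evtW (evtI (hS _ e1) (hT _ e1)) => F [h1 h2].
by rewrite bopMDr; apply: le_trans (opnD _ _) _; rewrite [leRHS]splitr lerD.
Qed.

Lemma tight_comp (U V : hilbertType R) (S : bop V L) (T : bop U V) : tight S -> tight (S \oB T).
Proof.
move=> hS e e0; have T1 : 0 < opn T + 1 by rewrite ltr_wpDl ?opn_ge0.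
apply: evtW (hS _ (divr_gt0 e0 T1)) => F h.
rewrite bopMA; apply: le_trans (opnM _ _) _; apply: le_trans (ler_wpM2r (opn_ge0 _) h) _.
by rewrite mulrAC ler_pdivrMr // ler_wpM2l ?(ltW e0) // lerDl.
Qed.

Lemma tightZ (U : hilbertType R) c (T : bop U L) : tight T -> tight (c *: T).
Proof.
by move=> hT; rewrite -[T]bopMIr -bopMZr; apply: tight_comp.
Qed.

Lemma tight0 (U : hilbertType R) : tight (0 : bop U L).
Proof. by move=> e e0; exists fset0 => F _; rewrite bopM0r opn0 ltW. Qed.

Lemma tight_sum (U : hilbertType R) (I : Type) (r : seq I) (Q : pred I) (T : I -> bop U L) :
  (forall i, tight (T i)) -> tight (\sum_(i <- r | Q i) T i).
Proof.
by move=> hT; elim/big_rec: _ => [|i y _ h]; [exact: tight0|apply: tightD].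
Qed.

Lemma tight_closed (U : hilbertType R) (T : bop U L) :
  (forall e : R, 0 < e -> exists2 S, tight S & opn (T - S) <= e) -> tight T.
Proof.
move=> h e e0; have e1 : 0 < e / 2 by rewrite divr_gt0.
have [S hS TS] := h _ e1; apply: evtW (hS _ e1) => F hF.
rewrite -(subrK S T) bopMDr; apply: le_trans (opnD _ _) _; rewrite [leRHS]splitr lerD //.
apply: le_trans (opnM _ _) _; apply: le_trans TS.
by rewrite ler_piMl ?opn_ge0 ?ptail_le1.
Qed.

End OrthogonalProjections.

(** * Tensor products of Hilbert spaces and of operators *)

Section Tensor.
Variables (R : realType) (H K L : hilbertType R) (t : H -> K -> L).
Hypothesis ht : hilbert_tensor t.

Lemma tensor_flip : hilbert_tensor (fun k h => t h k).
Proof.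
have [h1 h2 h3 h4] := ht; split=> [c k k' h|c k h h'|k k' h h'|].
- exact: h2.
- exact: h1.
- by rewrite h3 mulrC.
- rewrite -h4; congr (closure (lin_span _)); apply/seteqP; split=> v [x [y ->]].
    by exists y, x.
  by exists y, x.
Qed.

Lemma nrm_tensor h k : nrm (t h k) = nrm h * nrm k.
Proof.
have [_ _ h3 _] := ht; apply: (@pexpIrn _ 2) => //; rewrite ?nnegrE ?mulr_ge0 ?nrm_ge0 //.
by rewrite -Re_inner_nrm h3 !inner_nrm -rmorphM /= exprMn.
Qed.

Lemma tens_linear (k : K) : linear (fun h => t h k).
Proof. by case: ht => h1 _ _ _ c h h'; exact: h1. Qed.

Lemma tens_bounded (k : K) : exists2 M : R, 0 <= M & forall h, nrm (t h k) <= M * nrm h.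
Proof. by exists (nrm k) => [|h]; rewrite ?nrm_ge0 // nrm_tensor mulrC. Qed.

Definition tens (k : K) : bop H L := Bop (tens_linear k) (tens_bounded k).
Arguments tens : simpl never.

Lemma tensE k h : tens k h = t h k. Proof. by []. Qed.

Lemma opn_tens k : opn (tens k) <= nrm k.
Proof. by apply: opn_le => [|h]; rewrite ?nrm_ge0 // tensE nrm_tensor mulrC. Qed.

Lemma tensP c k k' : tens (c *: k + k') = c *: tens k + tens k'.
Proof. by apply: bop_ext => h; case: ht => _ h2 _ _; exact: h2. Qed.

Lemma tensD k k' : tens (k + k') = tens k + tens k'.
Proof. by have := tensP 1 k k'; rewrite !scale1r. Qed.

Lemma tens0 : tens 0 = 0.
Proof. by apply: (addIr (tens 0)); rewrite -tensD addr0 add0r. Qed.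

Lemma tensZ c k : tens (c *: k) = c *: tens k.
Proof. by have := tensP c k 0; rewrite tens0 !addr0. Qed.

Lemma tensB k k' : tens (k - k') = tens k - tens k'.
Proof. by rewrite tensD -scaleN1r tensZ scaleN1r. Qed.

Lemma tens_sum (I : Type) (r : seq I) (Q : pred I) (F : I -> K) :
  tens (\sum_(i <- r | Q i) F i) = \sum_(i <- r | Q i) tens (F i).
Proof. by elim/big_rec2: _ => [|i y x _ <-]; rewrite ?tens0 // tensD. Qed.

Lemma adj_tens z h k : adj (tens z) (t h k) = inner k z *: h.
Proof.
apply: inner_ext => u; rewrite -adjP tensE; case: ht => _ _ -> _.
by rewrite innerZr -inner_conj mulrC.
Qed.

Lemma adj_tensM z k : adj (tens z) \oB tens k = inner k z *: bopI H.
Proof. by apply: bop_ext => h; rewrite bopME tensE adj_tens. Qed.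

Lemma tensor_ext (W : hilbertType R) (X Y : bop L W) :
  (forall h k, X (t h k) = Y (t h k)) -> X = Y.
Proof.
case: ht => _ _ _ h4 h; apply: (bop_dense_ext h4) => s [x [y ->]].
exact: h.
Qed.

End Tensor.

Section Basis.
Variables (R : realType) (H K L : hilbertType R) (t : H -> K -> L).
Hypothesis ht : hilbert_tensor t.
Variables (J : choiceType) (e : J -> K).
Hypothesis he : orthonormal_basis e.

Lemma onbE i j : inner (e i) (e j) = (i == j)%:R.
Proof.
case: he => h1 h2 _; have [->|/eqP] := eqVneq i j; first exact: h1.
exact: h2.
Qed.

Definition bproj j : bop K K := rank1 (e j) (e j).

Lemma bproj_adj j : adj (bproj j) = bproj j.
Proof. exact: adj_rank1. Qed.

Lemma bproj_mul i j : bproj i \oB bproj j = if i == j then bproj j else 0.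
Proof.
apply: bop_ext => v; rewrite bopME !rank1E innerZl onbE eq_sym.
by case: eqP => [->|_]; rewrite ?mulr1 // mulr0 scale0r.
Qed.

Lemma basis_strong v (d : R) : 0 < d -> evt (fun F => nrm (ptail bproj F v) <= d).
Proof.
case: he => _ _ h3; apply: (evt_dense (M := 1) _ _ h3) => // [F|_ {}d [j _ <-] d0].
  exact: (ptail_le1 bproj_adj bproj_mul).
exists [fset j]%fset => F; rewrite fsub1set => jF.
have := psum_p bproj_mul jF => /(congr1 (fun T : bop K K => T (e j))).
rewrite bopME rank1E onbE eqxx scale1r => h.
by rewrite /ptail bopBE h subrr nrm0 ltW.
Qed.

Let V j := tens ht (e j).
Definition tproj j : bop L L := V j \oB adj (V j).

Lemma tproj_adj j : adj (tproj j) = tproj j.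
Proof. by rewrite adjM adjK. Qed.

Lemma tens_onb i j : adj (V i) \oB V j = if i == j then bopI H else 0.
Proof. by rewrite adj_tensM onbE eq_sym; case: eqP; rewrite ?scale1r ?scale0r. Qed.

Lemma tproj_mul i j : tproj i \oB tproj j = if i == j then tproj j else 0.
Proof.
rewrite /tproj bopMA -(bopMA (V i)) tens_onb; case: eqP => [->|_]; first by rewrite bopMIr.
by rewrite bopM0r bopM0l.
Qed.

Notation PL := (psum tproj).
Notation QL := (ptail tproj).

Lemma psum_tensor F h k : PL F (t h k) = t h (psum bproj F k).
Proof.
rewrite -!(tensE ht) /psum bop_sumE bop_sumE tens_sum bop_sumE; apply: eq_bigr => j _.
by rewrite /tproj /bproj bopME adj_tens bopLZ rank1E tensZ.
Qed.

Lemma psum_tens F k : PL F \oB tens ht k = tens ht (psum bproj F k).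
Proof. by apply: bop_ext => h; rewrite bopME !tensE psum_tensor. Qed.

Lemma ptail_tens F k : QL F \oB tens ht k = tens ht (ptail bproj F k).
Proof. by rewrite /ptail bopMBl bopMIl psum_tens bopBE tensB. Qed.

Lemma tensor_strong v (d : R) : 0 < d -> evt (fun F => nrm (QL F v) <= d).
Proof.
case: ht => _ _ _ h4; apply: (evt_dense (M := 1) _ _ h4) => // [F|_ {}d [h [k ->]] d0].
  exact: (ptail_le1 tproj_adj tproj_mul).
have h1 : 0 < nrm h + 1 by rewrite ltr_wpDl ?nrm_ge0.
apply: evtW (basis_strong k (divr_gt0 d0 h1)) => F hF.
have -> : QL F (t h k) = t h (ptail bproj F k) by rewrite -!(tensE ht) -ptail_tens.
rewrite (nrm_tensor ht); apply: le_trans (ler_wpM2l (nrm_ge0 _) hF) _.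
by rewrite mulrA ler_pdivrMr // mulrC ler_wpM2l ?(ltW d0) // lerDl.
Qed.

Section Amplification.
Variable S : bop H H.

(** Truncation of S (x) 1 to finitely many basis vectors of K. *)
Definition ampl_on (F : {fset J}) : bop L L := \sum_(j <- F) (V j \oB S \oB adj (V j)).

Lemma ampl_on_sub F G : (F `<=` G)%fset -> ampl_on G \oB PL F = ampl_on F.
Proof.
move=> /fsubsetP FG; rewrite /ampl_on /psum bopMsumr; apply: eq_big_seq => j jF.
rewrite bopMsuml (bigD1_seq j) ?fset_uniq ?FG //= big1 ?addr0 => [|i /negbTE ij].
  by rewrite /tproj !bopMA -[_ \oB adj _ \oB V j]bopMA tens_onb eqxx bopMIr.
by rewrite /tproj !bopMA -[_ \oB adj _ \oB V j]bopMA tens_onb ij bopM0r bopM0l.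
Qed.

Lemma nrm_sum_tens (F : {fset J}) (a : J -> H) :
  nrm (\sum_(j <- F) V j (a j)) ^+ 2 = \sum_(j <- F) nrm (a j) ^+ 2.
Proof.
apply: complexI; rewrite -inner_nrm inner_suml rmorph_sum /=; apply: eq_big_seq => j jF.
have VV i : inner (V j (a j)) (V i (a i)) = if i == j then (nrm (a j) ^+ 2)%:C else 0.
  rewrite adjP -bopME tens_onb eq_sym; case: eqP => [->|_]; first by rewrite inner_nrm.
  by rewrite inner0r.
rewrite inner_sumr (eq_bigr _ (fun i _ => VV i)) (bigD1_seq j) ?fset_uniq // eqxx.
by rewrite /= big1 ?addr0 // => i /negbTE ->.
Qed.

(** Pythagoras twice: the ranges of the [V j] are orthogonal, so [S] acts on each component
    separately and the components of [v] have total square norm at most |v|^2. *)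
Lemma ampl_on_le F : opn (ampl_on F) <= opn S.
Proof.
apply: opn_le => [|v]; first exact: opn_ge0.
rewrite -ler_sqr ?nnegrE ?mulr_ge0 ?nrm_ge0 ?opn_ge0 //.
rewrite /ampl_on bop_sumE (nrm_sum_tens F (fun j => S (adj (V j) v))).
apply: le_trans (_ : opn S ^+ 2 * nrm (PL F v) ^+ 2 <= _).
  rewrite /psum bop_sumE (nrm_sum_tens F (fun j => adj (V j) v)) mulr_sumr.
  apply: ler_sum => j _; rewrite -exprMn ler_sqr ?nnegrE ?mulr_ge0 ?nrm_ge0 ?opn_ge0 //.
  exact: opnP.
rewrite exprMn ler_wpM2l ?sqr_ge0 // ler_sqr ?nnegrE ?nrm_ge0 //.
apply: le_trans (opnP _ _) _; rewrite ler_piMl ?nrm_ge0 //.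
exact: (psum_le1 tproj_adj tproj_mul).
Qed.

(** [S (x) 1] is the strong limit of its truncations. For F inside G they differ at [v] by
    [ampl_on G] applied to the tail of [v] outside F, which gives the Cauchy property together with
    the uniform bound. *)
Lemma ampl_exists : exists X : bop L L,
  opn X <= opn S /\ forall h k, X (t h k) = t (S h) k.
Proof.
have S0 := opn_ge0 S; have S1 : 0 < opn S + 1 by rewrite ltr_wpDl.
have close v F G d : nrm (QL F v) <= d / (opn S + 1) -> 0 < d -> (F `<=` G)%fset ->
    nrm (ampl_on F v - ampl_on G v) <= d.
  move=> hF d0 FG; rewrite -(ampl_on_sub FG) nrmBC bopME -bopLB.
  have -> : v - PL F v = QL F v by rewrite /ptail bopBE.
  apply: le_trans (opnP _ _) _.
  apply: le_trans (ler_pM (opn_ge0 _) (nrm_ge0 _) (ampl_on_le G) hF) _.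
  by rewrite mulrA ler_pdivrMr // mulrC ler_wpM2l ?(ltW d0) // lerDl.
have lim_ex v : exists l : L, forall d : R, 0 < d -> evt (fun F => nrm (l - ampl_on F v) <= d).
  have : cvg (ampl_on x v @[x --> totally]).
    apply: cauchy_net => d d0.
    have [F0 hF0] := tensor_strong v (divr_gt0 d0 S1); exists F0 => F F0F.
    by apply: close => //; exact: hF0.
  by move=> /cvg_netP h; exists (lim (ampl_on x v @[x --> totally])).
have [X hX] := choice lim_ex.
have X_lin : linear X.
  move=> c u v; apply: nrm_close => d d0; have d1 : 0 < d / 2 / 2 by rewrite !divr_gt0.
  have c1 : 0 < nrm c + 1 by rewrite ltr_wpDl ?nrm_ge0.
  have d2 : 0 < d / 2 by rewrite divr_gt0.
  have [F [h1 [h2 h3]]] := evtE (evtI (hX (c *: u + v) _ d2)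
    (evtI (hX u _ (divr_gt0 d1 c1)) (hX v _ d1))).
  apply: le_trans (nrm_tri _ (ampl_on F (c *: u + v)) _) _; rewrite [leRHS]splitr lerD //.
  rewrite nrmBC bopLD bopLZ opprD addrACA -scalerBr.
  apply: le_trans (nrmD _ _) _; rewrite [leRHS]splitr lerD // nrmZ.
  apply: le_trans (ler_wpM2l (nrm_ge0 _) h2) _.
  by rewrite mulrA ler_pdivrMr // mulrC ler_wpM2l ?(ltW d1) // lerDl.
have X_bd v : nrm (X v) <= opn S * nrm v.
  apply/ler_addgt0Pr => d d0; have [F hF] := evtE (hX v d d0).
  have -> : X v = (X v - ampl_on F v) + ampl_on F v by rewrite subrK.
  apply: le_trans (nrmD _ _) _; rewrite addrC lerD //; apply: le_trans (opnP _ _) _.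
  by rewrite ler_wpM2r ?nrm_ge0 ?ampl_on_le.
have X_bd' : exists2 M : R, 0 <= M & forall v, nrm (X v) <= M * nrm v by exists (opn S).
exists (Bop X_lin X_bd'); split; first by apply: opn_le.
move=> h k /=; apply: nrm_close => d d0; have d2 : 0 < d / 2 by rewrite divr_gt0.
have h1 : 0 < nrm (S h) + 1 by rewrite ltr_wpDl ?nrm_ge0.
have [F [h2 h3]] := evtE (evtI (hX (t h k) _ d2) (basis_strong k (divr_gt0 d2 h1))).
apply: le_trans (nrm_tri _ (ampl_on F (t h k)) _) _; rewrite [leRHS]splitr lerD //.
have -> : ampl_on F (t h k) = t (S h) (psum bproj F k).
  rewrite -(psum_tensor F (S h)) /ampl_on /psum !bop_sumE; apply: eq_bigr => j _.
  by rewrite /tproj !bopME !adj_tens !bopLZ.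
have -> : t (S h) (psum bproj F k) - t (S h) k = - t (S h) (ptail bproj F k).
  have -> : psum bproj F k = k - ptail bproj F k by rewrite /ptail bopBE subKr.
  by rewrite -!(tensE ht) tensB bopBE addrAC subrr add0r.
rewrite nrmN (nrm_tensor ht); apply: le_trans (ler_wpM2l (nrm_ge0 _) h3) _.
by rewrite mulrA ler_pdivrMr // mulrC ler_wpM2l ?(ltW d2) // lerDl.
Qed.

End Amplification.

End Basis.

Section OperatorTensor.
Variables (R : realType) (H K L : hilbertType R) (t : H -> K -> L).
Hypothesis ht : hilbert_tensor t.
Variables (I J : choiceType) (f : I -> H) (e : J -> K).
Hypotheses (hf : orthonormal_basis f) (he : orthonormal_basis e).

(** Product of the amplifications S (x) 1 and 1 (x) T, the second obtained by exchanging the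
    factors; this is where a basis of each space is used. *)
Lemma tensor_op_exists (S : bop H H) (T : bop K K) : exists X : bop L L,
  opn X <= opn S * opn T /\ forall h k, X (t h k) = t (S h) (T k).
Proof.
have [X [X1 X2]] := ampl_exists ht he S.
have [Y [Y1 Y2]] := ampl_exists (tensor_flip ht) hf T.
exists (X \oB Y); split; first exact: opnM_le.
by move=> h k; rewrite bopME Y2 X2.
Qed.

Definition otens (S : bop H H) (T : bop K K) : bop L L := projT1 (cid (tensor_op_exists S T)).

Lemma otensE S T h k : otens S T (t h k) = t (S h) (T k).
Proof. by rewrite /otens; case: cid => X [] /=. Qed.

Lemma opn_otens S T : opn (otens S T) <= opn S * opn T.
Proof. by rewrite /otens; case: cid => X [] /=. Qed.

Lemma op_tensorE (S : bop H H) (T : bop K K) : op_tensor t S T = otens S T.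
Proof.
rewrite /op_tensor; case: xgetP => [X _ [/bounded_opP[X' ->] hX]|/(_ (otens S T))].
  by congr bfun; apply: (tensor_ext ht) => h k; rewrite hX otensE.
by case; split; [exact: bop_bounded_op|exact: otensE].
Qed.

Lemma otensM S S' T T' : otens S T \oB otens S' T' = otens (S \oB S') (T \oB T').
Proof. by apply: (tensor_ext ht) => h k; rewrite bopME !otensE. Qed.

Lemma otens_tens S T k : otens S T \oB tens ht k = tens ht (T k) \oB S.
Proof. by apply: bop_ext => h; rewrite !bopME !tensE otensE. Qed.

Lemma adj_otens S T : adj (otens S T) = otens (adj S) (adj T).
Proof.
apply: (tensor_ext ht) => h k; have [_ _ h3 h4] := ht.
(* Comparing operators into H, rather than inner products of elementary tensors, lets [tensor_ext]
   take care of density; the adjoint of this identity is the claim. *)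
have e1 : adj (tens ht k) \oB otens S T = S \oB adj (tens ht (adj T k)).
  apply: (tensor_ext ht) => h' k'.
  by rewrite !bopME otensE !adj_tens bopLZ adjP.
have := congr1 (fun X : bop L H => adj X h) e1.
by rewrite /= !adjM !adjK !bopME !tensE otensE.
Qed.

Lemma otens_rank1 S u v : otens S (rank1 u v) = tens ht u \oB S \oB adj (tens ht v).
Proof.
apply: (tensor_ext ht) => h k; rewrite otensE !bopME adj_tens -!(tensE ht) rank1E.
by rewrite tensZ bopZE !bopLZ.
Qed.

End OperatorTensor.

(** * Compact operators and multipliers *)

Section LinearSpan.
Variables (R : realType) (V : lmodType R[i]) (S : set V).

Lemma lin_span0 : lin_span S 0.
Proof.
exists 0%N, (fun=> 0), (fun=> 0); split; first by case.
by rewrite big_ord0.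
Qed.

Lemma lin_spanZ c v : S v -> lin_span S (c *: v).
Proof. by move=> Sv; exists 1%N, (fun=> c), (fun=> v); split=> //; rewrite big_ord1. Qed.

Lemma lin_span_in v : S v -> lin_span S v.
Proof. by move=> /(lin_spanZ 1); rewrite scale1r. Qed.

Lemma lin_spanD u v : lin_span S u -> lin_span S v -> lin_span S (u + v).
Proof.
move=> [m [c [s [Ss ->]]]] [n [d [r [Sr ->]]]].
exists (m + n)%N, (fun i : 'I_(m + n) => match fintype.split i with inl j => c j | inr j => d j end).
exists (fun i : 'I_(m + n) => match fintype.split i with inl j => s j | inr j => r j end); split.
  by move=> i; case: (fintype.split i).
rewrite big_split_ord; congr (_ + _); apply: eq_bigr => i _.
  by rewrite (unsplitK (inl i)).
by rewrite (unsplitK (inr i)).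
Qed.

Lemma lin_span_sum (I : Type) (r : seq I) (F : I -> V) :
  (forall i, lin_span S (F i)) -> lin_span S (\sum_(i <- r) F i).
Proof.
by move=> h; elim/big_rec: _ => [|i y _]; [exact: lin_span0|exact: lin_spanD].
Qed.

End LinearSpan.

Section CompactOperators.
Variables (R : realType) (K : hilbertType R).

Lemma rank1_compact (u v : K) : compact_op K (rank1 u v).
Proof.
split; first exact: bop_bounded_op.
(* The image of the unit ball lies in the continuous image of a compact real square of half-width
   |v|. *)
pose g (p : R * R) : K := (p.1 +i* p.2) *: u.
have cg : continuous g.
  move=> [a b]; apply/cvg_nrmP => d d0.
  have k0 : 0 < 2 * (nrm u + 1) by rewrite mulr_gt0 // ltr_wpDl ?nrm_ge0.
  have d1 := divr_gt0 d0 k0.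
  have hn (x : R) : nbhs x [set y | `|x - y| <= d / (2 * (nrm u + 1))].
    by apply/nbhs_normP; exists (d / (2 * (nrm u + 1))) => // y /ltW.
  exists ([set y | `|a - y| <= d / (2 * (nrm u + 1))],
    [set y | `|b - y| <= d / (2 * (nrm u + 1))]) => /=; first by split; exact: hn.
  move=> p [/= ha' hb']; rewrite /g -scalerBl nrmZ /=.
  apply: le_trans (ler_wpM2r (nrm_ge0 _) (nrm_ReIm _)) _ => /=.
  apply: le_trans (ler_wpM2r (nrm_ge0 _) (lerD ha' hb')) _.
  have u1 : 0 < nrm u + 1 by rewrite ltr_wpDl ?nrm_ge0.
  rewrite (_ : _ + _ = d / (nrm u + 1)); last by field; rewrite gt_eqF.
  by rewrite mulrAC ler_pdivrMr // ler_wpM2l ?(ltW d0) // lerDl.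
pose M := nrm v.
have cB : compact (g @` (`[- M, M] `*` `[- M, M])).
  apply: continuous_compact; first exact: continuous_subspaceT.
  by apply: compact_setX; exact: segment_compact.
apply: (subclosed_compact _ cB); first exact: closed_closure.
have /closure_id cl : closed (g @` (`[- M, M] `*` `[- M, M])).
  exact: (compact_closed (@norm_hausdorff _ K) cB).
rewrite cl; apply: closure_subset => _ [w /= w1 <-].
have h : nrm (inner w v) <= M.
  apply: le_trans (CauchySchwarz _ _) _; rewrite ler_piMl ?nrm_ge0 //.
  by rewrite -lecR -nrmE.
exists (complex.Re (inner w v), complex.Im (inner w v)) => /=.
  by rewrite !in_itv /= -!ler_norml; split; apply: le_trans h; [exact: nrm_Re|exact: nrm_Im].
by rewrite /g; case: (inner w v).
Qed.

Variables (J : choiceType) (e : J -> K).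
Hypothesis he : orthonormal_basis e.

Let tail_le1 := ptail_le1 (bproj_adj e) (bproj_mul he).

Lemma rank1_tight (u v : K) : tight (bproj e) (rank1 u v).
Proof.
move=> d d0; have v1 : 0 < nrm v + 1 by rewrite ltr_wpDl ?nrm_ge0.
apply: evtW (basis_strong he u (divr_gt0 d0 v1)) => F hF.
apply: opn_le => [|w]; first exact: ltW.
rewrite bopME rank1E bopLZ nrmZ.
apply: le_trans (ler_pM (nrm_ge0 _) (nrm_ge0 _) (CauchySchwarz _ _) hF) _.
rewrite mulrC mulrA mulrAC ler_wpM2r ?nrm_ge0 // mulrAC ler_pdivrMr //.
by rewrite ler_wpM2l ?(ltW d0) // lerDl.
Qed.

(** Contractions that tend strongly to 0 do so uniformly on compact sets, here on the closure of the
    image of the unit ball. *)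
Lemma compact_tight (T : bop K K) : compact_op K T -> tight (bproj e) T.
Proof.
move=> [_ /compact_near_coveringP cT] d d0; have d2 : 0 < d / 2 by rewrite divr_gt0.
have [|F0 _ hF0] := cT _ totally (fun F w => nrm (ptail (bproj e) F w) <= d) totally_filter.
  move=> w _; have [F0 hF0] := basis_strong he w d2.
  (* Half of [d] is spent on moving from [w] to a nearby point, which the contractive tails do not
     enlarge, and half on the tail at [w]. *)
  exists (ball w (d / 2)%:C, [set F | (F0 `<=` F)%fset]).
    by split; [apply: nbhsx_ballx; rewrite ltcR|exists F0].
  move=> [w' F] [hw /hF0 hF]; change (nrm (ptail (bproj e) F w') <= d); rewrite -(subrK w w') (bopLD (ptail (bproj e) F)).
  apply: le_trans (nrmD _ _) _; rewrite [leRHS]splitr lerD //.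
  apply: le_trans (opnP _ _) _; apply: le_trans (ler_piMl (nrm_ge0 _) (tail_le1 F)) _.
  by move: hw; rewrite -ball_normE /= nrmE ltcR nrmBC => /ltW.
exists F0 => F /hF0 hF; apply: opn_le => [|v]; first exact: ltW.
have [->|v0] := eqVneq v 0; first by rewrite linear0 nrm0 mulr0.
have nv : 0 < nrm v.
  by rewrite lt_def nrm_ge0 andbT; apply: contra v0 => /eqP/nrm_eq0 ->.
have := hF (T ((nrm v)^-1%:C *: v)); rewrite !bopLZ nrmZ nrmR gtr0_norm ?invr_gt0 //.
rewrite ler_pdivrMl // mulrC; apply.
apply: subset_closure; exists ((nrm v)^-1%:C *: v) => /=; last by rewrite bopLZ.
by rewrite nrm_leC nrmZ nrmR gtr0_norm ?invr_gt0 // mulVf // gt_eqF.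
Qed.

(** Compactness of the adjoint is bypassed: [T] is a norm limit of P_F T, so its adjoint is a norm
    limit of T^* P_F, a finite sum of rank-one operators. *)
Lemma compact_tight_adj (T : bop K K) : compact_op K T -> tight (bproj e) (adj T).
Proof.
move=> /compact_tight hT; apply: (tight_closed (bproj_adj e) (bproj_mul he)) => d d0.
have [F hF] := evtE (hT d d0); exists (adj T \oB psum (bproj e) F).
  rewrite /psum bopMsumr; apply: tight_sum => j.
  have -> : adj T \oB bproj e j = rank1 (adj T (e j)) (e j).
    by apply: bop_ext => v; rewrite bopME !rank1E bopLZ.
  exact: rank1_tight.
rewrite -{1}[adj T]bopMIr -bopMBr -/(ptail _ F) -opn_adj adjM adjK.
by rewrite (ptail_adj (bproj_adj e)).
Qed.

End CompactOperators.

(** * Matrix description of minimal tensor products with the compact operators *)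

Section MinTensor.
Variables (R : realType) (H K L : hilbertType R) (t : H -> K -> L).
Hypothesis ht : hilbert_tensor t.
Variables (I J : choiceType) (f : I -> H) (e : J -> K).
Hypotheses (hf : orthonormal_basis f) (he : orthonormal_basis e).

Notation V j := (tens ht (e j)).
Notation PL := (psum (tproj ht e)).
Notation QL := (ptail (tproj ht e)).
Notation tightL := (tight (tproj ht e)).
Let p_adj := tproj_adj ht e.
Let p_mul := tproj_mul ht he.

Definition slice (y : bop L L) i j : bop H H := adj (V i) \oB y \oB V j.

Lemma opn_V j : opn (V j) <= 1.
Proof.
apply: le_trans (opn_tens _ _) _; rewrite -(@ler_sqr _ (nrm _)) ?nnegrE ?nrm_ge0 //.
by rewrite -Re_inner_nrm (onbE he) eqxx expr1n.
Qed.

Lemma opn_slice y i j : opn (slice y i j) <= opn y.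
Proof.
rewrite -[opn y]mulr1; apply: opnM_le (opn_V j).
by rewrite -[opn y]mul1r; apply: opnM_le => //; rewrite opn_adj opn_V.
Qed.

Lemma sliceB x y i j : slice (x - y) i j = slice x i j - slice y i j.
Proof. by rewrite /slice bopMBr bopMBl. Qed.

Lemma sliceP c x y i j : slice (c *: x + y) i j = c *: slice x i j + slice y i j.
Proof. by rewrite /slice bopMDr bopMDl bopMZr bopMZl. Qed.

Lemma slice_adj y i j : slice (adj y) i j = adj (slice y j i).
Proof. by rewrite /slice !adjM adjK bopMA. Qed.

Definition linear_set (M : set (bop H H)) :=
  M 0 /\ forall c S T, M S -> M T -> M (c *: S + T).

Definition closed_set (M : set (bop H H)) := forall T,
  (forall d : R, 0 < d -> exists2 S, M S & opn (T - S) <= d) -> M T.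

(** For a norm closed subspace [M] this describes M (x) B_0(K). It is used for the image of A and
    for the idealiser of that image. *)
Definition amplified (M : set (bop H H)) (y : bop L L) :=
  [/\ forall i j, M (slice y i j), tightL y & tightL (adj y)].

Lemma amplified_lin M c y z : linear_set M ->
  amplified M y -> amplified M z -> amplified M (c *: y + z).
Proof.
move=> [_ lM] [y1 y2 y3] [z1 z2 z3]; split=> [i j||].
- by rewrite sliceP; apply: lM.
- by apply: tightD z2; apply: tightZ.
- by rewrite adjD adjZ; apply: tightD z3; apply: tightZ.
Qed.

Lemma amplified0 M : linear_set M -> amplified M 0.
Proof.
move=> [M0 _]; split=> [i j||]; [|exact: tight0|by rewrite adj0; exact: tight0].
by rewrite /slice bopM0r bopM0l.
Qed.

Lemma amplified_closed M y : closed_set M ->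
  (forall d : R, 0 < d -> exists2 z, amplified M z & opn (y - z) <= d) -> amplified M y.
Proof.
move=> cM h; split=> [i j||].
- apply: cM => d /h[z [hz _ _] yz]; exists (slice z i j) => //.
  by rewrite -sliceB; apply: le_trans (opn_slice _ _ _) yz.
- by apply: (tight_closed p_adj p_mul) => d /h[z [_ hz _] yz]; exists z.
- apply: (tight_closed p_adj p_mul) => d /h[z [_ _ hz] yz]; exists (adj z) => //.
  by rewrite -adjB opn_adj.
Qed.

Lemma amplified_adj M y : (forall S, M S -> M (adj S)) -> amplified M y -> amplified M (adj y).
Proof.
by move=> aM [h1 h2 h3]; split; rewrite ?adjK // => i j; rewrite slice_adj; apply: aM.
Qed.

Notation otens' := (otens ht hf he).

Lemma ptail_otens F S T : QL F \oB otens' S T = otens' S (ptail (bproj e) F \oB T).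
Proof.
apply: (tensor_ext ht) => h k; rewrite bopME !otensE -!(tensE ht) -bopME ptail_tens.
by [].
Qed.

Lemma tight_otens S T : tight (bproj e) T -> tightL (otens' S T).
Proof.
move=> hT d d0; have S1 : 0 < opn S + 1 by rewrite ltr_wpDl ?opn_ge0.
apply: evtW (hT _ (divr_gt0 d0 S1)) => F hF; rewrite ptail_otens.
apply: le_trans (opn_otens _ _ _ _ _) _; apply: le_trans (ler_wpM2l (opn_ge0 _) hF) _.
by rewrite mulrA ler_pdivrMr // mulrC ler_wpM2l ?(ltW d0) // lerDl.
Qed.

Lemma slice_otens S T i j : slice (otens' S T) i j = inner (T (e j)) (e i) *: S.
Proof. by rewrite /slice -bopMA otens_tens bopMA adj_tensM bopMZl bopMIl. Qed.

Lemma amplified_otens M (S : bop H H) (T : bop K K) : linear_set M -> M S -> compact_op K T ->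
  amplified M (otens' S T).
Proof.
move=> [M0 lM] MS cT; split=> [i j||].
- by rewrite slice_otens -[_ *: S]addr0; apply: lM.
- by apply: tight_otens; exact: compact_tight.
- by rewrite adj_otens; apply: tight_otens; exact: compact_tight_adj.
Qed.

Lemma bop_fun_sum n (c : 'I_n -> R[i]) (T : 'I_n -> bop L L) :
  (\sum_(i < n) c i *: T i : bop L L) = \sum_(i < n) c i *: (T i : L -> L) :> (L -> L).
Proof. by apply/funext => v; rewrite bop_sumE fct_sumE. Qed.

(** The amplified operators form a norm closed subspace, so elementary tensors suffice. *)
Lemma min_tensor_amplified (X : set (H -> H)) (M : set (bop H H)) y :
  linear_set M -> closed_set M ->
  (forall S, X S -> exists2 S' : bop H H, S = S' & M S') ->
  min_tensor t X (compact_op K) y -> exists2 Y : bop L L, y = Y & amplified M Y.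
Proof.
move=> lM cM XM [/bounded_opP[Y ->] hY]; exists Y => //.
apply: amplified_closed cM _ => d d0; have d0' : 0 < d%:C by rewrite ltcR.
have [_ [n [c [s [hs ->]]]] hd] := hY _ d0'.
have ex i : exists Z : bop L L, s i = Z /\ amplified M Z.
  have [S [T [/XM[S' -> MS] cT ->]]] := hs i.
  have [T' T'E] := proj1 (bounded_opP _) cT.1; rewrite T'E in cT *.
  by exists (otens' S' T'); rewrite (op_tensorE ht hf he); split=> //; apply: amplified_otens.
have [Z hZ] := choice ex; exists (\sum_(i < n) c i *: Z i).
  elim/big_rec: _ => [|i z _ hz]; first exact: amplified0.
  by apply: amplified_lin => //; exact: (hZ i).2.
apply: opn_le => [|v]; first exact: ltW.
rewrite bopBE -lecR -nrmE rmorphM /= -nrmE; apply: le_trans (hd v).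
rewrite bop_fun_sum; suff -> : \sum_(i < n) c i *: (Z i : L -> L) = \sum_(i < n) c i *: s i by [].
by apply: eq_bigr => i _; rewrite (hZ i).1.
Qed.

Lemma amplified_min_tensor (X : set (H -> H)) (Y : bop L L) :
  amplified [set S : bop H H | X S] Y -> min_tensor t X (compact_op K) Y.
Proof.
move=> [h1 h2 h3]; split; first exact: bop_bounded_op.
move=> _ /posC[d d0 ->]; have d2 : 0 < d / 2 by rewrite divr_gt0.
have [F [hF1 hF2]] := evtE (evtI (h2 _ d2) (h3 _ d2)).
pose Z : bop L L := PL F \oB Y \oB PL F.
exists Z.
  have -> : (Z : L -> L) =
      \sum_(i <- F) \sum_(j <- F) (otens' (slice Y i j) (rank1 (e i) (e j)) : L -> L).
    apply/funext => v; rewrite /Z /psum !bopMsuml fct_sumE bop_sumE; apply: eq_bigr => i _.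
    rewrite bopMsumr fct_sumE bop_sumE; apply: eq_bigr => j _.
    by rewrite otens_rank1 /slice /tproj !bopMA.
  apply: lin_span_sum => i; apply: lin_span_sum => j; apply: lin_span_in.
  exists (slice Y i j : H -> H), (rank1 (e i) (e j) : K -> K); split; first exact: h1.
    exact: rank1_compact.
  by rewrite (op_tensorE ht hf he).
move=> v; have -> : Y v - Z v = (Y - Z) v by rewrite bopBE.
rewrite nrm_leCM.
apply: le_trans (opnP _ _) _; rewrite ler_wpM2r ?nrm_ge0 //.
(* The first term is small by tightness of [Y], the second by tightness of its adjoint, since Y Q_F
   is the adjoint of Q_F Y^*. *)
have -> : Y - Z = QL F \oB Y + PL F \oB (Y \oB QL F).
  by rewrite /Z /ptail !bopMBl !bopMBr bopMIl bopMIr bopMA addrA subrK.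
apply: le_trans (opnD _ _) _; rewrite [leRHS]splitr lerD //.
apply: le_trans (opnM _ _) _; rewrite -[opn (Y \oB _)]opn_adj adjM (ptail_adj p_adj).
by apply: le_trans hF2; rewrite ler_piMl ?opn_ge0 // (psum_le1 p_adj p_mul).
Qed.

(* The condition on [x] that mediates between the three conditions of the
   theorem; [N] is the image of the C*-algebra in B(H). *)
Definition tight_matrix (N : set (bop H H)) (x : bop L L) :=
  [/\ forall i j, N (slice x i j), forall j, tightL (x \oB V j) &
    forall j, tightL (adj x \oB V j)].

Lemma tight_matrix_adj N x : (forall S, N S -> N (adj S)) ->
  tight_matrix N x -> tight_matrix N (adj x).
Proof.
by move=> aN [h1 h2 h3]; split; rewrite ?adjK // => i j; rewrite slice_adj; apply: aN.
Qed.

Lemma linear_set_sum M (I0 : Type) (r : seq I0) (T : I0 -> bop H H) : linear_set M ->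
  (forall i, M (T i)) -> M (\sum_(i <- r) T i).
Proof.
move=> [M0 lM] hT; elim/big_rec: _ => // i y _ hy.
by rewrite -[T i]scale1r; apply: lM.
Qed.

(** Tightness of [y] makes x P_F y a norm approximation of x y. In it only finitely many columns of
    [x] occur, so its entries are finite sums of products and it inherits tightness from those
    columns. *)
Lemma tight_matrix_mul N M x y : linear_set N -> closed_set N ->
  (forall S T, N S -> M T -> N (S \oB T)) ->
  tight_matrix N x -> amplified M y -> amplified N (x \oB y).
Proof.
move=> lN cN NM [x1 x2 x3] [y1 y2 y3].
have x0 := opn_ge0 x; have xp : 0 < opn x + 1 by rewrite ltr_wpDl.
have approx d : 0 < d -> exists F, opn (x \oB y - x \oB PL F \oB y) <= d.
  move=> d0; have [F hF] := evtE (y2 _ (divr_gt0 d0 xp)); exists F.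
  rewrite -bopMA -bopMBr -{1}[y]bopMIl -bopMBl -/(QL F).
  apply: le_trans (opnM _ _) _; apply: le_trans (ler_wpM2l x0 hF) _.
  by rewrite mulrA ler_pdivrMr // mulrC ler_wpM2l ?(ltW d0) // lerDl.
split=> [i j||].
- apply: cN => d /approx[F hF]; exists (slice (x \oB PL F \oB y) i j); last first.
    by rewrite -sliceB; apply: le_trans (opn_slice _ _ _) hF.
  have -> : slice (x \oB PL F \oB y) i j = \sum_(k <- F) (slice x i k \oB slice y k j).
    rewrite /slice /psum bopMsumr !bopMsuml bopMsumr bopMsuml; apply: eq_bigr => k _.
    by rewrite /tproj !bopMA.
  by apply: linear_set_sum => // k; apply: NM.
- apply: (tight_closed p_adj p_mul) => d /approx[F hF]; exists (x \oB PL F \oB y) => //.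
  apply: tight_comp; rewrite /psum bopMsumr; apply: tight_sum => k.
  by rewrite /tproj bopMA; apply: tight_comp.
- by rewrite adjM; apply: tight_comp.
Qed.

End MinTensor.

(** * The multiplier condition and the summability condition *)

Section Multipliers.
Variables (R : realType) (A : cstarAlgType R) (H K L : hilbertType R) (t : H -> K -> L).
Hypothesis ht : hilbert_tensor t.
Variables (I J : choiceType) (f : I -> H) (e : J -> K).
Hypotheses (hf : orthonormal_basis f) (he : orthonormal_basis e).
Variable P : A -> bop H H.
Hypotheses (hP : star_rep P) (onto : predual_onto (fun a => P a : H -> H)).
Hypothesis nd : nondegenerate_rep (fun a => P a : H -> H).

Notation pi := (fun a : A => P a : H -> H).
Notation V j := (tens ht (e j)).
Notation tightL := (tight (tproj ht e)).
Let p_adj := tproj_adj ht e.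
Let p_mul := tproj_mul ht he.

Definition rep_image : set (bop H H) := [set S | exists a, S = P a].

Lemma rep_image_linear : linear_set rep_image.
Proof.
split=> [|c _ _ [a ->] [b ->]]; first by exists 0; rewrite (rep0 hP).
by exists (c *: a + b); rewrite (rep_lin hP).
Qed.

Lemma rep_image_closed : closed_set rep_image.
Proof.
move=> T h; apply: (rep_range_closed hP onto) => d /h[_ [a ->] Ta].
by exists a.
Qed.

Lemma rep_image_adj S : rep_image S -> rep_image (adj S).
Proof. by move=> [a ->]; exists (cstar a); rewrite (rep_star hP). Qed.

Lemma rep_image_mul S T : rep_image S -> rep_image T -> rep_image (S \oB T).
Proof. by move=> [a ->] [b ->]; exists (cmul a b); rewrite (rep_mul hP). Qed.

(** Stands in for the unitisation: it contains it, is norm closed because the image of A is, and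
    multiplies that image into itself, as [tight_matrix_mul] requires. *)
Definition rep_idealiser : set (bop H H) :=
  [set S | forall T, rep_image T -> rep_image (T \oB S) /\ rep_image (S \oB T)].

Lemma rep_idealiser_linear : linear_set rep_idealiser.
Proof.
have [N0 Nl] := rep_image_linear.
split=> [T _|c S S' hS hS' T hT]; first by rewrite bopM0l bopM0r.
have [h1 h2] := hS T hT; have [h3 h4] := hS' T hT.
by rewrite bopMDr bopMDl bopMZr bopMZl; split; apply: Nl.
Qed.

Lemma rep_idealiser_closed : closed_set rep_idealiser.
Proof.
move=> S h T hT; have T1 : 0 < opn T + 1 by rewrite ltr_wpDl ?opn_ge0.
split; apply: rep_image_closed => d d0; have [S' hS' SS'] := h _ (divr_gt0 d0 T1).
  exists (T \oB S'); first exact: (hS' T hT).1.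
  rewrite -bopMBr; apply: le_trans (opnM _ _) _; apply: le_trans (ler_wpM2l (opn_ge0 _) SS') _.
  by rewrite mulrA ler_pdivrMr // mulrC ler_wpM2l ?(ltW d0) // lerDl.
exists (S' \oB T); first exact: (hS' T hT).2.
rewrite -bopMBl; apply: le_trans (opnM _ _) _; apply: le_trans (ler_wpM2r (opn_ge0 _) SS') _.
by rewrite mulrAC ler_pdivrMr // ler_wpM2l ?(ltW d0) // lerDl.
Qed.

Lemma rep_idealiser_adj S : rep_idealiser S -> rep_idealiser (adj S).
Proof.
move=> hS T hT; have [h1 h2] := hS _ (rep_image_adj hT).
by split; rewrite -[T]adjK -adjM; apply: rep_image_adj.
Qed.

Lemma unitisation_idealiser (S : H -> H) : unitisation pi S ->
  exists2 S' : bop H H, S = S' & rep_idealiser S'.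
Proof.
move=> [a [c [_ ->]]]; exists (c *: bopI H + P a).
  by apply/funext => v; rewrite bopDE bopZE addrC.
have [M0 Ml] := rep_idealiser_linear; apply: Ml.
  by move=> T hT; rewrite bopMIl bopMIr.
by move=> T hT; split; apply: rep_image_mul => //; exists a.
Qed.

(** Non-degeneracy enters here: when A has a unit, nothing is adjoined, and that unit must act as
    the identity of H. *)
Lemma unitisation_id : unitisation pi (bopI H).
Proof.
have [[u hu]|nu] := pselect (unital A); last first.
  exists 0, 1; split=> //; apply/funext => v.
  by rewrite (rep0 hP) bop0E add0r scale1r.
exists u, 0; split=> //; apply/funext => v; rewrite scale0r addr0.
suff -> : bopI H = P u by [].
apply: (bop_dense_ext nd) => _ [a [w ->]].
by change (P a w = (P u \oB P a) w); rewrite -(rep_mul hP) (hu a).1.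
Qed.

Notation mtU := (min_tensor t (unitisation pi) (compact_op K)).
Notation mtA := (min_tensor t (range pi) (compact_op K)).

Lemma mtA_amplified (y : L -> L) :
  mtA y <-> exists2 Y : bop L L, y = Y & amplified ht e rep_image Y.
Proof.
split=> [|[Y -> hY]].
  apply: (min_tensor_amplified ht hf he rep_image_linear rep_image_closed).
  by move=> _ [a _ <-]; exists (P a) => //; exists a.
apply: (@amplified_min_tensor _ _ _ _ _ ht _ _ _ _ hf he (range pi)).
by case: hY => h1 h2 h3; split=> // i j; have [a ->] := h1 i j; exists a.
Qed.

Lemma mtU_amplified (y : L -> L) :
  mtU y -> exists2 Y : bop L L, y = Y & amplified ht e rep_idealiser Y.
Proof.
apply: (min_tensor_amplified ht hf he rep_idealiser_linear rep_idealiser_closed).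
exact: unitisation_idealiser.
Qed.

Lemma mtA_sub_mtU (y : L -> L) : mtA y -> mtU y.
Proof.
move=> /mtA_amplified[Y -> [h1 h2 h3]].
apply: (@amplified_min_tensor _ _ _ _ _ ht _ _ _ _ hf he (unitisation pi)).
split=> // i j; have [a ->] := h1 i j.
by exists a, 0; split=> //; apply/funext => v; rewrite scale0r addr0.
Qed.

(** The projection 1 (x) e_jj is the test element through which a multiplier condition yields
    information on a single column or row. *)
Lemma mtU_tproj j : mtU (tproj ht e j).
Proof.
split; first exact: bop_bounded_op.
move=> d d0; exists (tproj ht e j); last first.
  by move=> v; rewrite subrr normr0 mulr_ge0 // ltW.
apply: lin_span_in; exists (bopI H : H -> H), (rank1 (e j) (e j) : K -> K); split.
- exact: unitisation_id.
- exact: rank1_compact.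
- by rewrite (op_tensorE ht hf he) otens_rank1 /tproj bopMIr.
Qed.

Lemma mtU0 : mtU (fun=> 0).
Proof.
split; first exact: (bop_bounded_op (0 : bop L L)).
move=> d d0; exists (fun=> 0); first exact: lin_span0.
by move=> v; rewrite subrr normr0 mulr_ge0 // ltW.
Qed.

Lemma multiplier_tight (x : bop L L) :
  multiplier_into mtU mtA x <-> tight_matrix ht e rep_image x.
Proof.
have Vj j : tproj ht e j \oB V j = V j by rewrite /tproj -bopMA (tens_onb ht he) eqxx bopMIr.
split=> [[_ hx]|hx].
  have xr j : amplified ht e rep_image (x \oB tproj ht e j).
    (* [multiplier_into] speaks of x c + d x; taking one of [c], [d] to be zero separates right from
       left multiplication. *)
    have /mtA_amplified[Y hY] := hx _ _ (mtU_tproj j) mtU0.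
    suff -> : x \oB tproj ht e j = Y by [].
    by apply: bop_ext => v; rewrite -hY /= addr0.
  have xl j : amplified ht e rep_image (tproj ht e j \oB x).
    have /mtA_amplified[Y hY] := hx _ _ mtU0 (mtU_tproj j).
    suff -> : tproj ht e j \oB x = Y by [].
    by apply: bop_ext => v; rewrite -hY /= linear0 add0r.
  split=> [i j|j|j].
  - have [h _ _] := xr j; have := h i j.
    by rewrite /slice -[_ \oB (x \oB _) \oB _]bopMA -[x \oB _ \oB _]bopMA Vj bopMA.
  - by have [_ h _] := xr j; rewrite -(Vj j) bopMA; apply: tight_comp.
  - have [_ _ h] := xl j; rewrite adjM p_adj in h.
    by rewrite -(Vj j) bopMA; apply: tight_comp.
have NM S T : rep_image S -> rep_idealiser T -> rep_image (S \oB T).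
  by move=> hS hT; have [] := hT S hS.
have xc c : mtU c -> exists2 Y : bop L L, x \o c = Y & amplified ht e rep_image Y.
  move=> /mtU_amplified[Y -> hY]; exists (x \oB Y) => //.
  exact: (tight_matrix_mul he rep_image_linear rep_image_closed NM hx hY).
have cx c : mtU c -> exists2 Y : bop L L, c \o x = Y & amplified ht e rep_image Y.
  move=> /mtU_amplified[Y -> hY]; exists (Y \oB x) => //.
  (* Left multiplication is reduced to right multiplication by passing to adjoints, under which
     every condition involved is stable. *)
  rewrite -[Y \oB x]adjK; apply: (amplified_adj rep_image_adj); rewrite adjM.
  apply: (tight_matrix_mul he rep_image_linear rep_image_closed NM).
    exact: tight_matrix_adj rep_image_adj hx.
  exact: amplified_adj rep_idealiser_adj hY.
split.
  split; first exact: bop_bounded_op.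
  by move=> c hc; split; apply: mtA_sub_mtU; apply/mtA_amplified; [apply: xc|apply: cx].
move=> c d /xc[Y xcY hY] /cx[Z dxZ hZ]; apply/mtA_amplified.
exists (1 *: Y + Z); last exact: amplified_lin rep_image_linear hY hZ.
by rewrite xcY dxZ scale1r.
Qed.

Lemma opn_sq_le (U W : hilbertType R) (T : bop U W) (d : R) : 0 <= d ->
  (forall v, complex.Re (inner ((adj T \oB T) v) v) <= d ^+ 2 * nrm v ^+ 2) -> opn T <= d.
Proof.
move=> d0 h; apply: opn_le => // v; rewrite -ler_sqr ?nnegrE ?mulr_ge0 ?nrm_ge0 //.
by rewrite exprMn nrm_sq_adj.
Qed.

Section Column.
Variables (T : bop H L) (b : J -> A).
Hypothesis hb : forall k, P (b k) = adj (V k) \oB T.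

Notation colsum := (partial_sum (fun k => cmul (cstar (b k)) (b k))).

(** [T] is one column, later [x V_j] or [x^* V_i], with entries [P (b k)]: inserting P_F between T^*
    and T gives the partial sum. *)
Lemma rep_colsum F : P (colsum F) = adj T \oB psum (tproj ht e) F \oB T.
Proof.
rewrite /partial_sum -(big_seq_fsetE _ F xpredT (fun k => cmul (cstar (b k)) (b k))) /=.
rewrite (rep_sum hP) /psum bopMsumr bopMsuml; apply: eq_bigr => k _.
by rewrite (rep_mul hP) (rep_star hP) hb adjM adjK /tproj !bopMA.
Qed.

Let rep_tail s F : P s = adj T \oB T ->
  P (s - colsum F) = adj (ptail (tproj ht e) F \oB T) \oB (ptail (tproj ht e) F \oB T).
Proof.
move=> sT; rewrite (repB hP) sT rep_colsum adjM (ptail_adj p_adj).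
rewrite -!bopMA [ptail _ F \oB (_ \oB _)]bopMA (ptail_sub p_mul) //.
by rewrite -bopMBr /ptail bopMBl bopMIl.
Qed.

Lemma column_tight : cvg (colsum F @[F --> totally]) <-> tightL T.
Proof.
split=> [/cvg_netP hs|hT]; last first.
  (* The lower bound turns the Cauchy estimate for T^* P_F T in B(H) into one in A. *)
  have [C C0 hC] := rep_bounded_below hP onto.
  apply: cauchy_net => d d0; have T0 := opn_ge0 T.
  have k0 : 0 < C * opn T * 2 + 1 by rewrite ltr_wpDl // !mulr_ge0.
  have [F0 hF0] := hT _ (divr_gt0 d0 k0); exists F0 => F FF.
  apply: le_trans (hC _) _; rewrite (repB hP) !rep_colsum -bopMBl -bopMBr.
  have -> : psum (tproj ht e) F0 - psum (tproj ht e) F =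
    ptail (tproj ht e) F - ptail (tproj ht e) F0 by rewrite /ptail opprB [RHS]addrC subrKA.
  rewrite -bopMA bopMBl.
  have h : opn (adj T \oB (ptail (tproj ht e) F \oB T - ptail (tproj ht e) F0 \oB T)) <=
      opn T * (2 * (d / (C * opn T * 2 + 1))).
    apply: opnM_le; first by rewrite opn_adj.
    apply: le_trans (opnB _ _) _; rewrite mulr_natl mulr2n lerD //; exact: hF0.
  apply: le_trans (ler_wpM2l C0 h) _; rewrite !mulrA ler_pdivrMr //.
  by rewrite mulrC ler_wpM2l ?(ltW d0) // lerDl.
(* The norm limit must agree with the strong limit T^* T of T^* P_F T. The tails then represent the
   squares of Q_F T, hence the exponent 2 on [d] below. *)
set s := lim _ in hs; have sT : P s = adj T \oB T.
  apply: bop_ext => v; apply: nrm_close => d d0; have d2 : 0 < d / 2 by rewrite divr_gt0.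
  have v1 : 0 < nrm v + 1 by rewrite ltr_wpDl ?nrm_ge0.
  have T1 : 0 < opn T + 1 by rewrite ltr_wpDl ?opn_ge0.
  have [F [h1 h2]] := evtE (evtI (hs _ (divr_gt0 d2 v1)) (tensor_strong ht he (T v) (divr_gt0 d2 T1))).
  apply: le_trans (nrm_tri _ (P (colsum F) v) _) _; rewrite [leRHS]splitr lerD //.
    rewrite -bopBE -(repB hP); apply: le_trans (opnP _ _) _.
    apply: le_trans (ler_wpM2r (nrm_ge0 _) (le_trans (rep_contractive hP _) h1)) _.
    by rewrite mulrAC ler_pdivrMr // ler_wpM2l ?(ltW d2) // lerDl.
  rewrite nrmBC rep_colsum !bopME -bopLB.
  have -> : T v - psum (tproj ht e) F (T v) = ptail (tproj ht e) F (T v) by rewrite /ptail bopBE.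
  apply: le_trans (opnP _ _) _; rewrite opn_adj; apply: le_trans (ler_wpM2l (opn_ge0 _) h2) _.
  by rewrite mulrA ler_pdivrMr // mulrC ler_wpM2l ?(ltW d2) // lerDl.
move=> d d0; have d2 : 0 < d ^+ 2 by rewrite exprn_gt0.
apply: evtW (hs _ d2) => F hF; apply: opn_sq_le => [|v]; first exact: ltW.
rewrite -(rep_tail F sT); apply: le_trans (Re_le_nrm _) _; apply: le_trans (CauchySchwarz _ _) _.
rewrite [nrm v ^+ 2]expr2 mulrA ler_wpM2r ?nrm_ge0 //; apply: le_trans (opnP _ _) _.
by rewrite ler_wpM2r ?nrm_ge0 //; apply: le_trans (rep_contractive hP _) hF.
Qed.

(** Only membership of T^* T in the image of A is known, not convergence; Dini upgrades the
    automatic weak convergence of the partial sums to norm convergence. *)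
Lemma Dini_tight s : P s = adj T \oB T -> tightL T.
Proof.
move=> sT d d0; have d2 : 0 < d ^+ 2 by rewrite exprn_gt0.
have sq F v : complex.Re (inner (P (s - colsum F) v) v) = nrm (ptail (tproj ht e) F (T v)) ^+ 2.
  by rewrite rep_tail // -nrm_sq_adj.
have mono F G v : (F `<=` G)%fset ->
    complex.Re (inner (P (s - colsum G) v) v) <= complex.Re (inner (P (s - colsum F) v) v).
  move=> FG; rewrite !sq ler_sqr ?nnegrE ?nrm_ge0 //.
  exact: (ptail_mono p_adj p_mul).
have weak mu d' : functional mu -> 0 < d' -> evt (fun F => nrm (mu (s - colsum F)) <= d').
  (* [mu] comes from a normal functional, for which weak operator convergence of the bounded net T^*
     P_F T is enough. *)
  move=> /dual_spaceP/onto[w hw wE] d'0.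
  have T0 : 0 <= opn T * opn T by rewrite mulr_ge0 ?opn_ge0.
  have Tb F : opn (P (colsum F)) <= opn T * opn T.
    rewrite rep_colsum; apply: opnM_le => //; rewrite -[opn T]mulr1.
    by apply: opnM_le; [rewrite opn_adj|exact: (psum_le1 p_adj p_mul)].
  have wk u v d1 : 0 < d1 ->
      evt (fun F => nrm (inner (P s u) v - inner (P (colsum F) u) v) <= d1).
    move=> d10; have v1 : 0 < nrm (T v) + 1 by rewrite ltr_wpDl ?nrm_ge0.
    apply: evtW (tensor_strong ht he (T u) (divr_gt0 d10 v1)) => F hF.
    rewrite sT rep_colsum -innerBl !bopME -bopLB adjP'.
    have -> : T u - psum (tproj ht e) F (T u) = ptail (tproj ht e) F (T u).
      by rewrite /ptail bopBE.
    apply: le_trans (CauchySchwarz _ _) _; apply: le_trans (ler_wpM2r (nrm_ge0 _) hF) _.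
    by rewrite mulrAC ler_pdivrMr // ler_wpM2l ?(ltW d10) // lerDl.
  apply: evtW (normal_weak hw T0 Tb wk d'0) => F.
  by rewrite -normalB // -(repB hP) wE.
apply: evtW (Dini hP mono weak d2) => F hF; apply: opn_sq_le => [|v]; first exact: ltW.
by rewrite -nrm_sq_adj bopME -sq.
Qed.

End Column.

Lemma summable_tight (x : bop L L) :
  tight_matrix ht e rep_image x <-> exists a : J -> J -> A,
    (forall i j, vslicer t x (e j) (e i) (P (a i j))) /\ row_col_summable a.
Proof.
have col j (a : J -> J -> A) : (forall i j, P (a i j) = slice ht e x i j) ->
    forall k, P (a k j) = adj (V k) \oB (x \oB V j).
  by move=> ha k; rewrite ha /slice bopMA.
have row i (a : J -> J -> A) : (forall i j, P (a i j) = slice ht e x i j) ->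
    forall k, P (cstar (a i k)) = adj (V k) \oB (adj x \oB V i).
  by move=> ha k; rewrite (rep_star hP) ha -slice_adj /slice bopMA.
(* A row sum for x is a column sum for the adjoint of x, whose entries in column i are the
   [cstar (a i k)]. *)
have rowE i (a : J -> J -> A) : (fun j => cmul (a i j) (cstar (a i j))) =
    (fun j => cmul (cstar (cstar (a i j))) (cstar (a i j))).
  by apply/funext => j; rewrite cstarK.
split=> [[x1 x2 x3]|[a [ha sa]]].
  have [a ha] := choice (fun ij : J * J => x1 ij.1 ij.2).
  pose b i j := a (i, j); have hb i j : P (b i j) = slice ht e x i j by rewrite -ha.
  exists b; split=> [i j|i].
    split; first exact: bop_bounded_op.
    by move=> u v; rewrite hb /slice !bopME adjP' !tensE.
  split; last by apply/(column_tight (col i b hb)).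
  by rewrite rowE; apply/(column_tight (row i b hb)).
have ha' i j : P (a i j) = slice ht e x i j.
  apply: bop_ext => u; apply: inner_ext => v; have [_ h] := ha i j.
  by rewrite inner_conj [RHS]inner_conj h /slice !bopME adjP' !tensE.
split=> [i j|j|i].
- by exists (a i j).
- by apply/(column_tight (col j a ha')); have [] := sa j.
- by apply/(column_tight (row i a ha')); have [h _] := sa i; rewrite -rowE.
Qed.

End Multipliers.

(** * Enveloping algebras and slice maps *)

Section Enveloping.
Variables (R : realType) (A : cstarAlgType R) (H : hilbertType R).
Implicit Types (Phi : (A -> R[i]) -> R[i]) (mu nu : A -> R[i]).

Lemma bidualP Phi : bidual Phi <->
  (forall (k : R[i]) mu nu, functional mu -> functional nu ->
    Phi (fun a => k * mu a + nu a) = k * Phi mu + Phi nu) /\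
  exists2 M : R, 0 <= M & forall mu (m : R), functional mu -> 0 <= m ->
    (forall a, nrm (mu a) <= m * nrm a) -> nrm (Phi mu) <= M * m.
Proof.
split=> [[lP [c hc]]|[lP [M M0 hM]]]; split.
- by move=> k mu nu /dual_spaceP hmu /dual_spaceP hnu; apply: lP.
- exists (nrm c) => [|mu m /dual_spaceP hmu m0 hm]; first exact: nrm_ge0.
  have m0' : 0 <= m%:C by rewrite lecR.
  have mE : `|m%:C| = m%:C by rewrite ger0_norm.
  rewrite -{1}(ger0_norm m0) -nrmR; apply: nrm_leP; rewrite mE.
  by apply: hc => // a; rewrite nrm_leCM.
- by move=> k mu nu /dual_spaceP hmu /dual_spaceP hnu; apply: lP.
- exists M%:C => mu m /dual_spaceP hmu m0 hm.
  have mE : m = (complex.Re m)%:C by rewrite RRe_real // ger0_real.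
  rewrite mE -rmorphM nrm_leC; apply: hM => // [|a].
    by rewrite -lecR -mE.
  by rewrite -nrm_leCM -mE.
Qed.

Lemma functional_mull mu a : functional mu -> functional (fun b => mu (cmul a b)).
Proof.
move=> [lm [M M0 hM]]; split=> [c u v|]; first by rewrite cmulDr cmulZr lm.
exists (M * nrm a) => [|b]; first by rewrite mulr_ge0 ?nrm_ge0.
by apply: le_trans (hM _) _; rewrite -mulrA ler_wpM2l ?nrm_cmul.
Qed.

Lemma functional_star mu : functional mu -> functional (fun a => (mu (cstar a))^*%R).
Proof.
move=> [lm [M M0 hM]]; split=> [c u v|].
  by rewrite cstarD cstarZ lm rmorphD rmorphM /= conjCK.
by exists M => // a; rewrite nrm_conj -[X in _ * X](nrm_cstar a); exact: hM.
Qed.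

Variable P : A -> bop H H.
Hypothesis hP : star_rep P.
Notation pi := (fun a : A => P a : H -> H).

Lemma functional_normal (w : (H -> H) -> R[i]) : normal_functional H w ->
  functional (fun a => w (P a)).
Proof.
move=> hw; split=> [c a b|]; first by rewrite (rep_lin hP) normal_lin.
have [M M0 hM] := normal_bound hw; exists M => // a; apply: le_trans (hM _) _.
by rewrite ler_wpM2l // rep_contractive.
Qed.

Lemma enveloping_bop (S : H -> H) : enveloping pi S -> exists S' : bop H H, S = S'.
Proof. by move=> [Phi _ [/bounded_opP]]. Qed.

(* The functional representing a product is the Arens product. *)
Lemma enveloping_mul (S T : bop H H) :
  enveloping pi S -> enveloping pi T -> enveloping pi (S \oB T).
Proof.
move=> [Phi bPhi [_ hS]] [Psi bPsi [_ hT]].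
have [lPhi [M M0 hM]] := proj1 (bidualP _) bPhi.
have [lPsi [N N0 hN]] := proj1 (bidualP _) bPsi.
have fPsi mu : functional mu -> functional (fun a => Psi (fun b => mu (cmul a b))).
  move=> fmu; have [lm [m m0 hm]] := fmu; split=> [c u v|].
    rewrite -lPsi; [|exact: functional_mull..].
    by congr Psi; apply/funext => b; rewrite cmulDl cmulZl lm.
  exists (N * m) => [|a]; first exact: mulr_ge0.
  rewrite -mulrA; apply: hN; [exact: functional_mull|by rewrite mulr_ge0 ?nrm_ge0|].
  by move=> b; apply: le_trans (hm _) _; rewrite -mulrA ler_wpM2l ?nrm_cmul.
exists (fun mu => Phi (fun a => Psi (fun b => mu (cmul a b)))).
  apply/bidualP; split=> [k mu nu fmu fnu|].
    rewrite -lPhi; [|exact: fPsi..]; congr Phi; apply/funext => a.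
    by rewrite lPsi //; exact: functional_mull.
  exists (M * N) => [|mu m fmu m0 hm]; first exact: mulr_ge0.
  rewrite -mulrA; apply: hM; [exact: fPsi|exact: mulr_ge0|move=> a].
  rewrite -mulrA; apply: hN; [exact: functional_mull|by rewrite mulr_ge0 ?nrm_ge0|].
  by move=> b; apply: le_trans (hm _) _; rewrite -mulrA ler_wpM2l ?nrm_cmul.
split; first exact: bop_bounded_op.
move=> w hw; have [w1 hw1 w1E] := normal_comp (bopI H) T hw.
rewrite (_ : w (S \oB T) = w1 S); last by rewrite w1E bopMIl.
rewrite hS //; congr Phi; apply/funext => a.
have [w2 hw2 w2E] := normal_comp (P a) (bopI H) hw.
rewrite w1E bopMIl (_ : w (P a \oB T) = w2 T); last by rewrite w2E bopMIr.
by rewrite hT //; congr Psi; apply/funext => b; rewrite w2E bopMIr (rep_mul hP).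
Qed.

Lemma enveloping_adj (S : bop H H) : enveloping pi S -> enveloping pi (adj S).
Proof.
move=> [Phi bPhi [_ hS]]; have [lPhi [M M0 hM]] := proj1 (bidualP _) bPhi.
(* The involution of the bidual: conjugate [Phi] on the adjoint functional. *)
exists (fun mu => (Phi (fun a => (mu (cstar a))^*%R))^*%R).
  apply/bidualP; split=> [k mu nu fmu fnu|].
    rewrite -[k]conjCK -rmorphM -rmorphD /= -lPhi; [|exact: functional_star..].
    by congr (_^*%R); congr Phi; apply/funext => a; rewrite rmorphD rmorphM /= conjCK.
  exists M => // mu m fmu m0 hm; rewrite nrm_conj; apply: hM => //.
    exact: functional_star.
  by move=> a; rewrite nrm_conj -[X in _ * X](nrm_cstar a); exact: hm.
split; first exact: bop_bounded_op.
move=> w hw; have [w1 hw1 w1E] := normal_adj hw.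
have -> : w (adj S) = (w1 S)^*%R by rewrite w1E conjCK.
rewrite hS //; congr (_^*%R); congr Phi; apply/funext => a.
by rewrite w1E (rep_star hP).
Qed.

End Enveloping.

Section SpanProducts.
Variables (R : realType) (L : hilbertType R).
Implicit Types (S : set (bop L L)) (X : set (L -> L)).

Lemma lin_span_bopM S (x y : bop L L) :
  (forall s s', S s -> S s' -> S (s \oB s')) ->
  lin_span S x -> lin_span S y -> lin_span S (x \oB y).
Proof.
move=> hS [m [c [s [Ss ->]]]] [n [d [r [Sr ->]]]].
rewrite bopMsuml; apply: lin_span_sum => i; rewrite bopMsumr; apply: lin_span_sum => j.
by rewrite bopMZl bopMZr scalerA; apply: lin_spanZ; apply: hS.
Qed.

Lemma lin_span_adj S (x : bop L L) :
  (forall s, S s -> S (adj s)) -> lin_span S x -> lin_span S (adj x).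
Proof.
move=> hS [m [c [s [Ss ->]]]]; rewrite adj_sum; apply: lin_span_sum => i.
by rewrite adjZ; apply: lin_spanZ; apply: hS.
Qed.

Lemma lin_span_bop S (f : L -> L) :
  lin_span [set g : L -> L | exists2 s : bop L L, S s & g = s] f <->
  exists2 x : bop L L, lin_span S x & f = x.
Proof.
split=> [[n [c [s [hs ->]]]]|[_ [n [c [s [hs ->]]]] ->]].
  have [r hr] := choice (fun i => let: ex_intro2 r h1 h2 := hs i in ex_intro _ r (conj h1 h2)).
  exists (\sum_(i < n) c i *: r i); first by exists n, c, r; split=> // i; exact: (hr i).1.
  by rewrite bop_fun_sum; apply: eq_bigr => i _; rewrite (hr i).2.
exists n, c, (fun i => s i : L -> L); split=> [i|]; first by exists (s i).
exact: bop_fun_sum.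
Qed.

Lemma weakstarP X (x : bop L L) : weakstar_closure X x <->
  forall (n : nat) (w : 'I_n -> (L -> L) -> R[i]) (d : R),
    (forall i, normal_functional L (w i)) -> 0 < d ->
    exists2 y, X y & forall i, nrm (w i x - w i y) < d.
Proof.
split=> [[_ h] n w d hw d0|h].
  have [|y Xy hy] := h n w d%:C hw; first by rewrite ltcR.
  by exists y => // i; rewrite -ltcR -nrmE.
split=> [|n w _ hw /posC[d d0 ->]]; first exact: bop_bounded_op.
by have [y Xy hy] := h n w d hw d0; exists y => // i; rewrite nrmE ltcR.
Qed.

Lemma weakstar_adj X (x : bop L L) :
  (forall y, X y -> exists2 y' : bop L L, y = y' & X (adj y')) ->
  weakstar_closure X x -> weakstar_closure X (adj x).
Proof.
move=> hX /weakstarP h; apply/weakstarP => n w d hw d0.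
have [v hv] := choice (fun i => let: ex_intro2 r h1 h2 := normal_adj (hw i) in
  ex_intro (fun r => normal_functional L r /\ _) r (conj h1 h2)).
have [|y Xy hy] := h n v d _ d0; first by move=> i; exact: (hv i).1.
have [y' yE Xy'] := hX y Xy; exists (adj y') => // i; have := hy i.
rewrite yE !(hv i).2 -(adjK y') -(adjK x) !adjK -rmorphB nrm_conj.
by [].
Qed.

(** Multiplication is only separately weak-* continuous, so two steps are made: first the right
    factor lies in [X] while the left one is approximated, then the right factor is approximated
    with the left one fixed. *)
Lemma weakstar_mul X (x y : bop L L) :
  (forall s, X s -> exists s' : bop L L, s = s') ->
  (forall s s' : bop L L, X s -> X s' -> X (s \oB s')) ->
  weakstar_closure X x -> weakstar_closure X y -> weakstar_closure X (x \oB y).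
Proof.
move=> Xb Xm /weakstarP hx /weakstarP hy.
have right s : X s -> exists2 s' : bop L L, s = s' & weakstar_closure X (x \oB s').
  move=> Xs; have [s' sE] := Xb s Xs; exists s' => //; rewrite sE in Xs.
  apply/weakstarP => n w d hw d0.
  have [v hv] := choice (fun i => let: ex_intro2 r h1 h2 := normal_comp (bopI L) s' (hw i) in
    ex_intro (fun r => normal_functional L r /\ _) r (conj h1 h2)).
  have [|z Xz hz] := hx n v d _ d0; first by move=> i; exact: (hv i).1.
  have [z' zE] := Xb z Xz; rewrite zE in Xz hz; exists (z' \oB s'); first exact: Xm.
  by move=> i; have := hz i; rewrite !(hv i).2 !bopMIl.
apply/weakstarP => n w d hw d0; have d2 : 0 < d / 2 by rewrite divr_gt0.
have [v hv] := choice (fun i => let: ex_intro2 r h1 h2 := normal_comp x (bopI L) (hw i) in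
  ex_intro (fun r => normal_functional L r /\ _) r (conj h1 h2)).
have [|s Xs hs] := hy n v _ _ d2; first by move=> i; exact: (hv i).1.
have [s' sE /weakstarP hxs] := right s Xs; rewrite sE in hs.
have [z Xz hz] := hxs n w _ hw d2; exists z => // i.
apply: le_lt_trans (nrm_tri _ (w i (x \oB s')) _) _; rewrite [ltRHS]splitr ltrD //.
by have := hs i; rewrite !(hv i).2 !bopMIr.
Qed.

End SpanProducts.

Section TensorFunctionals.
Variables (R : realType) (H K L : hilbertType R) (t : H -> K -> L).
Hypothesis ht : hilbert_tensor t.

Lemma ell2_shell (xi : nat -> H) (eta : nat -> K) : ell2 xi -> ell2 eta ->
  ell2 (fun k => t (xi (shell k).1) (eta (shell k).2)).
Proof.
move=> [M hM] [N hN]; exists (M * N) => n.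
apply: le_trans (_ : \sum_(0 <= k < n * n) nrm (t (xi (shell k).1) (eta (shell k).2)) ^+ 2 <= _).
  have nn : (n <= n * n)%N by nia.
  by rewrite [leRHS](big_cat_nat _ (n := n)) //= lerDl sumr_ge0 // => *; rewrite sqr_ge0.
rewrite (sum_shell (fun i j => nrm (t (xi i) (eta j)) ^+ 2)).
under eq_bigr do under eq_bigr do rewrite (nrm_tensor ht) exprMn.
under eq_bigr do rewrite -mulr_sumr.
rewrite -mulr_suml ler_pM //; by rewrite sumr_ge0 // => *; rewrite sqr_ge0.
Qed.

(* [phi] is the tensor product of [w1] and the functional of [xi], [eta]. *)
Lemma normal_tensor (w1 : (H -> H) -> R[i]) (xi eta : nat -> K) :
  normal_functional H w1 -> ell2 xi -> ell2 eta ->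
  exists2 phi, normal_functional L phi & forall (X : bop L L) (Y : bop H H),
    (forall u v, tends (fun n => \sum_(0 <= k < n) inner (X (t u (xi k))) (t v (eta k)))
      (inner (Y u) v)) -> phi X = w1 Y.
Proof.
move=> /normalP[xi1 [eta1 [hx1 he1 h1]]] hx he.
have [phi hphi phiE] := normal_exists (ell2_shell hx1 hx) (ell2_shell he1 he).
exists phi => // X Y hXY.
have [M hM] := ell2D hx1 he1; have [N hN] := ell2D hx he.
pose g i j := inner (X (t (xi1 i) (xi j))) (t (eta1 i) (eta j)).
apply: (@Fubini_shell R g (fun i => opn X * (nrm (xi1 i) ^+ 2 + nrm (eta1 i) ^+ 2))
  (fun j => nrm (xi j) ^+ 2 + nrm (eta j) ^+ 2) (opn X * M) N
  (fun i => inner (Y (xi1 i)) (eta1 i))) => //.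
- move=> i j; apply: le_trans (CauchySchwarz _ _) _.
  apply: le_trans (ler_wpM2r (nrm_ge0 _) (opnP _ _)) _; rewrite -!mulrA ler_wpM2l ?opn_ge0 //.
  rewrite !(nrm_tensor ht); set a := nrm (xi1 i); set b := nrm (xi j).
  set c := nrm (eta1 i); set d := nrm (eta j).
  have a0 : 0 <= a := nrm_ge0 _; have b0 : 0 <= b := nrm_ge0 _.
  have c0 : 0 <= c := nrm_ge0 _; have d0 : 0 <= d := nrm_ge0 _.
  rewrite mulrACA; apply: ler_pM; rewrite ?mulr_ge0 //.
    by have := sqr_ge0 (a - c); have := sqr_ge0 (a + c); lra.
  by have := sqr_ge0 (b - d); have := sqr_ge0 (b + d); lra.
- by move=> i; rewrite mulr_ge0 ?opn_ge0 // addr_ge0 ?sqr_ge0.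
- by move=> j; rewrite addr_ge0 ?sqr_ge0.
- by move=> n; rewrite -mulr_sumr ler_wpM2l ?opn_ge0.
- exact: phiE.
- by move=> i; exact: hXY.
Qed.

End TensorFunctionals.

(** * Slice maps on the von Neumann algebra tensor product *)

Section EnvelopingTensor.
Variables (R : realType) (A B : cstarAlgType R) (H K L : hilbertType R) (t : H -> K -> L).
Hypothesis ht : hilbert_tensor t.
Variables (I J : choiceType) (f : I -> H) (e : J -> K).
Hypotheses (hf : orthonormal_basis f) (he : orthonormal_basis e).
Variables (P : A -> bop H H) (Q : B -> bop K K).
Hypotheses (hP : star_rep P) (hQ : star_rep Q).
Notation pi := (fun a : A => P a : H -> H).
Notation rho := (fun b : B => Q b : K -> K).
Hypotheses (ontoP : predual_onto pi) (ontoQ : predual_onto rho).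

Notation env := (env_tensor t pi rho).
Notation otens' := (otens ht hf he).

Let simple_tensors : set (bop L L) :=
  [set Z | exists (S : bop H H) (T : bop K K),
    [/\ enveloping pi S, enveloping rho T & Z = otens' S T]].

Let alg_tensorP (x : L -> L) : alg_tensor t (enveloping pi) (enveloping rho) x <->
  exists2 y : bop L L, lin_span simple_tensors y & x = y.
Proof.
rewrite -lin_span_bop /alg_tensor; set X := (X in lin_span X); set Y := (Y in _ <-> lin_span Y _).
suff -> : X = Y by [].
apply/seteqP; split=> Z.
  move=> [S [T [eS eT ->]]]; have [S' SE] := enveloping_bop eS; have [T' TE] := enveloping_bop eT.
  rewrite SE in eS *; rewrite TE in eT *; exists (otens' S' T').
    by exists S', T'.
  by rewrite (op_tensorE ht hf he).
move=> [_ [S [T [eS eT ->]]] ->]; exists (S : H -> H), (T : K -> K); split=> //.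
by rewrite (op_tensorE ht hf he).
Qed.

Let simple_mul s s' : simple_tensors s -> simple_tensors s' -> simple_tensors (s \oB s').
Proof.
move=> [S [T [eS eT ->]]] [S' [T' [eS' eT' ->]]]; exists (S \oB S'), (T \oB T').
by split; [exact: enveloping_mul|exact: enveloping_mul|rewrite otensM].
Qed.

Let simple_adj s : simple_tensors s -> simple_tensors (adj s).
Proof.
move=> [S [T [eS eT ->]]]; exists (adj S), (adj T).
by split; [exact: enveloping_adj|exact: enveloping_adj|rewrite adj_otens].
Qed.

Lemma env_tensor_adj (x : bop L L) : env x -> env (adj x).
Proof.
apply: weakstar_adj => y /alg_tensorP[z hz ->]; exists z => //.
by apply/alg_tensorP; exists (adj z) => //; exact: lin_span_adj simple_adj hz.
Qed.

(** Needed for x^* x and x x^*: membership in [SC] includes membership in this algebra, which is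
    assumed for [x] only. *)
Lemma env_tensor_mul (x y : bop L L) : env x -> env y -> env (x \oB y).
Proof.
apply: weakstar_mul => [s /alg_tensorP[z _ ->]|s s' /alg_tensorP[z hz sz] /alg_tensorP[z' hz' sz']].
  by exists z.
apply/alg_tensorP; exists (z \oB z'); first exact: lin_span_bopM simple_mul hz hz'.
by apply/funext => v; rewrite !bopME sz' sz.
Qed.

Lemma env_tensor_bop (x : L -> L) : env x -> exists x' : bop L L, x = x'.
Proof. by move=> [/bounded_opP]. Qed.

(** Both functionals are prescribed on elementary tensors of the enveloping algebras; normality
    extends the agreement to the weak-* closure, approximating for the two functionals at once. *)
Lemma predual_tensor_uniq mu lam phi phi' (x : bop L L) : env x ->
  predual_tensor t pi rho mu lam phi -> predual_tensor t pi rho mu lam phi' ->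
  phi x = phi' x.
Proof.
move=> /weakstarP hx [nphi hphi] [nphi' hphi'].
apply: nrm_close => d d0; have d2 : 0 < d / 2 by rewrite divr_gt0.
pose w (i : 'I_2) := if i == ord0 then phi else phi'.
have [|y /alg_tensorP[y' [n [c [s [hs ->]]]] ->] hy] := hx 2%N w _ _ d2.
  by move=> i; rewrite /w; case: ifP.
have eq : phi (\sum_(i < n) c i *: s i : bop L L) = phi' (\sum_(i < n) c i *: s i : bop L L).
  rewrite !normal_sum //; apply: eq_bigr => i _; congr (_ * _).
  have [S [T [[Phi bPhi rS] [Psi bPsi rT] ->]]] := hs i.
  by rewrite -(op_tensorE ht hf he) (hphi Phi Psi) // (hphi' Phi Psi).
apply: le_trans (nrm_tri _ (phi (\sum_(i < n) c i *: s i : bop L L)) _) _.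
rewrite [leRHS]splitr lerD //; first exact: ltW (hy ord0).
by rewrite eq nrmBC; exact: ltW (hy ord_max).
Qed.

Lemma predual_tensor_vector (u v : H) (z z' : K) :
  predual_tensor t pi rho (fun a => inner (P a u) v) (fun b => inner (Q b z) z')
    (fun x => inner (x (t u z)) (t v z')).
Proof.
split; first exact: normal_vector.
move=> Phi Psi S T _ _ [/bounded_opP[S' ->] hS] [/bounded_opP[T' ->] hT].
rewrite (op_tensorE ht hf he) otensE; have [_ _ -> _] := ht.
by rewrite -(hS _ (normal_vector u v)) -(hT _ (normal_vector z z')).
Qed.

Definition right_slices (x : L -> L) :=
  forall lam, dual_space lam -> exists a : A, slicer t pi rho lam x (fun mu => mu a).

Lemma right_slices_image (x : bop L L) i j : env x -> right_slices x ->
  rep_image P (slice ht e x i j).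
Proof.
move=> ex sx; have [|a ha] := sx (fun b => inner (Q b (e j)) (e i)).
  by apply/dual_spaceP; exact: (functional_normal hQ (normal_vector _ _)).
exists a; apply: bop_ext => u; apply: inner_ext => v.
rewrite inner_conj [RHS]inner_conj; congr (_^*%R).
have [|phi hphi phix] := ha (fun a => inner (P a u) v).
  by apply/dual_spaceP; exact: (functional_normal hP (normal_vector _ _)).
rewrite -phix (predual_tensor_uniq ex hphi (predual_tensor_vector u v (e j) (e i))).
by rewrite /slice !bopME adjP' !tensE.
Qed.

Section Slices.
Variable x : bop L L.
Hypothesis hx : forall i j, rep_image P (slice ht e x i j).

(** For vectors in the span of the basis the slice is a finite combination of entries; truncating
    [u] and [v] changes it little in norm, and the image of A is closed. *)
Lemma vector_slice_image (u v : K) :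
  rep_image P (adj (tens ht v) \oB x \oB tens ht u).
Proof.
have Nc := rep_image_closed hP ontoP; have [N0 Nl] := rep_image_linear hP.
have fin F G : rep_image P (adj (tens ht (psum (bproj e) F v)) \oB x \oB
    tens ht (psum (bproj e) G u)).
  rewrite /psum !bop_sumE !tens_sum adj_sum bopMsuml bopMsuml.
  apply: linear_set_sum => // i; rewrite bopMsumr; apply: linear_set_sum => // j.
  rewrite /bproj !rank1E !tensZ adjZ bopMZl bopMZl bopMZr scalerA -[_ *: _]addr0.
  exact: Nl (hx i j) N0.
apply: Nc => d d0; have d2 : 0 < d / 2 by rewrite divr_gt0.
have x0 := opn_ge0 x; have u0 := nrm_ge0 u; have v0 := nrm_ge0 v.
have k1 : 0 < opn x * nrm u + 1 by rewrite ltr_wpDl ?mulr_ge0.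
have k2 : 0 < opn x * nrm v + 1 by rewrite ltr_wpDl ?mulr_ge0.
have [F hF] := evtE (basis_strong he v (divr_gt0 d2 k1)).
have [G hG] := evtE (basis_strong he u (divr_gt0 d2 k2)).
exists (adj (tens ht (psum (bproj e) F v)) \oB x \oB tens ht (psum (bproj e) G u)) => //.
apply: le_trans (opn_tri _ (adj (tens ht (psum (bproj e) F v)) \oB x \oB tens ht u) _) _.
rewrite [leRHS]splitr lerD //.
  rewrite -bopMBl -bopMBl -adjB -tensB.
  have -> : v - psum (bproj e) F v = ptail (bproj e) F v by rewrite /ptail bopBE.
  have h : opn (adj (tens ht (ptail (bproj e) F v)) \oB x \oB tens ht u) <=
      d / 2 / (opn x * nrm u + 1) * opn x * nrm u.
    apply: opnM_le (opn_tens ht u); apply: opnM_le => //.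
    by rewrite opn_adj; apply: le_trans (opn_tens ht _) hF.
  apply: le_trans h _; rewrite -mulrA mulrAC ler_pdivrMr // ler_wpM2l ?(ltW d2) //.
  by rewrite lerDl.
rewrite -bopMBr -tensB.
have -> : u - psum (bproj e) G u = ptail (bproj e) G u by rewrite /ptail bopBE.
have h : opn (adj (tens ht (psum (bproj e) F v)) \oB x \oB tens ht (ptail (bproj e) G u)) <=
    nrm v * opn x * (d / 2 / (opn x * nrm v + 1)).
  apply: opnM_le; last exact: le_trans (opn_tens ht _) hG.
  apply: opnM_le => //; rewrite opn_adj; apply: le_trans (opn_tens ht _) _.
  apply: le_trans (opnP _ _) _; rewrite ler_piMl //.
  exact: (psum_le1 (bproj_adj e) (bproj_mul he)).
apply: le_trans h _; rewrite mulrA ler_pdivrMr // mulrC ler_wpM2l ?(ltW d2) //.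
by rewrite mulrC lerDl.
Qed.

(** The vector slices are dominated by |x| times a summable sequence; the lower bound of [P] makes
    their series converge in A itself. *)
Lemma normal_slice_image (xi eta : nat -> K) : ell2 xi -> ell2 eta ->
  exists a : A, forall u v,
    tends (fun n => \sum_(0 <= k < n) inner (x (t u (xi k))) (t v (eta k))) (inner (P a u) v).
Proof.
move=> hxi heta; have [b hb] := choice (fun k => vector_slice_image (xi k) (eta k)).
pose s n := \sum_(0 <= k < n) b k.
have x0 := opn_ge0 x; have [C C0 hC] := rep_bounded_below hP ontoP.
have [M hM] := ell2D hxi heta.
have [a ha] : exists l : A, s n @[n --> \oo] --> l.
  apply: cauchy_seq => d d0; have k0 : 0 < C * opn x + 1 by rewrite ltr_wpDl ?mulr_ge0.
  have m0 k : 0 <= nrm (xi k) ^+ 2 + nrm (eta k) ^+ 2 by rewrite addr_ge0 ?sqr_ge0.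
  have [N hN] := bounded_tail m0 hM (divr_gt0 d0 k0); exists N => n Nn.
  rewrite nrmBC sum_natB //; apply: le_trans (hC _) _; rewrite (rep_sum hP).
  have h : opn (\sum_(N <= k < n) P (b k)) <= opn x * (d / (C * opn x + 1)).
    apply: le_trans (opn_sum _ _ _) _.
    apply: le_trans (_ : \sum_(N <= k < n) opn x * (nrm (xi k) ^+ 2 + nrm (eta k) ^+ 2) <= _).
      apply: ler_sum => k _; rewrite -hb.
      apply: le_trans (_ : nrm (eta k) * opn x * nrm (xi k) <= _).
        apply: opnM_le (opn_tens _ _); apply: opnM_le => //.
        by rewrite opn_adj; exact: opn_tens.
      rewrite [_ * opn x]mulrC -mulrA ler_wpM2l //.
      set p := nrm (eta k); set q := nrm (xi k).
      by have := sqr_ge0 (p - q); have := sqr_ge0 (p + q); lra.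
    by rewrite -mulr_sumr ler_wpM2l.
  apply: le_trans (ler_wpM2l C0 h) _; rewrite !mulrA ler_pdivrMr // mulrC.
  by rewrite ler_wpM2l ?(ltW d0) // lerDl.
exists a => u v; have {}ha : tends s a by apply/cvg_seqP.
have h1 : tends (fun n => inner (P (s n) u) v) (inner (P a u) v).
  apply: (@tends_comp _ _ _ s (fun y => inner (P y u) v) a (nrm u * nrm v) _ _ ha).
    by rewrite mulr_ge0 ?nrm_ge0.
  move=> y z; rewrite -innerBl -bopBE -(repB hP); apply: le_trans (CauchySchwarz _ _) _.
  rewrite mulrAC [nrm u * _]mulrC ler_wpM2r ?nrm_ge0 //.
  apply: le_trans (opnP _ _) _; rewrite ler_wpM2r ?nrm_ge0 //.
  exact: (rep_contractive hP).
apply: tends_ext h1 => n; rewrite (rep_sum hP) bop_sumE inner_suml; apply: eq_bigr => k _.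
by rewrite -hb !bopME adjP' !tensE.
Qed.

Lemma right_slices_of_image : right_slices x.
Proof.
move=> lam /ontoQ[w2 hw2 w2E].
have [xi [eta [hxi heta w2lim]]] := proj1 (normalP _) hw2.
have [a ha] := normal_slice_image hxi heta.
exists a => mu /ontoP[w1 hw1 w1E].
(* [phiE] is used twice: with [x] and its slice [P a] for the value of the pairing, and with S (x) T
   and its slice [w2 T *: S] to see that [phi] extends mu (x) lam. *)
have [phi hphi phiE] := normal_tensor ht hw1 hxi heta.
exists phi; last by rewrite -w1E; exact: phiE.
split=> // Phi Psi S T _ _ [/bounded_opP[S' ->] hS] [/bounded_opP[T' ->] hT].
rewrite (op_tensorE ht hf he) (phiE _ (w2 T' *: S')).
  rewrite -[_ *: S']addr0 normal_lin // normal0 // addr0 mulrC; congr (_ * _).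
    by rewrite hS //; congr Phi; apply/funext => b; rewrite w1E.
  by rewrite hT //; congr Psi; apply/funext => b; rewrite w2E.
move=> u v; rewrite bopZE innerZl mulrC; apply: tends_ext (tendsM (inner (S' u) v) (w2lim T')) => n.
rewrite mulr_sumr; apply: eq_bigr => k _; rewrite otensE.
by have [_ _ -> _] := ht.
Qed.

End Slices.

(** Tightness of the j-th column of [z] makes the matrix product converge in norm, so that it stays
    in the closed image of A. *)
Lemma slice_mul_image (x z : bop L L) i j :
  (forall i j, rep_image P (slice ht e x i j)) -> (forall i j, rep_image P (slice ht e z i j)) ->
  tight (tproj ht e) (z \oB tens ht (e j)) -> rep_image P (slice ht e (x \oB z) i j).
Proof.
move=> hx hz tz; have [N0 Nl] := rep_image_linear hP; have x0 := opn_ge0 x.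
apply: (rep_image_closed hP ontoP) => d d0; have x1 : 0 < opn x + 1 by rewrite ltr_wpDl.
have [F hF] := evtE (tz _ (divr_gt0 d0 x1)).
exists (\sum_(k <- F) (slice ht e x i k \oB slice ht e z k j)).
  by apply: linear_set_sum => // k; apply: (rep_image_mul hP).
have -> : \sum_(k <- F) (slice ht e x i k \oB slice ht e z k j) =
    adj (tens ht (e i)) \oB x \oB (psum (tproj ht e) F \oB (z \oB tens ht (e j))).
  rewrite /psum bopMsuml bopMsumr; apply: eq_bigr => k _.
  by rewrite /slice /tproj !bopMA.
have -> : slice ht e (x \oB z) i j = adj (tens ht (e i)) \oB x \oB (z \oB tens ht (e j)).
  by rewrite /slice !bopMA.
rewrite -bopMBr -{1}[z \oB _]bopMIl -bopMBl -/(ptail _ F).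
have h : opn (adj (tens ht (e i)) \oB x \oB (ptail (tproj ht e) F \oB (z \oB tens ht (e j)))) <=
    1 * opn x * (d / (opn x + 1)).
  apply: opnM_le => //; apply: opnM_le => //.
  by rewrite opn_adj; exact: opn_V.
apply: le_trans h _; rewrite mul1r mulrA ler_pdivrMr // mulrC ler_wpM2l ?(ltW d0) //.
by rewrite lerDl.
Qed.

Lemma right_slices_tight (x : bop L L) : env x ->
  [/\ right_slices x, right_slices (adj x \oB x) & right_slices (x \oB adj x)] <->
  tight_matrix ht e (rep_image P) x.
Proof.
move=> ex; have ex' := env_tensor_adj ex; split=> [[s1 s2 s3]|[x1 x2 x3]].
  have x1 i j := right_slices_image i j ex s1.
  have xx1 i j := right_slices_image i j (env_tensor_mul ex' ex) s2.
  have xx2 i j := right_slices_image i j (env_tensor_mul ex ex') s3.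
  split=> // j.
    have [b hb] := choice (fun k => x1 k j); have [s hs] := xx1 j j.
    (* Diagonal entries suffice: for the column T = x V_j, the operator T^* T is the (j, j) entry of
       x^* x. *)
    apply: (@Dini_tight _ _ _ _ _ _ ht _ _ he _ hP ontoP _ b _ s).
      by move=> k; rewrite -hb /slice !bopMA.
    by rewrite -hs /slice adjM !bopMA.
  have [b hb] := choice (fun k => rep_image_adj hP (x1 j k)); have [s hs] := xx2 j j.
  apply: (@Dini_tight _ _ _ _ _ _ ht _ _ he _ hP ontoP _ b _ s).
    by move=> k; rewrite -hb -slice_adj /slice !bopMA.
  by rewrite -hs /slice adjM adjK !bopMA.
have x1' i j : rep_image P (slice ht e (adj x) i j).
  by rewrite slice_adj; apply: (rep_image_adj hP).
split; apply: right_slices_of_image => // i j; exact: slice_mul_image.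
Qed.

End EnvelopingTensor.

(** * Exchange of the two factors, and the theorem *)

Section Flip.
Variables (R : realType) (H K L : hilbertType R) (t : H -> K -> L).
Notation t' := (fun k h => t h k).

Lemma op_tensor_flip (S : H -> H) (T : K -> K) : op_tensor t' T S = op_tensor t S T.
Proof.
rewrite /op_tensor; congr xget; apply/seteqP.
by split=> X [bX hX]; split=> // x y; rewrite hX.
Qed.

Lemma alg_tensor_flip (X : set (H -> H)) (Y : set (K -> K)) :
  alg_tensor t' Y X = alg_tensor t X Y.
Proof.
rewrite /alg_tensor; congr lin_span; apply/seteqP.
by split=> Z [S [T [hS hT ->]]]; exists T, S; split; rewrite // op_tensor_flip.
Qed.

Lemma min_tensor_flip (X : set (H -> H)) (Y : set (K -> K)) :
  min_tensor t' Y X = min_tensor t X Y.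
Proof. by rewrite /min_tensor alg_tensor_flip. Qed.

Variables (A B : cstarAlgType R) (P : A -> bop H H) (Q : B -> bop K K).
Notation pi := (fun a : A => P a : H -> H).
Notation rho := (fun b : B => Q b : K -> K).

Lemma env_tensor_flip : env_tensor t' rho pi = env_tensor t pi rho.
Proof. by rewrite /env_tensor /vn_tensor alg_tensor_flip. Qed.

Lemma predual_tensor_flip mu lam phi :
  predual_tensor t' rho pi lam mu phi <-> predual_tensor t pi rho mu lam phi.
Proof.
split=> -[nphi hphi]; split=> // Phi Psi S T bPhi bPsi rS rT.
  by rewrite -op_tensor_flip mulrC; apply: hphi.
by rewrite op_tensor_flip mulrC; apply: hphi.
Qed.

(** Lets the side of B be read off from the results on right slices, applied to the flipped tensor
    product. *)
Lemma left_slices (y : L -> L) :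
  (forall mu, dual_space mu -> exists b : B, slicel t pi rho mu y (fun lam => lam b)) <->
  right_slices t' Q P y.
Proof.
split=> h mu /h[b hb]; exists b => lam /hb[phi /predual_tensor_flip hphi phiy];
  by exists phi.
Qed.

End Flip.

Theorem theorem3p1 (R : realType) (A B : cstarAlgType R)
    (H K HK : hilbertType R) (t : H -> K -> HK)
    (pi : A -> H -> H) (rho : B -> K -> K)
    (I J : choiceType) (f : I -> H) (e : J -> K) (x : HK -> HK) :
  hilbert_tensor t ->
  representation pi -> nondegenerate_rep pi -> predual_onto pi ->
  representation rho -> nondegenerate_rep rho -> predual_onto rho ->
  orthonormal_basis f -> orthonormal_basis e ->
  env_tensor t pi rho x ->
  let P1 :=
    [/\ SC t pi rho x,
        SC t pi rho (adjoint x \o x) &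
        SC t pi rho (x \o adjoint x)] in
  let P2 :=
    multiplier_into (min_tensor t (unitisation pi) (compact_op K))
                    (min_tensor t (range pi) (compact_op K)) x /\
    multiplier_into (min_tensor t (compact_op H) (unitisation rho))
                    (min_tensor t (compact_op H) (range rho)) x in
  let P3 :=
    (exists a : J -> J -> A,
      (forall i j, vslicer t x (e j) (e i) (pi (a i j))) /\
      row_col_summable a) /\
    (exists b : I -> I -> B,
      (forall i j, vslicel t x (f j) (f i) (rho (b i j))) /\
      row_col_summable b) in
  (P1 <-> P2) /\ (P2 <-> P3).
Proof.
move=> ht /representation_bop[P hP ->] ndP ontoP /representation_bop[Q hQ ->] ndQ ontoQ hf he ex.
have [x' xE] := env_tensor_bop ex; move: ex; rewrite xE => {x xE}; move: x' => x ex.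
have ht' := tensor_flip ht.
have ex' : env_tensor (fun k h => t h k) (fun b : B => Q b : K -> K) (fun a : A => P a : H -> H) x.
  by rewrite env_tensor_flip.
pose TA := tight_matrix ht e (rep_image P) x.
pose TB := tight_matrix ht' f (rep_image Q) x.
have p1A := right_slices_tight ht hf he hP hQ ontoP ontoQ ex.
have p1B := right_slices_tight ht' he hf hQ hP ontoQ ontoP ex'.
have p2A := multiplier_tight ht hf he hP ontoP ndP x.
have p2B := multiplier_tight ht' he hf hQ ontoQ ndQ x.
have p3A := summable_tight ht he hP ontoP x.
have p3B := summable_tight ht' hf hQ ontoQ x.
(* Tightness says nothing about the enveloping tensor product, so this component of [SC] is supplied
   separately for the two products. *)
have e1 : env_tensor t (fun a : A => P a : H -> H) (fun b : B => Q b : K -> K) (adj x \oB x).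
  by apply: (env_tensor_mul ht hf he hP hQ) => //; exact: (env_tensor_adj ht hf he hP hQ).
have e2 : env_tensor t (fun a : A => P a : H -> H) (fun b : B => Q b : K -> K) (x \oB adj x).
  by apply: (env_tensor_mul ht hf he hP hQ) => //; exact: (env_tensor_adj ht hf he hP hQ).
rewrite adjointE; rewrite !(min_tensor_flip t) in p2B.
have h12 : TA /\ TB <-> multiplier_into
    (min_tensor t (unitisation (fun a : A => P a : H -> H)) (compact_op K))
    (min_tensor t (range (fun a : A => P a : H -> H)) (compact_op K)) x /\
    multiplier_into (min_tensor t (compact_op H) (unitisation (fun b : B => Q b : K -> K)))
    (min_tensor t (compact_op H) (range (fun b : B => Q b : K -> K))) x.
  by split=> -[/p2A h1 /p2B h2].
split.
  rewrite -h12; split=> [[[_ l1 r1] [_ l2 r2] [_ l3 r3]]|[/p1A[r1 r2 r3] /p1B[l1 l2 l3]]].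
    split; first exact/p1A.
    by apply/p1B; split; apply/left_slices.
  by split; split=> //; apply/left_slices.
by rewrite -h12; split=> -[/p3A h1 /p3B h2].
Qed.
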